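(* Let $F$ be an isoparametric polynomial of degree $g$ on $\mathbb{R}^{n+2}$, with associated multiplicities $m_1,m_2$, and let $\Phi=\frac1g\nabla F|_{S^{n+1}}:S^{n+1}\to S^{n+1}$ be its gradient map. Then the Brouwer degree of $\Phi$ is given by: (1) for $g=2$, $\deg\Phi=(-1)^{m_1+1}$; (2) for $g=3$, $\deg\Phi=(-1)^{m_1+1}+(-1)^{m_1+m_2+1}$; (3) for $g=4$, $\deg\Phi=(-1)^{m_1+1}+(-1)^{m_1+m_2+1}+(-1)^{m_2+1}$; (4) for $g=6$, $\deg\Phi=2\cdot(-1)^{m_1+1}+(-1)^{m_1+m_2+1}+(-1)^{m_2+1}-1$.
   Context: Isoparametric hypersurface: a connected oriented hypersurface $M$ of the unit sphere $S^{n+1}\subset\mathbb{R}^{n+2}$ (with oriented unit normal field $\xi$) whose principal curvatures are constant; $g$ denotes the number of distinct principal curvatures. Write them as $\lambda_i=\cot\theta_i$ with $\lambda_1>\cdots>\lambda_g$, $0<\theta_1<\dots<\theta_g<\pi$, where the principal curvatures are the eigenvalues of the shape operator $X\mapsto -D_X\xi$, and let $m_i$ be the multiplicity of $\lambda_i$. It is well known that $\theta_i=\theta_1+\frac{i-1}{g}\pi$, that $m_i=m_{i+2}$ and $m_2=m_g$ (so $m_1$, $m_2$ are the multiplicities of the maximal and the minimal principal curvature), and that $g\in\{1,2,3,4,6\}$ (Münzner). Isoparametric polynomial of $M$: let $\phi(x,t)=\cos t\cdot x+\sin t\cdot\xi_x$ for $x\in M$, $t\in\mathbb{R}$. Near a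 regular point of $\phi$, $\phi$ is a diffeomorphism of a neighbourhood $U$ onto an open set $V\subset S^{n+1}$; put $\tau(p)=\theta_1-t$ for $p=\phi(x,t)\in V$ and $F(rp)=r^g\cos(g\tau(p))$ for $r>0$, $p\in V$. It is well known (Münzner) that this function is the restriction of a homogeneous polynomial $F$ of degree $g$ on $\mathbb{R}^{n+2}$, uniquely determined by $M$, called the isoparametric polynomial of $M$. It satisfies the Cartan–Münzner equations $$|\nabla F|^2=g^2|x|^{2g-2},\qquad \Delta F=\tfrac{g^2}{2}(m_2-m_1)|x|^{g-2}.$$ In particular $\frac1g\nabla F$ maps $S^{n+1}$ into $S^{n+1}$. An isoparametric polynomial on $\mathbb{R}^{n+2}$ is a polynomial arising in this way from some connected oriented isoparametric hypersurface $M$ in $S^{n+1}$, and $m_1,m_2$ are the multiplicities belonging to $M$. Well known facts: for $s\in(-1,1)$ the level sets $\{p\in S^{n+1}:F(p)=s\}$ are compact connected isoparametric hypersurfaces parallel to $M$, and the level sets of $F|_{S^{n+1}}$ at $1$ and $-1$ are submanifolds (the focal submanifolds) of $S^{n+1}$ of codimension $m_1+1$ and $m_2+1$ respectively. *)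

(* Defs.v *)
From HB Require Import structures.
From mathcomp Require Import all_boot all_order all_algebra.
From mathcomp Require Import all_classical all_reals all_analysis.
From mathcomp Require mpoly.

Set Implicit Arguments.
Unset Strict Implicit.
Unset Printing Implicit Defensive.

Import Order.TTheory GRing.Theory Num.Theory.
Import numFieldNormedType.Exports.
(* The notations of [mpoly] clash with those of the analysis library. *)
Import (canonicals, coercions) mpoly.

Local Open Scope classical_set_scope.
Local Open Scope ring_scope.

(* Submanifolds, smooth maps and differentials are the extrinsic ones, as in
   Milnor's "Topology from the differentiable viewpoint": a map on an arbitrary
   subset is smooth when it extends locally to smooth maps on open sets of the
   ambient space. *)

Fixpoint Ck (R : realType) (V W : normedModType R) (k : nat)
    (O : set V) (f : V -> W) : Prop :=
  if k is k'.+1 then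
    (forall x, O x -> differentiable f x) /\
    (forall v, Ck k' O (fun x => 'd f x v))
  else forall x, O x -> {for x, continuous f}.

Definition smooth_on (R : realType) (V W : normedModType R)
    (O : set V) (f : V -> W) : Prop := forall k, Ck k O f.

Definition smooth_map (R : realType) (V W : normedModType R)
    (A : set V) (f : V -> W) : Prop :=
  forall x, A x -> exists (O : set V) (h : V -> W),
    [/\ open O, O x, smooth_on O h & forall y, A y -> O y -> h y = f y].

Definition diffeomorphism (R : realType) (V W : normedModType R)
    (A : set V) (B : set W) (f : V -> W) : Prop :=
  [/\ smooth_map A f, f @` A = B &
      exists2 h : W -> V, smooth_map B h & forall x, A x -> h (f x) = x].

Definition relatively_open (T : topologicalType) (A B : set T) : Prop :=
  exists2 O : set T, open O & B = A `&` O.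

Definition submanifold (R : realType) (V : normedModType R) (d : nat)
    (M : set V) : Prop :=
  forall x, M x -> exists (B : set V) (O : set 'rV[R]_d) (f : 'rV[R]_d -> V),
    [/\ relatively_open M B, B x, open O & diffeomorphism O B f].

Definition curve_through (R : realType) (V : normedModType R) (A : set V)
    (x v : V) (c : R -> V) : Prop :=
  [/\ c 0 = x, \forall t \near (0 : R), A (c t) & is_derive (0 : R) (1 : R) c v].

Definition tangent (R : realType) (V : normedModType R) (A : set V) (x : V)
  : set V := [set v | exists c, curve_through A x v c].

(* The differential at [x], in the direction [v] tangent to [A] at [x], of a
   map [f] defined on [A]; it depends only on the values of [f] on [A].  For a
   smooth map on a submanifold the choice made by [xget] is irrelevant, the
   derivative of [f] being the same along all curves with velocity [v]. *)
Definition dmap (R : realType) (V W : normedModType R) (A : set V)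
    (f : V -> W) (x v : V) : W :=
  xget 0 [set w | exists2 c, curve_through A x v c &
                             is_derive (0 : R) (1 : R) (f \o c) w].

Definition regular_point (R : realType) (V W : normedModType R) (A : set V)
    (B : set W) (f : V -> W) (x : V) : Prop :=
  A x /\ set_bij (tangent A x) (tangent B (f x)) (dmap A f x).

(* The norm of ['rV[R]_n] in the library is the sup norm, hence this explicit
   Euclidean product. *)
Definition dot (R : realType) (n : nat) (u v : 'rV[R]_n) : R :=
  \sum_(i < n) u 0 i * v 0 i.

Definition sphere (R : realType) (n : nat) : set 'rV[R]_n :=
  [set x | dot x x = 1].
Arguments sphere R n : clear implicits.

(* For [f] mapping the sphere to itself, the matrix (acting on row vectors) of
   the endomorphism of the ambient space which maps [x] to [f x] and restricts
   to the differential of [f] from the tangent space at [x] to the one at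
   [f x].  With the sphere oriented as the boundary of the ball (a tangent
   frame at [x] is positive iff [x] followed by this frame is a positive frame
   of the ambient space), the differential is an isomorphism iff the
   determinant is nonzero, and it preserves (reverses) the orientation iff the
   determinant is positive (negative). *)
Definition sphere_diff_mx (R : realType) (n : nat)
    (f : 'rV[R]_n -> 'rV[R]_n) (x : 'rV[R]_n) : 'M[R]_n :=
  lin1_mx (fun v => dot v x *: f x
                    + dmap (sphere R n) f x (v - dot v x *: x)).

Definition local_degree (R : realType) (n : nat)
    (f : 'rV[R]_n -> 'rV[R]_n) (x : 'rV[R]_n) : int :=
  sgz (\det (sphere_diff_mx f x)).

Definition sphere_fiber (R : realType) (n : nat)
    (f : 'rV[R]_n -> 'rV[R]_n) (y : 'rV[R]_n) : set 'rV[R]_n :=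
  [set x | sphere R n x /\ f x = y].

Definition sphere_regular_value (R : realType) (n : nat)
    (f : 'rV[R]_n -> 'rV[R]_n) (y : 'rV[R]_n) : Prop :=
  sphere R n y /\
  (forall x, sphere_fiber f y x -> \det (sphere_diff_mx f x) != 0).

(* [f] restricts to a smooth self-map of the unit sphere of R^n, of Brouwer
   degree [d]: regular values exist, and at each of them the preimages counted
   with signs add up to [d]. *)
Definition brouwer_degree (R : realType) (n : nat)
    (f : 'rV[R]_n -> 'rV[R]_n) (d : int) : Prop :=
  [/\ smooth_map (sphere R n) f,
      forall x, sphere R n x -> sphere R n (f x),
      exists y, sphere_regular_value f y &
      forall y, sphere_regular_value f y ->
        finite_set (sphere_fiber f y) /\
        \sum_(x \in sphere_fiber f y) local_degree f x = d].

Definition has_dim (R : realType) (n : nat) (A : set 'rV[R]_n) (d : nat)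
  : Prop := exists2 U : {vspace 'rV[R]_n}, A = [set` U] & (\dim U)%N = d.

Definition shape_operator (R : realType) (n : nat) (M : set 'rV[R]_n)
    (xi : 'rV[R]_n -> 'rV[R]_n) (x v : 'rV[R]_n) : 'rV[R]_n :=
  - dmap M xi x v.

Definition principal_space (R : realType) (n : nat) (M : set 'rV[R]_n)
    (xi : 'rV[R]_n -> 'rV[R]_n) (x : 'rV[R]_n) (a : R) : set 'rV[R]_n :=
  [set v | tangent M x v /\ shape_operator M xi x v = a *: v].

Definition cot (R : realType) (t : R) : R := cos t / sin t.

(* [M], with unit normal field [xi], is an isoparametric hypersurface of the
   sphere S^(n+1) with exactly [g] distinct principal curvatures
   cot (theta 1) > ... > cot (theta g), of multiplicities m 1, ..., m g.  The
   values of [theta] and [m] outside 1..g are irrelevant. *)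
Record isoparametric (R : realType) (n g : nat) (M : set 'rV[R]_n.+2)
    (xi : 'rV[R]_n.+2 -> 'rV[R]_n.+2) (theta : nat -> R) (m : nat -> nat)
  : Prop := {
  iso_nonempty : M !=set0;
  iso_connected : connected M;
  iso_sphere : M `<=` sphere R n.+2;
  iso_submanifold : submanifold n M;
  iso_normal_smooth : smooth_map M xi;
  iso_normal_unit : forall x, M x -> dot (xi x) (xi x) = 1;
  iso_normal_sphere : forall x, M x -> dot (xi x) x = 0;
  iso_normal : forall x v, M x -> tangent M x v -> dot (xi x) v = 0;
  iso_theta_range : forall i, (1 <= i <= g)%N -> 0 < theta i < pi;
  iso_theta_incr : forall i j, (1 <= i < j)%N -> (j <= g)%N ->
    theta i < theta j;
  iso_mult_gt0 : forall i, (1 <= i <= g)%N -> (0 < m i)%N;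
  iso_mult : forall x i, M x -> (1 <= i <= g)%N ->
    has_dim (principal_space M xi x (cot (theta i))) (m i);
  iso_all_curvatures : forall x a v, M x -> principal_space M xi x a v ->
    v != 0 -> exists2 i, (1 <= i <= g)%N & a = cot (theta i)
}.

(* the normal exponential map (x, t) |-> cos t x + sin t xi_x *)
Definition normal_map (R : realType) (n : nat)
    (xi : 'rV[R]_n -> 'rV[R]_n) (p : 'rV[R]_n * R) : 'rV[R]_n :=
  cos p.2 *: p.1 + sin p.2 *: xi p.1.

Definition peval (R : realType) (n : nat) (F : mpoly.mpoly n R)
    (x : 'rV[R]_n) : R := mpoly.meval (fun i => x 0 i) F.

(* The last equation is F (r p) = r^g cos (g tau(p)) with
   tau(p) = theta1 - t for p = normal_map xi (x, t). *)
Definition isoparametric_polynomial_of (R : realType) (n g : nat)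
    (M : set 'rV[R]_n.+2) (xi : 'rV[R]_n.+2 -> 'rV[R]_n.+2) (theta1 : R)
    (F : mpoly.mpoly n.+2 R) : Prop :=
  F \is mpoly.ishomog1 g (@mpoly.mdeg n.+2) /\
  forall q, regular_point (M `*` [set: R]) (sphere R n.+2) (normal_map xi) q ->
    exists (U : set ('rV[R]_n.+2 * R)%type) (V : set 'rV[R]_n.+2),
      [/\ relatively_open (M `*` [set: R]) U, U q,
          relatively_open (sphere R n.+2) V,
          diffeomorphism U V (normal_map xi) &
          forall x t r, U (x, t) -> 0 < r ->
            peval F (r *: normal_map xi (x, t))
            = r ^+ g * cos (g%:R * (theta1 - t))].

(* m_2 is the multiplicity of the minimal curvature; for [g = 1] it is that of
   the only curvature, hence [minn 2 g]. *)
Definition isoparametric_polynomial (R : realType) (n g m1 m2 : nat)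
    (F : mpoly.mpoly n.+2 R) : Prop :=
  exists (M : set 'rV[R]_n.+2) (xi : 'rV[R]_n.+2 -> 'rV[R]_n.+2)
         (theta : nat -> R) (m : nat -> nat),
    [/\ isoparametric g M xi theta m,
        isoparametric_polynomial_of g M xi (theta 1%N) F,
        m1 = m 1%N & m2 = m (minn 2 g)].

Definition gradient_map (R : realType) (n g : nat) (F : mpoly.mpoly n R)
    (x : 'rV[R]_n) : 'rV[R]_n :=
  g%:R^-1 *: \row_(i < n) peval (mpoly.mderiv i F) x.

(* Main.v *)
(* Along a normal great circle, with angle tau measured so that F = cos (g tau),
   the map Phi = grad F / g is tau |-> (1 - g) tau.  On the open set covered by
   the tubes around M this is differentiated along M: a principal direction of
   curvature cot (theta i) is an eigenvector of Hess F with eigenvalue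
   g sin (theta i - t') / sin (theta i - t), where t' = g theta 1 - (g - 1) t is
   the parameter of the image.  As Hess F has no poles,
   sin (g (theta i - theta 1)) = 0, so the angles are pi / g apart.  The Laplacian
   of F depends on t only, hence its gradient has no normal component at the
   focal points; this is Cartan's identity sum_i m_i cot (theta i - theta j) = 0
   and gives the periodicity of the multiplicities.  Consequently det (Hess F)
   is an explicit function of F, and every identity between polynomials obtained
   so far extends from an open subset of the sphere to the whole sphere.

   If |F y| < 1, then F maps the fiber of Phi over y bijectively onto the g - 1
   numbers cos z with 0 < z < pi and cos ((g - 1) z) = F y, one for each of the
   intervals j pi < (g - 1) z < (j + 1) pi, on which the sign of det (Hess F) is
   constant.  If F y = 1 or -1 and y is a regular value, a compactness argument
   leaves only g = 2, or g = 3 and F y = 1, where the fiber is {F(y) y} or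
   {y, -y}. *)

Require Import Defs.
From mathcomp Require Import all_boot all_order all_algebra.
From mathcomp Require Import all_classical all_reals all_analysis.
From mathcomp Require Import ring lra.
From mathcomp Require mpoly.

Set Implicit Arguments.
Unset Strict Implicit.
Unset Printing Implicit Defensive.

Import Order.TTheory GRing.Theory Num.Theory.
Import numFieldNormedType.Exports.
Import (canonicals, coercions) mpoly.

Local Open Scope classical_set_scope.
Local Open Scope ring_scope.

(** * Trigonometric polynomials *)

(** [M] is not assumed complete, so its normal great circles sweep out only part of the sphere, and
    over a general point [y] no normal of [M] is at hand. The plane of the missing normal circle is
    recovered as the span of [y] and [Phi y]: on a genuine normal circle, [Phi (a y + b Phi y)] is a
    combination of [y] and [Phi y] whose coefficients are polynomials in [F y]. This identity makes
    sense on the whole sphere and extends to it; there it yields [F (Phi x) = T_(g-1) (F x)] with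
    the Chebyshev polynomial [T_(g-1)], a formula for the preimages of [y], and their uniqueness.

    The compactness argument excludes critical values. Let [F y = 1] or [-1], and suppose that the
    fibers over the nonfocal points near [y] contain points at which [F] stays in a fixed compact
    part of the interval (-1, 1). A limit of such points is a preimage [x] of [y] with
    [F x = cos z], [0 < z < pi]. Since [F y = cos ((g - 1) z)], the sine of [(g - 1) z] vanishes,
    and with it one of the factors of the determinant of the Hessian at [x]. *)

Section Subalgebra.
Variables (R : realType) (T : Type) (C : (T -> R) -> Prop).

(** The closure rules are proved once and used for four classes: trigonometric polynomials,
    polynomial functions, continuous functions and differentiable functions. *)
Definition fun_subalgebra : Prop :=
  [/\ forall a, C (fun _ => a),
      forall f g, C f -> C g -> C (fun x => f x + g x) &
      forall f g, C f -> C g -> C (fun x => f x * g x)].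

Hypothesis hC : fun_subalgebra.

Lemma subalgebra_cst a : C (fun _ => a).
Proof. by case: hC. Qed.

Lemma subalgebraD f g : C f -> C g -> C (fun x => f x + g x).
Proof. by case: hC => _ h _; apply: h. Qed.

Lemma subalgebraM f g : C f -> C g -> C (fun x => f x * g x).
Proof. by case: hC => _ _ h; apply: h. Qed.

Lemma subalgebra_ext f g : f =1 g -> C f -> C g.
Proof. by move=> /funext ->. Qed.

Lemma subalgebraN f : C f -> C (fun x => - f x).
Proof.
move=> hf; apply: (@subalgebra_ext (fun x => (-1) * f x)).
  by move=> x; rewrite mulN1r.
by apply: subalgebraM => //; apply: subalgebra_cst.
Qed.

Lemma subalgebraB f g : C f -> C g -> C (fun x => f x - g x).
Proof. by move=> hf hg; apply: subalgebraD => //; apply: subalgebraN. Qed.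

Lemma subalgebraX f k : C f -> C (fun x => f x ^+ k).
Proof.
move=> hf; elim: k => [|k IHk]; first exact: subalgebra_cst.
apply: (@subalgebra_ext (fun x => f x * f x ^+ k)).
  by move=> x; rewrite exprS.
exact: subalgebraM.
Qed.

Lemma subalgebra_sum (I : Type) (r : seq I) (P : pred I) (f : I -> T -> R) :
  (forall i, C (f i)) -> C (fun x => \sum_(i <- r | P i) f i x).
Proof.
move=> hf; elim: r => [|i r IHr].
  by apply: subalgebra_ext (subalgebra_cst 0) => x; rewrite big_nil.
case hP: (P i); last by apply: subalgebra_ext IHr => x; rewrite big_cons hP.
apply: subalgebra_ext (subalgebraD (hf i) IHr) => x.
by rewrite big_cons hP.
Qed.

Lemma subalgebra_prod (I : Type) (r : seq I) (P : pred I) (f : I -> T -> R) :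
  (forall i, C (f i)) -> C (fun x => \prod_(i <- r | P i) f i x).
Proof.
move=> hf; elim: r => [|i r IHr].
  by apply: subalgebra_ext (subalgebra_cst 1) => x; rewrite big_nil.
case hP: (P i); last by apply: subalgebra_ext IHr => x; rewrite big_cons hP.
apply: subalgebra_ext (subalgebraM (hf i) IHr) => x.
by rewrite big_cons hP.
Qed.

Lemma subalgebra_horner (p : {poly R}) f : C f -> C (fun x => p.[f x]).
Proof.
move=> hf; apply: (@subalgebra_ext (fun x => \sum_(i < size p) p`_i * f x ^+ i)).
  by move=> x; rewrite horner_coef.
apply: subalgebra_sum => i; apply: subalgebraM; first exact: subalgebra_cst.
exact: subalgebraX.
Qed.

Lemma subalgebra_peval n (p : mpoly.mpoly n R) (G : T -> 'rV[R]_n) :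
  (forall i, C (fun s => G s 0 i)) -> C (fun s => peval p (G s)).
Proof.
move=> hG; apply: (@subalgebra_ext (fun s => \sum_(m <- mpoly.msupp p)
    mpoly.mcoeff m p * \prod_(i < n) G s 0 i ^+ m i)).
  by move=> x; rewrite /peval mpoly.mevalE.
apply: subalgebra_sum => m; apply: subalgebraM; first exact: subalgebra_cst.
by apply: subalgebra_prod => i; apply: subalgebraX.
Qed.

Lemma subalgebra_det n (A : T -> 'M[R]_n) :
  (forall i j, C (fun s => A s i j)) -> C (fun s => \det (A s)).
Proof.
move=> hA; rewrite /determinant; apply: subalgebra_sum => s.
by apply: subalgebraM; [exact: subalgebra_cst|exact: subalgebra_prod].
Qed.

Lemma subalgebra_dot n (u v : T -> 'rV[R]_n) :
  (forall i, C (fun s => u s 0 i)) -> (forall i, C (fun s => v s 0 i)) ->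
  C (fun s => dot (u s) (v s)).
Proof. by move=> hu hv; apply: subalgebra_sum => i; apply: subalgebraM. Qed.

End Subalgebra.

Section TrigPoly.
Variable R : realType.
Implicit Types f g : R -> R.

Definition trigpoly f : Prop :=
  exists A B : {poly R}, forall s, f s = A.[cos s] + sin s * B.[cos s].

Lemma trigpoly_subalgebra : fun_subalgebra trigpoly.
Proof.
split=> [a|f g [A [B hf]] [A' [B' hg]]|f g [A [B hf]] [A' [B' hg]]].
- by exists a%:P, 0 => s; rewrite !hornerE.
- by exists (A + A'), (B + B') => s; rewrite hf hg !hornerD; ring.
- exists (A * A' + (1%:P - 'X^2) * (B * B')), (A * B' + B * A') => s.
  rewrite hf hg !(hornerXn, hornerD, hornerN, hornerM, hornerC).
  by rewrite -sin2cos2; ring.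
Qed.

Lemma trigpoly_cos : trigpoly (@cos R).
Proof. by exists 'X, 0 => s; rewrite !hornerE. Qed.

Lemma trigpoly_sin : trigpoly (@sin R).
Proof. by exists 0, 1 => s; rewrite !hornerE. Qed.

Lemma trigpoly_cos_sin_lin (a : R) (k : nat) :
  trigpoly (fun s => cos (a + k%:R * s)) /\
  trigpoly (fun s => sin (a + k%:R * s)).
Proof.
have S := trigpoly_subalgebra.
elim: k => [|k [IHc IHs]].
  split.
    apply: (subalgebra_ext _ (subalgebra_cst S (cos a))) => s.
    by rewrite mul0r addr0.
  apply: (subalgebra_ext _ (subalgebra_cst S (sin a))) => s.
  by rewrite mul0r addr0.
have e s : a + k.+1%:R * s = (a + k%:R * s) + s by rewrite -natr1; ring.
split.
  apply: (@subalgebra_ext _ _ _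
      (fun s => cos (a + k%:R * s) * cos s - sin (a + k%:R * s) * sin s)).
    by move=> s; rewrite e [RHS]cosD.
  by apply: (subalgebraB S); apply: (subalgebraM S);
    first [exact: IHc|exact: IHs|exact: trigpoly_cos|exact: trigpoly_sin].
apply: (@subalgebra_ext _ _ _
    (fun s => sin (a + k%:R * s) * cos s + cos (a + k%:R * s) * sin s)).
  by move=> s; rewrite e [RHS]sinD.
by apply: (subalgebraD S); apply: (subalgebraM S);
  first [exact: IHc|exact: IHs|exact: trigpoly_cos|exact: trigpoly_sin].
Qed.

Lemma trigpoly_cosB (a : R) (k : nat) : trigpoly (fun s => cos (a - k%:R * s)).
Proof.
apply: (subalgebra_ext _ (trigpoly_cos_sin_lin (- a) k).1) => s.
by rewrite -cosN; congr cos; ring.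
Qed.

Lemma trigpoly_shift f a : trigpoly f -> trigpoly (fun s => f (s + a)).
Proof.
move=> [A [B hf]]; have S := trigpoly_subalgebra.
have hc : trigpoly (fun s => cos (s + a)).
  apply: (subalgebra_ext _ (trigpoly_cos_sin_lin a 1).1) => s.
  by rewrite mul1r addrC.
have hs : trigpoly (fun s => sin (s + a)).
  apply: (subalgebra_ext _ (trigpoly_cos_sin_lin a 1).2) => s.
  by rewrite mul1r addrC.
apply: (@subalgebra_ext _ _ _
    (fun s => A.[cos (s + a)] + sin (s + a) * B.[cos (s + a)])).
  by move=> s; rewrite hf.
apply: (subalgebraD S); last apply: (subalgebraM S) => //;
  exact: (subalgebra_horner S).
Qed.

(* On an interval where [cos] is injective, [A(c) + s B(c) = 0] forces
   [A^2 = (1 - X^2) B^2], whose leading coefficients have opposite signs. *)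
Lemma trigpoly_eq0_near0 f e : trigpoly f -> 0 < e ->
  (forall s, 0 < s < e -> f s = 0) -> forall s, f s = 0.
Proof.
move=> [A [B hf]] e0 hz.
pose d := Num.min e pi.
have d0 : 0 < d by rewrite lt_min e0 pi_gt0.
(* With [i.+2] instead of [i.+1] these points stay strictly below [d], where [f] is known to vanish.
   Their cosines are [size N] distinct roots of [N], one more than a nonzero [N] can have. *)
have hdi (i : nat) : 0 < d / i.+2%:R < d.
  rewrite divr_gt0 //= ltr_pdivrMr // ltr_pMr // ltr1n //.
pose N := A ^+ 2 - (1 - 'X^2) * B ^+ 2.
have N0 : N = 0.
  apply/eqP/negP => /negP N0.
  pose rs := [seq cos (d / i.+2%:R) | i <- iota 0 (size N)].
  suff : (size rs < size N)%N by rewrite size_map size_iota ltnn.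
  apply: max_poly_roots => //.
    apply/allP => _ /mapP[i _ ->].
    have /andP[h1 h2] := hdi i.
    have : f (d / i.+2%:R) = 0.
      by apply: hz; rewrite h1 (lt_le_trans h2) // ge_min lexx.
    rewrite hf => /eqP; rewrite addr_eq0 => /eqP hAB.
    rewrite /root /N -polyC1.
    rewrite !(horner_exp, hornerD, hornerN, hornerM, hornerC, hornerX).
    rewrite hAB sqrrN exprMn.
    by rewrite -sin2cos2 subrr.
  rewrite map_inj_in_uniq ?iota_uniq // => i j _ _ hij.
  have hin (k : nat) : d / k.+2%:R \in `[0, pi].
    have /andP[h1 h2] := hdi k; rewrite in_itv /= (ltW h1) /=.
    by rewrite (le_trans (ltW h2)) // ge_min lexx orbT.
  have /(congr1 (fun x => d / x)) := cos_inj (hin i) (hin j) hij.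
  rewrite !invf_div !mulrA ![d * _]mulrC.
  rewrite !mulfK ?gt_eqF // => /eqP; rewrite eqr_nat => /eqP.
  by case.
have hB : B = 0.
  apply/eqP/negP => /negP B0.
  have : lead_coef (A ^+ 2) = lead_coef ((1 - 'X^2) * B ^+ 2).
    by congr lead_coef; apply/eqP; rewrite -subr_eq0 -/N N0.
  rewrite lead_coef_exp [RHS]lead_coefM [in RHS]lead_coef_exp.
  have -> : lead_coef (1 - 'X^2 : {poly R}) = -1.
    rewrite addrC lead_coefDl ?lead_coefN ?lead_coefXn //.
    by rewrite size_polyN size_polyXn size_poly1.
  move=> h; have : 0 < lead_coef B ^+ 2.
    by rewrite lt_neqAle sqr_ge0 andbT eq_sym sqrf_eq0 lead_coef_eq0.
  have := sqr_ge0 (lead_coef A); rewrite h; lra.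
have hA : A = 0.
  move/eqP: N0; rewrite /N hB expr0n /= mulr0 subr0 expf_eq0 /=.
  by move/eqP.
by move=> s; rewrite hf hA hB !hornerE.
Qed.

Lemma trigpoly_eq0 f a b : trigpoly f -> a < b ->
  (forall s, a < s < b -> f s = 0) -> forall s, f s = 0.
Proof.
move=> hf hab hz s.
have h0 : forall s, 0 < s < b - a -> f (s + a) = 0.
  by move=> t /andP[t0 t1]; apply: hz; lra.
have := trigpoly_eq0_near0 (trigpoly_shift a hf) _ h0 (s - a).
by rewrite subrK; apply; lra.
Qed.

Lemma trigpoly_eq f g a b : trigpoly f -> trigpoly g -> a < b ->
  (forall s, a < s < b -> f s = g s) -> f =1 g.
Proof.
move=> hf hg hab hz s; apply/eqP; rewrite -subr_eq0; apply/eqP.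
apply: (trigpoly_eq0 (subalgebraB trigpoly_subalgebra hf hg) hab) => t ht.
by rewrite hz // subrr.
Qed.

End TrigPoly.

(** * Calculus of polynomials on Euclidean space *)

Section Dot.
Variables (R : realType) (n : nat).
Implicit Types (u v w : 'rV[R]_n) (a : R).

Lemma dotE u v : dot u v = (u *m v^T) 0 0.
Proof. by rewrite mxE; apply: eq_bigr => i _; rewrite mxE. Qed.

Lemma dotC u v : dot u v = dot v u.
Proof. by apply: eq_bigr => i _; rewrite mulrC. Qed.

Lemma dotDl u v w : dot (u + v) w = dot u w + dot v w.
Proof. by rewrite !dotE mulmxDl mxE. Qed.

Lemma dotZl a u v : dot (a *: u) v = a * dot u v.
Proof. by rewrite !dotE -scalemxAl mxE. Qed.

Lemma dotNl u v : dot (- u) v = - dot u v.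
Proof. by rewrite -scaleN1r dotZl mulN1r. Qed.

Lemma dotBl u v w : dot (u - v) w = dot u w - dot v w.
Proof. by rewrite dotDl dotNl. Qed.

Lemma dotDr u v w : dot w (u + v) = dot w u + dot w v.
Proof. by rewrite dotC dotDl !(dotC w). Qed.

Lemma dotZr a u v : dot u (a *: v) = a * dot u v.
Proof. by rewrite dotC dotZl dotC. Qed.

Lemma dotNr u v : dot u (- v) = - dot u v.
Proof. by rewrite dotC dotNl dotC. Qed.

Lemma dotBr u v w : dot w (u - v) = dot w u - dot w v.
Proof. by rewrite dotDr dotNr. Qed.

Lemma dot0l u : dot 0 u = 0.
Proof. by rewrite -(scale0r 0) dotZl mul0r. Qed.

Lemma dot0r u : dot u 0 = 0.
Proof. by rewrite dotC dot0l. Qed.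

Definition dot_bilinear := (dotDl, dotDr, dotBl, dotBr, dotNl, dotNr, dotZl, dotZr).

Lemma dot_ge0 u : 0 <= dot u u.
Proof. by apply: sumr_ge0 => i _; rewrite -expr2 sqr_ge0. Qed.

Lemma dot_eq0 u : (dot u u == 0) = (u == 0).
Proof.
apply/idP/eqP => [|->]; last by rewrite dot0l.
rewrite psumr_eq0 => [/allP h|i _]; last by rewrite -expr2 sqr_ge0.
apply/rowP => i; rewrite mxE; have := h i (mem_index_enum i).
by rewrite -expr2 sqrf_eq0 => /eqP.
Qed.

Lemma dot_gt0 u : u != 0 -> 0 < dot u u.
Proof. by move=> u0; rewrite lt_neqAle eq_sym dot_eq0 u0 dot_ge0. Qed.

Lemma unit_normalize u : u != 0 ->
  dot ((Num.sqrt (dot u u))^-1 *: u) ((Num.sqrt (dot u u))^-1 *: u) = 1.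
Proof.
move=> u0; have h := dot_gt0 u0.
rewrite dotZl dotZr mulrA -invfM -expr2 sqr_sqrtr ?(ltW h) // mulVf //.
by rewrite gt_eqF.
Qed.

Lemma exists_unit_orthogonal k (X : 'M[R]_(k, n)) : (k < n)%N ->
  exists2 w : 'rV[R]_n, dot w w = 1 & w *m X^T = 0.
Proof.
move=> kn; have h : kermx X^T != 0.
  rewrite -mxrank_eq0 mxrank_ker -lt0n subn_gt0.
  by apply: leq_ltn_trans kn; rewrite mxrank_tr rank_leq_row.
have w0 : nz_row (kermx X^T) != 0 by rewrite nz_row_eq0.
exists ((Num.sqrt (dot (nz_row (kermx X^T)) (nz_row (kermx X^T))))^-1 *:
  nz_row (kermx X^T)); first exact: unit_normalize.
rewrite -scalemxAl (sub_kermxP (nz_row_sub _)) scaler0 //.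
Qed.

End Dot.

Lemma dot_mulmx (R : realType) n m (u : 'rV[R]_m) (A : 'M[R]_(m, n))
  (v : 'rV[R]_n) : dot (u *m A) v = dot u (v *m A^T).
Proof. by rewrite !dotE trmx_mul trmxK mulmxA. Qed.

Section Deriv.
Variable R : realType.
Implicit Types f g : R -> R.

Lemma is_derive_rVP n (c : R -> 'rV[R]_n) (s : R) v :
  is_derive s (1 : R) c v <->
  forall i, is_derive s (1 : R) (fun t => c t 0 i) (v 0 i).
Proof.
split=> [[dc ec] i|h].
  split; first by have /derivable_mxP := dc; apply.
  by rewrite -ec derive_mx // mxE.
have dc : derivable c s 1.
  by apply/derivable_mxP => i j; rewrite ord1; case: (h j).
split=> //; rewrite derive_mx //; apply/rowP => i; rewrite !mxE.
by case: (h i).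
Qed.

Lemma is_derive_unique (V : normedModType R) (c : R -> V) (s : R) v w :
  is_derive s (1 : R) c v -> is_derive s (1 : R) c w -> v = w.
Proof. by move=> [_ <-] [_ <-]. Qed.

Lemma is_derive_add (V : normedModType R) (f g : R -> V) (s : R) df dg :
  is_derive s (1 : R) f df -> is_derive s (1 : R) g dg ->
  is_derive s (1 : R) (fun t => f t + g t) (df + dg).
Proof. by move=> hf hg; exact: is_deriveD. Qed.

Lemma is_derive_mul f g (s : R) df dg :
  is_derive s (1 : R) f df -> is_derive s (1 : R) g dg ->
  is_derive s (1 : R) (fun t => f t * g t) (df * g s + f s * dg).
Proof.
move=> hf hg; rewrite addrC [df * _]mulrC; exact: is_deriveM.
Qed.

Lemma is_derive_const (V : normedModType R) (a : V) (s : R) :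
  is_derive s (1 : R) (fun _ => a) 0.
Proof. exact: is_derive_cst. Qed.

Lemma is_derive_bigsum (I : Type) (r : seq I) (P : pred I)
    (f : I -> R -> R) (df : I -> R) (s : R) :
  (forall i, is_derive s (1 : R) (f i) (df i)) ->
  is_derive s (1 : R) (fun t => \sum_(i <- r | P i) f i t)
    (\sum_(i <- r | P i) df i).
Proof.
move=> h; elim: r => [|i r IHr].
  under eq_fun do rewrite big_nil; rewrite big_nil.
  exact: is_derive_const.
under eq_fun do rewrite big_cons; rewrite big_cons.
case: (P i) => //; exact: is_derive_add.
Qed.

Lemma is_derive_scale n f (c : R -> 'rV[R]_n) (s : R) df dc :
  is_derive s (1 : R) f df -> is_derive s (1 : R) c dc ->
  is_derive s (1 : R) (fun t => f t *: c t) (df *: c s + f s *: dc).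
Proof.
move=> hf /is_derive_rVP hc; apply/is_derive_rVP => i.
rewrite !mxE; under eq_fun do rewrite mxE.
exact: is_derive_mul.
Qed.

Lemma is_derive_comp1 f g (s : R) df dg :
  is_derive s (1 : R) g dg -> is_derive (g s) (1 : R) f df ->
  is_derive s (1 : R) (fun t => f (g t)) (dg * df).
Proof. by move=> hg hf; rewrite mulrC; exact: is_derive1_comp. Qed.

Lemma is_derive_lin (a b s : R) :
  is_derive s (1 : R) (fun t : R => a + b * t) b.
Proof.
have := is_derive_add (is_derive_const a s)
  (is_derive_mul (is_derive_const b s) (is_derive_id s (1 : R))).
by rewrite mul0r !add0r mulr1.
Qed.

Lemma is_derive_cosl (a b s : R) :
  is_derive s (1 : R) (fun t => cos (a + b * t)) (- (b * sin (a + b * s))).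
Proof.
have := is_derive_comp1 (is_derive_lin a b s) (is_derive_cos (a + b * s)).
by rewrite mulrN.
Qed.

Lemma is_derive_sinl (a b s : R) :
  is_derive s (1 : R) (fun t => sin (a + b * t)) (b * cos (a + b * s)).
Proof.
exact: (is_derive_comp1 (is_derive_lin a b s) (is_derive_sin (a + b * s))).
Qed.

End Deriv.

(** * Gradient and Hessian of a polynomial; Euler's identities *)

Section Gradient.
Variables (R : realType) (n : nat).
Implicit Types (p : mpoly.mpoly n R) (x v : 'rV[R]_n).

Definition grad p x : 'rV[R]_n := \row_i peval (mpoly.mderiv i p) x.

Definition hess p x : 'M[R]_n :=
  \matrix_(i, j) peval (mpoly.mderiv i (mpoly.mderiv j p)) x.

Lemma hess_sym p x : (hess p x)^T = hess p x.
Proof. by apply/matrixP => i j; rewrite !mxE mpoly.mderiv_comm. Qed.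

Lemma is_derive_peval p (c : R -> 'rV[R]_n) (s : R) v :
  is_derive s (1 : R) c v ->
  is_derive s (1 : R) (fun t => peval p (c t)) (dot v (grad p (c s))).
Proof.
move=> hc.
pose K p := is_derive s (1 : R) (fun t => peval p (c t)) (dot v (grad p (c s))).
rewrite -[is_derive _ _ _ _]/(K p).
have Kcst a : K (mpoly.mpolyC n a).
  rewrite /K (_ : dot _ _ = 0); last first.
    apply: big1 => i _.
    by rewrite mxE mpoly.mderivC /peval mpoly.meval0 mulr0.
  rewrite (_ : (fun t => _) = fun=> a); first exact: is_derive_const.
  by apply/funext => t; rewrite /peval mpoly.mevalC.
have KX i : K (mpoly.mpolyX R (mpoly.mnm1 i)).
  rewrite /K (_ : dot _ _ = v 0 i); last first.
    rewrite /dot (bigD1 i) //= big1 => [|j ji].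
      rewrite mxE mpoly.mderivX mpoly.mnm1E eqxx scale1r.
      rewrite (_ : mpoly.mnm_sub _ _ = mpoly.mnm0); last first.
        by apply/mpoly.mnmP => k; rewrite mpoly.mnmBE subnn mpoly.mnm0E.
      by rewrite mpoly.mpolyX0 /peval mpoly.meval1 mulr1 addr0.
    rewrite mxE mpoly.mderivX mpoly.mnm1E eq_sym (negbTE ji) scale0r.
    by rewrite /peval mpoly.meval0 mulr0.
  rewrite (_ : (fun t => _) = (fun t => c t 0 i)); last first.
    by apply/funext => t; rewrite /peval mpoly.mevalXU.
  by have /is_derive_rVP := hc; apply.
have KD q r : K q -> K r -> K (q + r).
  move=> hq hr; rewrite /K.
  rewrite (_ : (fun t => _) = fun t => peval q (c t) + peval r (c t)); last first.
    by apply/funext => t; rewrite /peval mpoly.mevalD.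
  rewrite (_ : dot _ _ = dot v (grad q (c s)) + dot v (grad r (c s))).
    exact: is_derive_add.
  rewrite -dotDr; congr dot; apply/rowP => i.
  by rewrite !mxE mpoly.mderivD /peval mpoly.mevalD.
have KM q r : K q -> K r -> K (q * r).
  move=> hq hr; rewrite /K.
  rewrite (_ : (fun t => _) = fun t => peval q (c t) * peval r (c t)); last first.
    by apply/funext => t; rewrite /peval mpoly.mevalM.
  rewrite (_ : dot _ _ = dot v (grad q (c s)) * peval r (c s) +
                         peval q (c s) * dot v (grad r (c s))).
    exact: is_derive_mul.
  rewrite [X in _ = X + _]mulrC -!dotZr -dotDr; congr dot; apply/rowP => i.
  by rewrite !mxE mpoly.mderivM /peval mpoly.mevalD !mpoly.mevalM mulrC.
rewrite (mpoly.mpolyE p); elim/big_ind: _ => [||m _].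
- by rewrite -(mpoly.mpolyC0 n R).
- exact: KD.
rewrite -mpoly.mul_mpolyC; apply: (KM) => //.
rewrite mpoly.mpolyXE_id; elim/big_ind: _ => [||i _].
- by rewrite -(mpoly.mpolyC1 n R).
- exact: KM.
elim: (mpoly.fun_of_multinom m i) => [|k IHk].
  by rewrite expr0 -(mpoly.mpolyC1 n R).
by rewrite exprS; apply: (KM).
Qed.

Lemma is_derive_grad p (c : R -> 'rV[R]_n) (s : R) v :
  is_derive s (1 : R) c v ->
  is_derive s (1 : R) (fun t => grad p (c t)) (v *m hess p (c s)).
Proof.
move=> hc; apply/is_derive_rVP => j.
under eq_fun do rewrite mxE.
rewrite (_ : (_ *m _) 0 j = dot v (grad (mpoly.mderiv j p) (c s))).
  exact: is_derive_peval.
by rewrite mxE; apply: eq_bigr => i _; rewrite !mxE.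
Qed.

Lemma is_derive_line x v (s : R) :
  is_derive s (1 : R) (fun t => x + t *: v) v.
Proof.
have := is_derive_add (is_derive_const x s)
  (is_derive_scale (is_derive_id s (1 : R)) (is_derive_const v s)).
by rewrite scaler0 addr0 add0r scale1r.
Qed.

Section Homogeneous.
Variables (d : nat) (p : mpoly.mpoly n R).
Hypothesis hp : p \is mpoly.ishomog1 d (@mpoly.mdeg n).

Lemma peval_homog (r : R) x : peval p (r *: x) = r ^+ d * peval p x.
Proof.
rewrite /peval !mpoly.mevalE mulr_sumr !big_seq; apply: eq_bigr => m hm.
have /mpoly.dhomogP/(_ _ hm) hd := hp.
rewrite mulrCA; congr (_ * _).
rewrite -hd -[mpoly.Measure.sort _ m]/(mpoly.mdeg m) mpoly.mdegE expr_sum.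
rewrite -big_split /=; apply: eq_bigr => i _.
by rewrite mxE exprMn.
Qed.

Lemma euler x : dot x (grad p x) = d%:R * peval p x.
Proof.
have h1 := is_derive_peval p (is_derive_line 0 x 1).
rewrite add0r scale1r in h1.
rewrite (_ : (fun t => _) = (fun t => t ^+ d * peval p x)) in h1; last first.
  by apply/funext => t; rewrite add0r peval_homog.
apply: is_derive_unique h1 _.
have hX : is_derive (1 : R) (1 : R) (fun t : R => t ^+ d) d%:R.
  split; first exact: exprn_derivable.
  by rewrite exp_derive expr1n [LHS]mulr1 [LHS]mulr1.
have := is_derive_mul hX (is_derive_const (peval p x) (1 : R)).
by rewrite mulr0 addr0.
Qed.

Lemma mderiv_homog i : mpoly.mderiv i p \is mpoly.ishomog1 d.-1 (@mpoly.mdeg n).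
Proof.
apply/mpoly.dhomogP => m; rewrite mpoly.mcoeff_msupp mpoly.mcoeff_mderiv => h.
have : mpoly.mnm_add m (mpoly.mnm1 i) \in mpoly.msupp p.
  by rewrite mpoly.mcoeff_msupp; apply: contraNneq h => ->; rewrite mul0rn.
have /mpoly.dhomogP hd := hp; move/hd => /= <-.
by rewrite mpoly.mdegD mpoly.mdeg1 addn1.
Qed.

End Homogeneous.

Lemma grad_homog d p (r : R) x : p \is mpoly.ishomog1 d (@mpoly.mdeg n) ->
  grad p (r *: x) = r ^+ d.-1 *: grad p x.
Proof.
move=> hp; apply/rowP => i; rewrite !mxE.
by rewrite (peval_homog (mderiv_homog hp i)).
Qed.

Lemma euler_hess d p x : p \is mpoly.ishomog1 d (@mpoly.mdeg n) ->
  x *m hess p x = d.-1%:R *: grad p x.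
Proof.
move=> hp; apply/rowP => j; rewrite !mxE -(euler (mderiv_homog hp j)).
by apply: eq_bigr => i _; rewrite !mxE.
Qed.

End Gradient.

(** * Continuity and compactness *)

Section Continuity.
Variables (R : realType) (n : nat).
Implicit Types (f : 'rV[R]_n -> R) (w : 'rV[R]_n).

Lemma continuous_subalgebra (T : topologicalType) :
  fun_subalgebra (fun f : T -> R => continuous f).
Proof.
split=> [a x|f g hf hg x|f g hf hg x]; first exact: cst_continuous.
  by apply: continuousD; [exact: hf|exact: hg].
by apply: continuousM; [exact: hf|exact: hg].
Qed.

Lemma continuous_coord i : continuous (fun w : 'rV[R]_n => w 0 i).
Proof. exact: coord_continuous. Qed.

Lemma continuous_peval (p : mpoly.mpoly n R) : continuous (peval p).
Proof.
by apply: (subalgebra_peval (continuous_subalgebra _)); exact: continuous_coord.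
Qed.

Lemma continuous_rV (T : topologicalType) (G : T -> 'rV[R]_n) :
  (forall i, continuous (fun x => G x 0 i)) -> continuous G.
Proof.
move=> h x; apply/cvgrPdist_le => /= e e0.
near=> y.
rewrite [leLHS]/Num.Def.normr/= mx_normrE (bigmax_le _ (ltW e0))//= => i _.
rewrite !mxE/= (ord1 i.1).
move: i; near: y; apply: filter_forall => /= i.
by have /cvgrPdist_le := h i.2 x; apply.
Unshelve. all: by end_near. Qed.

Lemma closed_preimage_eq f a : continuous f -> closed [set w | f w = a].
Proof.
move=> hf; apply: (@preimage_closed _ _ f [set x | x = a]); last exact: closed_eq.
by move=> x _; apply: hf.
Qed.

Lemma closed_preimage_le f a : continuous f -> closed [set w | f w <= a].
Proof.
move=> hf; apply: (@preimage_closed _ _ f [set x | x <= a]); last exact: closed_le.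
by move=> x _; apply: hf.
Qed.

Lemma subsphere_compact (A : set 'rV[R]_n) :
  A `<=` sphere R n -> closed A -> compact A.
Proof.
move=> hA cA; apply: bounded_closed_compact => //.
exists 1; split=> // M M1 w /hA hw /=.
rewrite [leLHS]/Num.Def.normr /= mx_normrE.
apply: bigmax_le => [|i _]; first by rewrite (le_trans ler01) // ltW.
rewrite (ord1 i.1) (le_trans _ (ltW M1)) // -(@ler_pXn2r _ 2) ?nnegrE //.
rewrite expr1n -normrX ger0_norm ?sqr_ge0 // -[leRHS]hw.
rewrite /dot (bigD1 i.2) //= -expr2 lerDl sumr_ge0 // => j _.
by rewrite -expr2 sqr_ge0.
Qed.

Lemma sphere_closed : closed (sphere R n).
Proof.
apply: closed_preimage_eq.
by apply: (subalgebra_dot (continuous_subalgebra _)); exact: continuous_coord.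
Qed.

End Continuity.

(** * The spectral theorem relative to an invariant subspace *)

Section Spectral.
Variables (R : realType) (N : nat).
Implicit Types (H : 'M[R]_N) (w : 'rV[R]_N).

(* Maximize the Rayleigh quotient on the orthogonal complement of the rows
   of [X], which is stable under [H]. *)
Lemma sym_eigenvector k H (X : 'M[R]_(k, N)) (C : 'M[R]_k) :
  H^T = H -> X *m H = C *m X -> (k < N)%N ->
  exists w (mu : R), [/\ dot w w = 1, w *m X^T = 0 & w *m H = mu *: w].
Proof.
move=> Hs XH kN.
pose A := [set w : 'rV[R]_N | dot w w = 1] `&` [set w | dot (w *m X^T) (w *m X^T) = 0].
have SC := continuous_subalgebra R 'rV[R]_N.
have cmul m (M : 'M[R]_(N, m)) i : continuous (fun w : 'rV[R]_N => (w *m M) 0 i).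
  rewrite (_ : (fun w => _) = fun w => \sum_j w 0 j * M j i); last first.
    by apply/funext => w; rewrite mxE.
  apply: (subalgebra_sum SC) => j; apply: (subalgebraM SC); first exact: continuous_coord.
  exact: (subalgebra_cst SC).
have AS : A `<=` sphere R N by move=> w [].
have cA : compact A.
  apply: subsphere_compact => //; apply: closedI; first exact: sphere_closed.
  by apply: closed_preimage_eq; apply: (subalgebra_dot SC) => i; apply: cmul.
have A0 : A !=set0.
  have [w w1 wX] := exists_unit_orthogonal X kN.
  by exists w; split => //=; rewrite wX dot0l.
have cf : continuous (fun w => dot (w *m H) w).
  by apply: (subalgebra_dot SC) => i; [exact: cmul|exact: continuous_coord].
have [c cA' cmax] := EVT_max_rV A0 cA (continuous_subspaceT cf).
move: cA'; rewrite inE => -[/= c1 /eqP]; rewrite dot_eq0 => /eqP cX.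
pose mu := dot (c *m H) c.
exists c, mu; split=> //.
have hle u : u *m X^T = 0 -> dot (u *m H) u <= mu * dot u u.
  move=> uX; have [->|u0] := eqVneq u 0; first by rewrite mul0mx !dot0l mulr0.
  have h := dot_gt0 u0.
  pose s := Num.sqrt (dot u u).
  have s2 : s ^+ 2 = dot u u by rewrite sqr_sqrtr ?(ltW h).
  have := cmax (s^-1 *: u); rewrite inE => /(_ _).
  rewrite -scalemxAl dotZl dotZr mulrA -invfM -expr2 s2 -/mu.
  rewrite [_ * dot _ _]mulrC ler_pdivrMr //; apply.
  split=> /=; first exact: unit_normalize.
  by rewrite -scalemxAl uX scaler0 dot0l.
have [z zE] : {z | z = c *m H - mu *: c} by exists (c *m H - mu *: c).
have zX : z *m X^T = 0.
  rewrite zE mulmxBl -scalemxAl cX scaler0 subr0 -mulmxA -[H]Hs -trmx_mul XH.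
  by rewrite trmx_mul mulmxA cX mul0mx.
pose K := dot (z *m H) z - mu * dot z z.
(* First variation at the maximum: the residual [z = c H - mu c] is itself an admissible direction,
   and moving [c] to [c + e z] changes the defect in [hle] by this quantity. *)
have hz (e : R) : e * (2 * dot z z) + e ^+ 2 * K <= 0.
  have := hle (c + e *: z); rewrite mulmxDl cX -scalemxAl zX scaler0 addr0.
  move=> /(_ erefl); rewrite mulmxDl -scalemxAl !dot_bilinear -/mu c1.
  have e1 : dot (z *m H) c = dot (c *m H) z by rewrite dot_mulmx Hs dotC.
  have e2 : dot z z = dot (c *m H) z - mu * dot c z.
    by rewrite {1}zE dotBl dotZl.
  rewrite e1 (dotC z c) {1}e2 /K; nra.
apply/eqP; rewrite -subr_eq0 -zE -dot_eq0.
have d0 := dot_ge0 z; set d := dot z z in d0 hz *.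
have K1 : 0 < `|K| + 1 by rewrite ltr_pwDr.
(* A step small enough for the linear term to dominate the quadratic one, so that [z] must be 0. *)
have := hz (d / (`|K| + 1)).
have -> : d / (`|K| + 1) * (2 * d) + (d / (`|K| + 1)) ^+ 2 * K =
  d ^+ 2 / (`|K| + 1) ^+ 2 * (2 * (`|K| + 1) + K).
  by field; rewrite gt_eqF.
have K2 : 0 < 2 * (`|K| + 1) + K.
  by have := ler_norm (- K); rewrite normrN; have := normr_ge0 K; lra.
rewrite pmulr_lle0 // => h.
rewrite -sqrf_eq0.
have : d ^+ 2 <= 0 by move: h; rewrite pmulr_lle0 // invr_gt0 exprn_gt0.
by move=> h'; rewrite eq_le h' sqr_ge0.
Qed.

(** Each new eigenvector is appended to [X], whose row space stays invariant; this is why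
    [sym_eigenvector] works in the complement of an arbitrary invariant row space. In the
    application the rows of [X] are a point and its normal, leaving an eigenbasis of the tangent
    space. *)
Lemma sym_eigenbasis k H (X : 'M[R]_(k, N)) (C : 'M[R]_k) :
  H^T = H -> X *m H = C *m X -> forall j, (k + j <= N)%N ->
  exists (Q : 'M[R]_(j, N)) (d : 'rV[R]_j),
    [/\ Q *m Q^T = 1%:M, Q *m X^T = 0 & Q *m H = diag_mx d *m Q].
Proof.
move=> Hs XH; elim=> [|j IHj] hj.
  exists 0, 0; split; last by rewrite mul0mx mulmx0.
  - by apply/matrixP => -[].
  - by rewrite mul0mx.
have [|Q [d [QQ QX QH]]] := IHj; first by apply: leq_trans hj; rewrite addnS.
have hY : col_mx X Q *m H = block_mx C 0 0 (diag_mx d) *m col_mx X Q.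
  by rewrite mul_col_mx mul_block_col XH QH !mul0mx addr0 add0r.
have [|w [mu [w1 wY wH]]] := sym_eigenvector Hs hY; first by rewrite -addnS.
move: wY; rewrite tr_col_mx mul_mx_row -[0]row_mx0 => /eq_row_mx[wX wQ].
have Qw : Q *m w^T = 0 by apply: trmx_inj; rewrite trmx_mul trmxK wQ trmx0.
suff : exists (Q' : 'M[R]_(1 + j, N)) (d' : 'rV[R]_(1 + j)),
  [/\ Q' *m Q'^T = 1%:M, Q' *m X^T = 0 & Q' *m H = diag_mx d' *m Q'] by [].
exists (col_mx w Q), (row_mx (const_mx mu) d); split.
- rewrite tr_col_mx mul_col_mx !mul_mx_row QQ Qw wQ.
  rewrite (_ : w *m w^T = 1%:M); first by rewrite -block_mxEv -scalar_mx_block.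
  by apply/matrixP => a b; rewrite !ord1 -dotE w1 mxE.
- by rewrite mul_col_mx wX QX col_mx0.
- rewrite mul_col_mx wH QH diag_mx_row mul_block_col !mul0mx addr0 add0r.
  congr col_mx; rewrite -mul_scalar_mx; congr (_ *m _).
  by apply/matrixP => a b; rewrite !ord1 !mxE.
Qed.

End Spectral.

(** * Polynomials on the sphere *)

Section SphereContinuation.
Variable R : realType.

Definition polyfun n (f : 'rV[R]_n -> R) : Prop :=
  exists p : mpoly.mpoly n R, forall x, f x = peval p x.

Lemma polyfun_subalgebra n : fun_subalgebra (@polyfun n).
Proof.
split=> [a|f g [p hp] [q hq]|f g [p hp] [q hq]].
- by exists (mpoly.mpolyC n a) => x; rewrite /peval mpoly.mevalC.
- by exists (p + q) => x; rewrite hp hq /peval mpoly.mevalD.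
- by exists (p * q) => x; rewrite hp hq /peval mpoly.mevalM.
Qed.

Lemma polyfun_peval n (p : mpoly.mpoly n R) : polyfun (peval p).
Proof. by exists p. Qed.

Lemma polyfun_coord n (i : 'I_n) : polyfun (fun x => x 0 i).
Proof.
by exists (mpoly.mpolyX R (mpoly.mnm1 i)) => x; rewrite /peval mpoly.mevalXU.
Qed.

Lemma great_circle n (p y : 'rV[R]_n.+2) :
  sphere R n.+2 p -> sphere R n.+2 y ->
  exists (w : 'rV[R]_n.+2) (s : R),
    [/\ dot w w = 1, dot w p = 0 & y = cos s *: p + sin s *: w].
Proof.
rewrite /sphere /= => p1 y1; pose a := dot y p.
have [z zE] : {z | z = y - a *: p} by exists (y - a *: p).
have zz : dot z z = 1 - a ^+ 2.
  by rewrite zE !dot_bilinear y1 p1 (dotC p y) -/a; ring.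
have zp : dot z p = 0 by rewrite zE !dot_bilinear p1 mulr1 subrr.
have yE : y = a *: p + z by rewrite zE addrC subrK.
have a1 : -1 <= a <= 1 by have := dot_ge0 z; rewrite zz; nra.
have sa : sin (acos a) = Num.sqrt (dot z z) by rewrite sin_acos // zz.
have ca : cos (acos a) = a by rewrite acosK // in_itv.
(* Here [y] is [p] or [- p], and any unit vector orthogonal to [p] serves; one exists because the
   dimension is at least 2. *)
have [z0|z0] := eqVneq z 0.
  have [w w1 wp] := @exists_unit_orthogonal _ n.+2 1 p isT.
  exists w, (acos a); split=> //.
    by rewrite dotE wp mxE.
  by rewrite sa ca yE z0 dot0l sqrtr0 scale0r.
exists ((Num.sqrt (dot z z))^-1 *: z), (acos a); split.
- exact: unit_normalize.
- by rewrite dotZl zp mulr0.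
- rewrite sa ca scalerA divff ?scale1r // sqrtr_eq0 -ltNge.
  exact: dot_gt0.
Qed.

Lemma great_circle_sphere n (p w : 'rV[R]_n) s :
  dot p p = 1 -> dot w w = 1 -> dot w p = 0 ->
  sphere R n (cos s *: p + sin s *: w).
Proof.
move=> p1 w1 wp; rewrite /sphere /= !dot_bilinear p1 w1 (dotC p) wp.
by rewrite !mulr1 !mulr0 addr0 add0r -!expr2 cos2Dsin2.
Qed.

Lemma continuous_arc n (p w : 'rV[R]_n) :
  continuous (fun s : R => cos s *: p + sin s *: w).
Proof.
apply: continuous_rV => i; have S := continuous_subalgebra R R.
rewrite (_ : (fun s => _) = fun s => cos s * p 0 i + sin s * w 0 i); last first.
  by apply/funext => s; rewrite !mxE.
apply: (subalgebraD S); apply: (subalgebraM S);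
  first [exact: (subalgebra_cst S) | exact: continuous_cos | exact: continuous_sin].
Qed.

Lemma trigpoly_arc n (p w : 'rV[R]_n) i :
  trigpoly (fun s : R => (cos s *: p + sin s *: w) 0 i).
Proof.
have S := trigpoly_subalgebra R.
apply: (@subalgebra_ext _ _ _ (fun s => cos s * p 0 i + sin s * w 0 i)).
  by move=> s; rewrite !mxE.
apply: (subalgebraD S); apply: (subalgebraM S);
  first [exact: (subalgebra_cst S) | exact: trigpoly_cos | exact: trigpoly_sin].
Qed.

(** Join [p] to the given point by a great circle. Restricted to it both functions are trigonometric
    polynomials, and they agree on the short arc that stays in [O], hence along the whole circle. *)
Lemma polyfun_sphere_eq n (f g : 'rV[R]_n.+2 -> R) (O : set 'rV[R]_n.+2) p :
  polyfun f -> polyfun g -> open O -> O p -> sphere R n.+2 p ->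
  (forall x, sphere R n.+2 x -> O x -> f x = g x) ->
  forall x, sphere R n.+2 x -> f x = g x.
Proof.
move=> [pf hf] [pg hg] oO Op Sp hfg y Sy.
have [w [s0 [w1 wp ->]]] := great_circle Sp Sy.
pose c s := cos s *: p + sin s *: w.
have hc : \forall s \near (0 : R), O (c s).
  have /(_ O) := @continuous_arc _ p w (0 : R); apply.
  rewrite /= cos0 sin0 scale1r scale0r addr0; exact: open_nbhs_nbhs.
have [e /= e0 he] := hc.
have hT q : trigpoly (fun s => peval q (c s)).
  by apply: (subalgebra_peval (trigpoly_subalgebra R)) => i; exact: trigpoly_arc.
rewrite hf hg.
apply: (trigpoly_eq (hT pf) (hT pg) e0 _ s0) => s /andP[h0 h1].
rewrite -hf -hg; apply: hfg; first exact: great_circle_sphere.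
by apply: he; rewrite /= sub0r normrN gtr0_norm.
Qed.

End SphereContinuation.

(** * Smoothness of polynomial maps; differentials along subsets *)

Section Smooth.
Variable R : realType.

Lemma is_derive_diff (V W : normedModType R) (f : V -> W) (c : R -> V) (s : R) v :
  differentiable f (c s) -> is_derive s (1 : R) c v ->
  is_derive s (1 : R) (fun t => f (c t)) ('d f (c s) v).
Proof.
move=> df [dc <-]; have dc' : differentiable c s by exact/derivable1_diffP.
have dfc : differentiable (f \o c) s by exact: differentiable_comp.
split; first exact/derivable1_diffP.
rewrite -[LHS]/('D_1 (f \o c) s) deriveE // diff_comp //=.
by rewrite deriveE.
Qed.

Lemma polyfun_differentiable n (f : 'rV[R]_n -> R) x :
  polyfun f -> differentiable f x.
Proof.
move=> [p hp]; rewrite (_ : f = peval p); last exact/funext.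
suff : forall y, differentiable (peval p) y by [].
have S : fun_subalgebra (fun f : 'rV[R]_n -> R => forall y, differentiable f y).
  split=> [a y|f' g' hf hg y|f' g' hf hg y].
  - exact: differentiable_cst.
  - exact: differentiableD.
  - exact: differentiableM.
apply: (subalgebra_peval S) => i y; exact: differentiable_coord.
Qed.

Definition polymap n m (G : 'rV[R]_n -> 'rV[R]_m) : Prop :=
  forall j, polyfun (fun x => G x 0 j).

Lemma polymap_differentiable n m (G : 'rV[R]_n -> 'rV[R]_m) x :
  polymap G -> differentiable G x.
Proof.
move=> hG.
have -> : G = \sum_(j < m) (fun x => G x 0 j *: (delta_mx 0 j : 'rV[R]_m)).
  by apply/funext => y; rewrite fct_sumE {1}(row_sum_delta (G y)).
apply: differentiable_sum => j; apply: differentiableZl.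
exact: polyfun_differentiable.
Qed.

Lemma diff_polymap n m (G : 'rV[R]_n -> 'rV[R]_m) v :
  polymap G -> polymap (fun x => 'd G x v).
Proof.
move=> hG j; have [p hp] := hG j.
exists (\sum_i v 0 i *: mpoly.mderiv i p) => x.
have dG := polymap_differentiable x hG.
have hl := is_derive_line x v 0.
have e0 : x + 0 *: v = x by rewrite scale0r addr0.
have := is_derive_diff (c := fun t => x + t *: v) (s := 0) (v := v) (f := G) _ hl.
rewrite e0 => /(_ dG) /is_derive_rVP/(_ j) h1.
have := is_derive_peval p hl; rewrite e0.
rewrite (_ : (fun t => _) = fun t => G (x + t *: v) 0 j); last exact/funext.
move=> /(is_derive_unique h1) ->.
rewrite /peval /dot raddf_sum /=; apply: eq_bigr => i _.
by rewrite mpoly.mevalZ mxE.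
Qed.

Lemma polymap_Ck n m (G : 'rV[R]_n -> 'rV[R]_m) k (O : set 'rV[R]_n) :
  polymap G -> Ck k O G.
Proof.
elim: k G => [|k IHk] G hG /=.
  move=> x _; exact/differentiable_continuous/polymap_differentiable.
split=> [x _|v]; first exact: polymap_differentiable.
exact/IHk/diff_polymap.
Qed.

Lemma polymap_smooth n m (G : 'rV[R]_n -> 'rV[R]_m) (A : set 'rV[R]_n) :
  polymap G -> smooth_map A G.
Proof.
move=> hG x _; exists setT, G; split=> //; first exact: openT.
by move=> k; apply: polymap_Ck.
Qed.

(** Along any curve in [A] with velocity [v] the compositions with [f] and [h] agree near 0, so
    every candidate for the choice in [dmap] is the differential of the extension [h]. *)
Lemma dmap_diff (V W : normedModType R) (A O : set V) (f h : V -> W) x v :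
  open O -> O x -> differentiable h x -> (forall y, A y -> O y -> h y = f y) ->
  tangent A x v -> dmap A f x v = 'd h x v.
Proof.
move=> oO Ox dh hf.
have key c : curve_through A x v c -> is_derive (0 : R) (1 : R) (f \o c) ('d h x v).
  move=> [c0 cA dc].
  have hO : \forall t \near (0 : R), O (c t).
    have /differentiable_continuous/(_ O) : differentiable c 0.
      by case: dc => dc _; exact/derivable1_diffP.
    by apply; rewrite c0; exact: open_nbhs_nbhs.
  have := is_derive_diff (f := h) (c := c) (s := 0) (v := v).
  rewrite c0 => /(_ dh dc); apply: near_eq_is_derive.
  by near do apply: hf.
move=> [c hc].
have [c' hc' dw] : [set w | exists2 c, curve_through A x v c &
   is_derive (0 : R) (1 : R) (f \o c) w] (dmap A f x v).
  by apply: xgetPex; exists ('d h x v), c => //; exact: key.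
exact: is_derive_unique dw (key _ hc').
Unshelve. all: by end_near. Qed.

Lemma sphere_tangent n (x v : 'rV[R]_n) : sphere R n x -> dot v x = 0 ->
  tangent (sphere R n) x v.
Proof.
rewrite /sphere /= => x1 vx; pose a := Num.sqrt (dot v v).
(* The great circle run through with speed [a = |v|]. For [v = 0] the speed is 0 and the curve is
   constant, so the value of [a^-1] does not matter. *)
exists (fun t => cos (0 + a * t) *: x + sin (0 + a * t) *: (a^-1 *: v)); split.
- by rewrite mulr0 addr0 cos0 sin0 scale1r scale0r addr0.
- near=> t; rewrite /= add0r; have [v0|v0] := eqVneq v 0.
    by rewrite /a v0 !scaler0 addr0 dot0l sqrtr0 mul0r cos0 scale1r.
  apply: great_circle_sphere => //; first exact: unit_normalize.
  by rewrite dotZl vx mulr0.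
- have := is_derive_add
    (is_derive_scale (is_derive_cosl 0 a 0) (is_derive_const x (0 : R)))
    (is_derive_scale (is_derive_sinl 0 a 0) (is_derive_const (a^-1 *: v) (0 : R))).
  rewrite !mulr0 !addr0 cos0 sin0 mulr0 oppr0 scale0r !scaler0 !addr0 mulr1 add0r.
  have [->|v0] := eqVneq v 0; first by rewrite !scaler0.
  by rewrite scalerA divff ?scale1r // sqrtr_eq0 -ltNge dot_gt0.
Unshelve. all: by end_near. Qed.

End Smooth.

(** * The gradient map of a homogeneous polynomial and its local degree *)

Section GradientMap.
Variables (R : realType) (n g : nat) (F : mpoly.mpoly n R).
Hypothesis g2 : (2 <= g)%N.
Hypothesis hF : F \is mpoly.ishomog1 g (@mpoly.mdeg n).
Implicit Types x y v : 'rV[R]_n.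

Local Notation Phi := (gradient_map g F).

Lemma gradient_mapE x : Phi x = g%:R^-1 *: grad F x.
Proof. by []. Qed.

Lemma g_neq0 : g%:R != 0 :> R.
Proof. by rewrite pnatr_eq0; case: g g2. Qed.

Lemma gradient_map_polymap : polymap Phi.
Proof.
move=> j; apply: (@subalgebra_ext _ _ _ (fun x => g%:R^-1 * grad F x 0 j)).
  by move=> x; rewrite [RHS]mxE.
apply: (subalgebraM (polyfun_subalgebra _ _)).
  exact: (subalgebra_cst (polyfun_subalgebra _ _)).
by exists (mpoly.mderiv j F) => x; rewrite mxE.
Qed.

Lemma gradient_map_homog (r : R) x : Phi (r *: x) = r ^+ g.-1 *: Phi x.
Proof. by rewrite !gradient_mapE (grad_homog _ _ hF) !scalerA mulrC. Qed.

Lemma dot_gradient_map x : dot x (Phi x) = peval F x.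
Proof. by rewrite dotZr (euler hF) mulrA mulVf ?mul1r // g_neq0. Qed.

Lemma diff_gradient_map x v : 'd Phi x v = g%:R^-1 *: (v *m hess F x).
Proof.
have e0 : x + 0 *: v = x by rewrite scale0r addr0.
have hl := is_derive_line x v 0.
have := is_derive_diff (c := fun t => x + t *: v) (s := 0) (v := v) (f := Phi) _ hl.
rewrite e0 => /(_ (polymap_differentiable x gradient_map_polymap)) h.
apply: is_derive_unique h _.
have := is_derive_scale (is_derive_const (g%:R^-1 : R) (0 : R)) (is_derive_grad F hl).
by rewrite e0 scale0r add0r.
Qed.

Lemma sphere_diff_mxE x : sphere R n x ->
  sphere_diff_mx Phi x = g%:R^-1 *: hess F x +
    x^T *m (Phi x - g%:R^-1 *: (x *m hess F x)).
Proof.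
move=> x1; apply/matrixP => i j; rewrite [LHS]mxE; set u := delta_mx 0 i.
rewrite (dmap_diff openT I (polymap_differentiable x gradient_map_polymap)) //; last first.
  apply: sphere_tangent => //; rewrite dotBl dotZl.
  by move: x1; rewrite /sphere /= => ->; rewrite mulr1 subrr.
rewrite diff_gradient_map.
have ux : dot u x = x 0 i.
  rewrite /dot (bigD1 i) //= big1 => [|k ki]; first by rewrite mxE !eqxx mul1r addr0.
  by rewrite mxE (negbTE ki) andbF mul0r.
rewrite ux mulmxBl -scalemxAl -rowE [RHS]mxE.
have -> : (x^T *m (Phi x - g%:R^-1 *: (x *m hess F x))) i j =
    x 0 i * (Phi x - g%:R^-1 *: (x *m hess F x)) 0 j.
  by rewrite [LHS]mxE big_ord1 [x^T _ _]mxE.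
set y := x *m hess F x; set z := Phi x; clearbody y z.
by rewrite !mxE; ring.
Qed.

(* [hess F x / g] is the product of [1 + (g - 2) x^T x] and of
   [sphere_diff_mx Phi x], and the former has positive determinant, being the
   square of [1 + (sqrt (g - 1) - 1) x^T x]. *)
Lemma local_degree_hess x : sphere R n x ->
  local_degree Phi x = sgz (\det (hess F x)).
Proof.
move=> Sx; have x1 : x *m x^T = 1%:M.
  by apply/matrixP => a b; rewrite !ord1 -dotE Sx mxE.
rewrite /local_degree; set S := sphere_diff_mx Phi x.
(* [P k] multiplies [x] by [1 + k] and fixes its orthogonal complement, so the factors [1 + k]
   multiply under composition; this is [PP], and it shows that [P (q - 1)] has inverse
   [P (q^-1 - 1)]. *)
pose P (k : R) : 'M[R]_n := 1%:M + k *: (x^T *m x).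
have PP k l : P k *m P l = P (k + l + k * l).
  rewrite /P mulmxDl !mulmxDr !mul1mx !mulmx1 -scalemxAl -scalemxAr.
  rewrite -mulmxA [x *m (_ *m _)]mulmxA x1 mul1mx !scalerDl scalerA.
  by rewrite -!addrA; congr (_ + _); rewrite addrCA.
pose q : R := Num.sqrt g.-1%:R.
have g1 : 0 < g.-1%:R :> R by rewrite ltr0n; case: g g2 => [|[]].
have q2 : q ^+ 2 = g.-1%:R by rewrite sqr_sqrtr // ltW.
have q0 : 0 < q by rewrite sqrtr_gt0.
have hS : P (q - 1) *m P (q - 1) *m S = g%:R^-1 *: hess F x.
  rewrite PP (_ : _ + _ + _ = g.-1%:R - 1); last by rewrite -q2; ring.
  have xH : x *m (g%:R^-1 *: hess F x) = g.-1%:R *: Phi x.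
    by rewrite -scalemxAr (euler_hess _ hF) gradient_mapE !scalerA mulrC.
  rewrite /S sphere_diff_mxE // [g%:R^-1 *: (x *m _)]scalemxAr.
  move: (g%:R^-1 *: hess F x) xH => A xH; rewrite xH.
  rewrite (_ : Phi x - _ = (1 - g.-1%:R) *: Phi x); last first.
    by rewrite scalerBl scale1r.
  rewrite -scalemxAr /P mulmxDl mul1mx.
  rewrite mulmxDr -!scalemxAl -!scalemxAr -!mulmxA xH [x *m (x^T *m _)]mulmxA.
  rewrite x1 mul1mx -!scalemxAr !scalerA -addrA -!scalerDl.
  rewrite [X in _ + X *: _](_ : _ = 0) ?scale0r ?addr0 //; ring.
have : \det (P (q - 1)) != 0.
  apply/negP => /eqP h.
  have : \det (P (q - 1) *m P (q^-1 - 1)) = 0 by rewrite det_mulmx h mul0r.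
  rewrite PP (_ : _ + _ + _ = 0) ?/P ?scale0r ?addr0 ?det1.
    by move/eqP; rewrite oner_eq0.
  by field; rewrite gt_eqF.
move=> hP; have := congr1 (fun A => sgz (\det A)) hS.
rewrite /= !det_mulmx detZ sgzM [in LHS]gtr0_sgz; last first.
  by rewrite -expr2 lt_neqAle sqr_ge0 andbT eq_sym sqrf_eq0.
by rewrite mul1r => ->; rewrite sgzM gtr0_sgz ?mul1r // exprn_gt0 // invr_gt0
  ltr0n (leq_trans _ g2).
Qed.

End GradientMap.

(** * Tangent spaces *)

Section SmoothCurves.
Variable R : realType.

Lemma curve_near (V : normedModType R) (A O : set V) x v c :
  curve_through A x v c -> nbhs x O -> \forall t \near (0 : R), O (c t).
Proof.
move=> [c0 _ [dc _]] Ox.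
have /differentiable_continuous/(_ O) : differentiable c 0 by exact/derivable1_diffP.
by apply; rewrite c0.
Qed.

Lemma smooth_map_ext (V W : normedModType R) (A : set V) (f : V -> W) x :
  smooth_map A f -> A x -> exists (O : set V) (h : V -> W),
    [/\ open O, O x, differentiable h x & forall y, A y -> O y -> h y = f y].
Proof.
move=> sf Ax; have [Om [h [oO Ox sh hf]]] := sf x Ax; exists Om, h; split=> //.
by have [h1 _] := sh 1%N; apply: h1.
Qed.

Lemma dmap_curve (V W : normedModType R) (A : set V) (f : V -> W) x v c :
  smooth_map A f -> A x -> curve_through A x v c ->
  is_derive (0 : R) (1 : R) (fun t => f (c t)) (dmap A f x v).
Proof.
move=> sf Ax; have [Om [h [oO Ox dh hf]]] := smooth_map_ext sf Ax; move=> hc.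
rewrite (dmap_diff oO Ox dh hf); last by exists c.
have hO := curve_near hc (open_nbhs_nbhs (conj oO Ox)).
case: hc => c0 cA dc.
have := is_derive_diff (f := h) (c := c) (s := 0) (v := v).
rewrite c0 => /(_ dh dc); apply: near_eq_is_derive.
by near do apply: hf.
Unshelve. all: by end_near. Qed.

Lemma dmap_linear (V W : normedModType R) (A : set V) (f : V -> W) x :
  smooth_map A f -> A x ->
  exists h : {linear V -> W}, forall v, tangent A x v -> dmap A f x v = h v.
Proof.
move=> sf Ax; have [Om [h [oO Ox dh hf]]] := smooth_map_ext sf Ax.
by exists ('d h x) => v; apply: (dmap_diff oO Ox dh hf).
Qed.

(** The chart and its inverse extend to differentiable maps [h1], [h2]; differentiating
    [h2 (h1 (u + t w)) = u + t w] shows that the differential of [h1] is injective. This bounds the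
    tangent space from below; for hypersurfaces the upper bound comes from orthogonality to [x] and
    [xi x]. *)
Lemma submanifold_tangent N d (M : set 'rV[R]_N) x :
  submanifold d M -> M x -> exists2 J : 'M[R]_(d, N),
    \rank J = d & forall w, tangent M x (w *m J).
Proof.
move=> sM Mx; have [B [Oc [f [[Om' oO' BE] Bx oO [sf fB [hinv sh hf]]]]]] := sM x Mx.
have BM : B `<=` M by rewrite BE => y [].
have [u Ou fu] : (f @` Oc) x by rewrite fB.
have [Om1 [h1 [oO1 O1u d1 e1]]] := smooth_map_ext sf Ou.
have [Om2 [h2 [oO2 O2x d2 e2]]] := smooth_map_ext sh Bx.
have h1u : h1 u = x by rewrite e1.
pose l (w : 'rV[R]_d) t := u + t *: w.
have l0 w : l w 0 = u by rewrite /l scale0r addr0.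
have ln w P : nbhs u P -> \forall t \near (0 : R), P (l w t).
  have [dl _] := is_derive_line u w 0.
  have /differentiable_continuous/(_ P) : differentiable (l w) 0.
    exact/derivable1_diffP.
  by rewrite l0.
have hO w : \forall t \near (0 : R), Oc (l w t) by apply/ln/open_nbhs_nbhs.
have hO1 w : \forall t \near (0 : R), Om1 (l w t) by apply/ln/open_nbhs_nbhs.
have hO2 w : \forall t \near (0 : R), Om2 (h1 (l w t)).
  apply: (ln w (h1 @^-1` Om2)).
  have /differentiable_continuous/(_ Om2) := d1; apply.
  by rewrite h1u; apply/open_nbhs_nbhs.
have D1 w : is_derive (0 : R) (1 : R) (fun t => h1 (l w t)) ('d h1 u w).
  have := is_derive_diff (f := h1) (c := l w) (s := 0) (v := w).
  by rewrite l0; apply => //; exact: is_derive_line.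
have e12 w : 'd h2 x ('d h1 u w) = w.
  have := is_derive_diff (f := h2) (c := fun t => h1 (l w t)) (s := 0)
    (v := 'd h1 u w).
  rewrite l0 h1u => /(_ d2 (D1 w)) h.
  apply: is_derive_unique h _.
  apply: near_eq_is_derive (is_derive_line u w 0).
  near=> t.
  have tO : Oc (l w t) by near: t; exact: hO.
  have t1 : Om1 (l w t) by near: t; exact: hO1.
  have t2 : Om2 (h1 (l w t)) by near: t; exact: hO2.
  have h1f : h1 (l w t) = f (l w t) by rewrite e1.
  rewrite e2 //; last by rewrite h1f -fB; exists (l w t).
  by rewrite h1f hf.
exists (lin1_mx ('d h1 u)).
  apply/eqP; rewrite -/(row_free _); apply/row_freeP; exists (lin1_mx ('d h2 x)).
  apply/row_matrixP => i; rewrite !rowE mulmxA !mul_rV_lin1 mulmx1; exact: e12.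
move=> w; rewrite mul_rV_lin1; exists (fun t => h1 (l w t)); split.
- by rewrite l0.
- near=> t.
  have tO : Oc (l w t) by near: t; exact: hO.
  have t1 : Om1 (l w t) by near: t; exact: hO1.
  by rewrite e1 //; apply: BM; rewrite -fB; exists (l w t).
- exact: D1.
Unshelve. all: by end_near. Qed.

Lemma is_derive_dot N (u v : R -> 'rV[R]_N) (s : R) du dv :
  is_derive s (1 : R) u du -> is_derive s (1 : R) v dv ->
  is_derive s (1 : R) (fun t => dot (u t) (v t)) (dot du (v s) + dot (u s) dv).
Proof.
move=> /is_derive_rVP hu /is_derive_rVP hv; rewrite -big_split /=.
by apply: is_derive_bigsum => i; apply: is_derive_mul.
Qed.

Lemma is_derive_dot_const N (u v : R -> 'rV[R]_N) du dv a :
  is_derive (0 : R) (1 : R) u du -> is_derive (0 : R) (1 : R) v dv ->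
  (\forall t \near (0 : R), dot (u t) (v t) = a) ->
  dot du (v 0) + dot (u 0) dv = 0.
Proof.
move=> hu hv ha; have := is_derive_dot hu hv.
have : is_derive (0 : R) (1 : R) (fun t => dot (u t) (v t)) 0.
  apply: near_eq_is_derive (is_derive_const a (0 : R)).
  by near do apply/esym.
move=> h1 h2; exact: is_derive_unique h2 h1.
Unshelve. all: by end_near. Qed.

Lemma sphere_tangentP N (x v : 'rV[R]_N) : sphere R N x ->
  tangent (sphere R N) x v <-> dot v x = 0.
Proof.
move=> Sx; split; last exact: sphere_tangent.
move=> [c [c0 cS dc]].
have := is_derive_dot_const dc dc cS.
rewrite c0 (dotC x) => h; lra.
Qed.

End SmoothCurves.

(** * Tangent spaces of the hypersurface and the differential of its normal field *)

Section Hypersurface.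
Variables (R : realType) (n g : nat).
Variables (M : set 'rV[R]_n.+2) (xi : 'rV[R]_n.+2 -> 'rV[R]_n.+2).
Variables (theta : nat -> R) (m : nat -> nat).
Hypothesis iso : isoparametric g M xi theta m.
Implicit Types x v : 'rV[R]_n.+2.

Lemma iso_sphereE x : M x -> dot x x = 1.
Proof. by move/(iso_sphere iso). Qed.

Lemma iso_tangent_orth x v : M x -> tangent M x v ->
  dot v x = 0 /\ dot v (xi x) = 0.
Proof.
move=> Mx tv; split; last by rewrite dotC; exact: (iso_normal iso Mx tv).
have [c [c0 cM dc]] := tv.
apply/(sphere_tangentP _ (iso_sphereE Mx)); exists c; split => //.
by apply: filterS cM => t; exact: (iso_sphere iso).
Qed.

(** Dimension count: the row space of [J] has dimension [n] and lies in the orthogonal complement of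
    [x] and [xi x], which has dimension [n] too. *)
Lemma iso_tangent_basis x : M x -> exists J : 'M[R]_(n, n.+2),
  [/\ row_free J, forall w, tangent M x (w *m J) &
      forall v, dot v x = 0 -> dot v (xi x) = 0 -> exists w, v = w *m J].
Proof.
move=> Mx; have x1 := iso_sphereE Mx.
have xi1 := iso_normal_unit iso Mx; have xix := iso_normal_sphere iso Mx.
have [J rJ tJ] := submanifold_tangent (iso_submanifold iso) Mx.
pose X : 'M[R]_(1 + 1, n.+2) := col_mx x (xi x).
have XE w : dot w x = 0 -> dot w (xi x) = 0 -> w *m X^T = 0.
  move=> h1 h2; rewrite /X tr_col_mx mul_mx_row -[0]row_mx0.
  congr row_mx; apply/matrixP => i j; rewrite !ord1 -dotE.
    by rewrite h1 mxE.
  by rewrite h2 mxE.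
have rX : \rank X = 2%N.
  apply/eqP; rewrite -[_ == _]/(row_free X); apply/row_freeP; exists X^T.
  rewrite /X tr_col_mx mul_col_mx !mul_mx_row -block_mxEv [RHS]scalar_mx_block.
  by congr block_mx; apply/matrixP => i j; rewrite !ord1 -dotE ?x1 ?xi1 ?xix
    ?(dotC x) ?xix !mxE.
have JK : (J <= kermx X^T)%MS.
  apply/row_subP => i; apply/sub_kermxP; rewrite rowE.
  by have [h1 h2] := iso_tangent_orth Mx (tJ (delta_mx 0 i)); apply: XE.
have KJ : (kermx X^T <= J)%MS.
  by rewrite -(mxrank_leqif_sup JK) mxrank_ker mxrank_tr rX rJ subn2.
exists J; split=> // [|v h1 h2]; first by rewrite /row_free rJ.
have /sub_kermxP vK := XE _ h1 h2.
by have /submxP := submx_trans vK KJ.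
Qed.

Lemma iso_tangentP x v : M x ->
  tangent M x v <-> dot v x = 0 /\ dot v (xi x) = 0.
Proof.
move=> Mx; split; first exact: iso_tangent_orth.
have [J [_ tJ hJ]] := iso_tangent_basis Mx.
by move=> [h1 h2]; have [w ->] := hJ v h1 h2.
Qed.

Lemma iso_tangent_surj x (L : {linear 'rV[R]_n.+2 -> 'rV[R]_n.+2}) : M x ->
  (forall v, tangent M x v -> tangent M x (L v)) ->
  (forall v, tangent M x v -> L v = 0 -> v = 0) ->
  forall u, tangent M x u -> exists2 v, tangent M x v & L v = u.
Proof.
move=> Mx LT Linj u /(iso_tangentP _ Mx)[h1 h2].
have [J [fJ tJ hJ]] := iso_tangent_basis Mx.
pose K := J *m lin1_mx L.
have KE w : w *m K = L (w *m J) by rewrite mulmxA mul_rV_lin1.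
have fK : row_free K.
  apply: inj_row_free => w; rewrite KE => /(Linj _ (tJ w)) wJ.
  by apply: (row_free_inj fJ); rewrite wJ mul0mx.
have KJ : (K <= J)%MS.
  apply/row_subP => i; rewrite rowE KE.
  have /(iso_tangentP _ Mx)[k1 k2] := LT _ (tJ (delta_mx 0 i)).
  by have [w ->] := hJ _ k1 k2; exact: submxMl.
have JK : (J <= K)%MS.
  by rewrite -(mxrank_leqif_sup KJ) (eqP fJ) (eqP fK).
have [w uw] := hJ _ h1 h2.
have /submxP[w' uw'] : (u <= K)%MS by rewrite uw (submx_trans (submxMl _ _)).
by exists (w' *m J); [exact: tJ | rewrite -KE].
Qed.

Local Notation Dxi x v := (dmap M xi x v).

Lemma iso_dxi_curve x v c : M x -> curve_through M x v c ->
  is_derive (0 : R) (1 : R) (fun t => xi (c t)) (Dxi x v).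
Proof. by apply: dmap_curve; exact: (iso_normal_smooth iso). Qed.

Lemma iso_dxi_linear x : M x ->
  exists h : {linear 'rV[R]_n.+2 -> 'rV[R]_n.+2},
  forall v, tangent M x v -> Dxi x v = h v.
Proof. exact/dmap_linear/(iso_normal_smooth iso). Qed.

Lemma iso_dxi_tangent x v : M x -> tangent M x v -> tangent M x (Dxi x v).
Proof.
move=> Mx tv; have [c hc] := tv; have hd := iso_dxi_curve Mx hc.
have [c0 cM dc] := hc; have xi1 := iso_normal_unit iso Mx.
have /(iso_tangentP _ Mx) [vx vxi] := tv.
apply/(iso_tangentP _ Mx); split.
  have := @is_derive_dot_const _ _ _ _ _ _ 0 hd dc.
  rewrite c0 (dotC (xi x)) vxi addr0; apply.
  by apply: filterS cM => t; exact: (iso_normal_sphere iso).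
have := @is_derive_dot_const _ _ _ _ _ _ 1 hd hd.
rewrite c0 (dotC (xi x)) => h.
have {h} : dot (Dxi x v) (xi x) + dot (Dxi x v) (xi x) = 0.
  by apply: h; apply: filterS cM => t; exact: (iso_normal_unit iso).
lra.
Qed.

(* The differential at [(x, 0)] is [(v, s) |-> v + s xi]. *)
Lemma normal_map_regular x : M x ->
  regular_point (M `*` [set: R]) (sphere R n.+2) (normal_map xi) (x, 0).
Proof.
move=> Mx; split=> //.
have x1 := iso_sphereE Mx; have xi1 := iso_normal_unit iso Mx.
have xix := iso_normal_sphere iso Mx.
have e0 : normal_map xi (x, 0) = x.
  by rewrite /normal_map /= cos0 sin0 scale1r scale0r addr0.
have cfst : continuous (fst : 'rV[R]_n.+2 * R -> _) by move=> q; exact: cvg_fst.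
have csnd : continuous (snd : 'rV[R]_n.+2 * R -> _) by move=> q; exact: cvg_snd.
have dfst (p : 'rV[R]_n.+2 * R) := linear_differentiable p cfst.
have dsnd (p : 'rV[R]_n.+2 * R) := linear_differentiable p csnd.
have tproj p c : curve_through (M `*` [set: R]) (x, 0) p c ->
    curve_through M x p.1 (fun t => (c t).1) /\
    is_derive (0 : R) (1 : R) (fun t => (c t).2) p.2.
  move=> [c0 cM dc]; split; first split.
  - by rewrite c0.
  - by apply: filterS cM => t [].
  - have := is_derive_diff (f := fst) (dfst (c 0)) dc.
    by rewrite (diff_lin _ cfst).
  - have := is_derive_diff (f := snd) (dsnd (c 0)) dc.
    by rewrite (diff_lin _ csnd).
have tP p : tangent (M `*` [set: R]) (x, 0) p <-> tangent M x p.1.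
  split=> [[c /tproj[h _]]|[c [c0 cM dc]]]; first by exists (fun t => (c t).1).
  exists (fun t => (c t, p.2 * t)); split.
  - by rewrite c0 mulr0.
  - by near=> t; split => //=; near: t.
  - have d2 : is_derive (0 : R) (1 : R) (fun t : R => p.2 * t) p.2.
      have := is_derive_lin 0 p.2 0; apply: near_eq_is_derive.
      by near=> t; rewrite add0r.
    case: dc => dc1 dc2; case: d2 => d21 d22.
    have k1 : differentiable c 0 by exact/derivable1_diffP.
    have k2 : differentiable (fun t : R => p.2 * t) 0 by exact/derivable1_diffP.
    have k3 : differentiable (fun t : R => (c t, p.2 * t)) 0.
      exact: differentiable_pair.
    split; first exact/derivable1_diffP.
    by rewrite deriveE // diff_pair // -!deriveE // dc2 d22; case: (p).
have dmE p : tangent M x p.1 ->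
    dmap (M `*` [set: R]) (normal_map xi) (x, 0) p = p.1 + p.2 *: xi x.
  have key c : curve_through (M `*` [set: R]) (x, 0) p c ->
    is_derive (0 : R) (1 : R) (normal_map xi \o c) (p.1 + p.2 *: xi x).
    move=> hc; have [h1 h2] := tproj _ _ hc.
    have h3 := iso_dxi_curve Mx h1.
    have [c0 _ _] := hc; have [_ _ dc1] := h1.
    have hcos : is_derive (0 : R) (1 : R) (fun t => cos (c t).2) 0.
      have := is_derive_comp1 h2 (is_derive_cos (c 0).2).
      by rewrite c0 /= sin0 oppr0 mulr0.
    have hsin : is_derive (0 : R) (1 : R) (fun t => sin (c t).2) p.2.
      have := is_derive_comp1 h2 (is_derive_sin (c 0).2).
      by rewrite c0 /= cos0 mulr1.
    have := is_derive_add (is_derive_scale hcos dc1) (is_derive_scale hsin h3).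
    by rewrite c0 /= cos0 sin0 !scale0r add0r scale1r addr0.
  move=> tp; have /tP[c hc] := tp.
  have [c' hc' dw] : [set w | exists2 c, curve_through (M `*` [set: R]) (x, 0) p c &
     is_derive (0 : R) (1 : R) (normal_map xi \o c) w]
     (dmap (M `*` [set: R]) (normal_map xi) (x, 0) p).
    by apply: xgetPex; exists (p.1 + p.2 *: xi x), c => //; exact: key.
  exact: is_derive_unique dw (key _ hc').
rewrite e0; split.
- move=> p /tP tp; rewrite /= dmE //.
  have /(iso_tangentP _ Mx)[h1 h2] := tp.
  by apply/(sphere_tangentP _ x1); rewrite !dot_bilinear h1 xix mulr0 addr0.
- move=> p q; rewrite !inE => /tP tp /tP tq; rewrite !dmE //.
  have /(iso_tangentP _ Mx)[_ hp] := tp; have /(iso_tangentP _ Mx)[_ hq] := tq.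
  move=> h; have h2 : p.2 = q.2.
    have := congr1 (fun w => dot w (xi x)) h.
    by rewrite /= !dot_bilinear hp hq xi1 !add0r !mulr1.
  case: p q h h2 {tp tq hp hq} => [p1 p2] [q1 q2] /= h h2.
  rewrite h2 in h *; congr pair.
  exact: (@addIr _ (q2 *: xi x) _ _ h).
- move=> v /(sphere_tangentP _ x1) vx.
  have tv : tangent M x (v - dot v (xi x) *: xi x).
    by apply/(iso_tangentP _ Mx); rewrite !dot_bilinear vx xix xi1; split; ring.
  exists (v - dot v (xi x) *: xi x, dot v (xi x)); first exact/tP.
  by rewrite dmE //= subrK.
Unshelve. all: by end_near. Qed.

End Hypersurface.

(** * The normal great circles *)

Section LocalStructure.
Variables (R : realType) (n g : nat).
Variables (M : set 'rV[R]_n.+2) (xi : 'rV[R]_n.+2 -> 'rV[R]_n.+2).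
Variables (theta : nat -> R) (m : nat -> nat) (F : mpoly.mpoly n.+2 R).
Hypothesis g2 : (2 <= g)%N.
Hypothesis iso : isoparametric g M xi theta m.
Implicit Types x v : 'rV[R]_n.+2.

Definition normal_point x (t : R) := cos t *: x + sin t *: xi x.
Definition normal_vector x (t : R) := - sin t *: x + cos t *: xi x.

Local Notation e := normal_point.
Local Notation nu := normal_vector.
Local Notation Dxi x v := (dmap M xi x v).
Local Notation T x v := (tangent M x v).

(* [M'] is the part of [M] covered by the domain [U] on which [F] is prescribed. *)
Record covered (M' : set 'rV[R]_n.+2) : Prop := {
  covered_sub : M' `<=` M;
  covered_nonempty : M' !=set0;
  covered_open : forall x, M' x -> \forall y \near x, M y -> M' y;
  covered_peval : forall x t, M' x ->
    peval F (e x t) = cos (g%:R * (theta 1 - t));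
  covered_image : exists (O : set 'rV[R]_n.+2) p, [/\ open O, O p, sphere R n.+2 p &
    forall y, sphere R n.+2 y -> O y -> exists x t, M' x /\ y = e x t]
}.

Lemma trigpoly_peval_arc (q : mpoly.mpoly n.+2 R) (a b : 'rV[R]_n.+2) :
  trigpoly (fun t => peval q (cos t *: a + sin t *: b)).
Proof.
by apply: (subalgebra_peval (trigpoly_subalgebra R)) => i; exact: trigpoly_arc.
Qed.

(** The regular point [(x0, 0)] suffices. Over a point of [M'] the values of [F] are prescribed for
    [t] in some interval only; both sides being trigonometric polynomials in [t], the formula holds
    on the whole normal circle. The image of the local diffeomorphism is the open piece from which
    identities are continued to the sphere. *)
Lemma exists_covered : isoparametric_polynomial_of g M xi (theta 1) F ->
  exists M', covered M'.
Proof.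
move=> [hF hU]; have [x0 Mx0] := iso_nonempty iso.
have [U [V [[OU oOU UE] Ux0 [OV oOV VE] [_ UV _] FU]]] :=
  hU _ (normal_map_regular iso Mx0).
exists [set x | exists t, U (x, t)]; split.
- by move=> x [t]; rewrite UE => -[[]].
- by exists x0, 0.
- move=> x [t]; rewrite {1}UE => -[[/= Mx _] OUx].
  have : \forall y \near x, OU (y, t).
    have hc : (y, t) @[y --> x] --> (x, t).
      by apply: (cvg_pair (F := nbhs x) (G := nbhs x) (H := nbhs t));
        [exact: cvg_id|exact: cvg_cst].
    by apply: (hc OU); exact: open_nbhs_nbhs.
  apply: filterS => y OUy My; exists t; rewrite UE; split => //; split => //.
- move=> x t [t1 Ut1].
  have [Mx OUx] : M x /\ OU (x, t1) by move: Ut1; rewrite UE => -[[]].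
  have : \forall s \near t1, OU (x, s).
    have hc : (x, s) @[s --> t1] --> (x, t1).
      by apply: (cvg_pair (F := nbhs t1) (G := nbhs x) (H := nbhs t1));
        [exact: cvg_cst|exact: cvg_id].
    by apply: (hc OU); exact: open_nbhs_nbhs.
  move=> [r /= r0 hr].
  have : t1 < t1 + r by rewrite ltrDl.
  have tp : trigpoly (fun t => cos (g%:R * (theta 1 - t))).
    apply: subalgebra_ext (trigpoly_cosB (g%:R * theta 1) g) => s.
    by congr cos; ring.
  move=> lt1; apply: (trigpoly_eq (trigpoly_peval_arc F x (xi x)) tp lt1).
  move=> s /andP[s1 s2].
  have := FU x s 1; rewrite ltr01 scale1r expr1n mul1r; apply => //.
  rewrite UE; split => //; apply: hr => /=.
  rewrite ltr0_norm; lra.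
- exists OV, x0; split => //.
  + have : (normal_map xi @` U) (e x0 0) by exists (x0, 0).
    by rewrite UV VE /e cos0 sin0 scale1r scale0r addr0 => -[].
  + exact: (iso_sphere iso).
  + move=> y Sy OVy; have : V y by rewrite VE.
    rewrite -UV => -[[x t] Uxt <-]; exists x, t; split => //.
    by exists t.
Qed.

Section Frame.
Variable x : 'rV[R]_n.+2.
Hypothesis Mx : M x.

Let x1 : dot x x = 1 := iso_sphereE iso Mx.
Let xi1 : dot (xi x) (xi x) = 1 := iso_normal_unit iso Mx.
Let xix : dot (xi x) x = 0 := iso_normal_sphere iso Mx.
Let xxi : dot x (xi x) = 0. Proof. by rewrite dotC. Qed.

Lemma dot_point_point t s : dot (e x t) (e x s) = cos (t - s).
Proof. by rewrite /e !dot_bilinear x1 xi1 xix xxi cosB; ring. Qed.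

Lemma dot_vector_vector t s : dot (nu x t) (nu x s) = cos (t - s).
Proof. by rewrite /nu !dot_bilinear x1 xi1 xix xxi cosB; ring. Qed.

Lemma dot_vector_point t s : dot (nu x t) (e x s) = sin (s - t).
Proof. by rewrite /nu !dot_bilinear x1 xi1 xix xxi sinB; ring. Qed.

Lemma dot_point_vector t s : dot (e x t) (nu x s) = sin (t - s).
Proof. by rewrite dotC dot_vector_point. Qed.

Lemma dot_tangent_point v t : T x v -> dot v (e x t) = 0.
Proof.
by move=> /(iso_tangentP iso _ Mx)[h1 h2]; rewrite /e !dot_bilinear h1 h2; ring.
Qed.

Lemma dot_tangent_vector v t : T x v -> dot v (nu x t) = 0.
Proof.
by move=> /(iso_tangentP iso _ Mx)[h1 h2]; rewrite /nu !dot_bilinear h1 h2; ring.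
Qed.

Lemma normal_pointD t s : e x (t + s) = cos s *: e x t + sin s *: nu x t.
Proof.
rewrite /e /nu cosD sinD.
move: (xi x) => z; apply/rowP => i; rewrite !mxE; ring.
Qed.

Lemma normal_vectorD t s : nu x (t + s) = - sin s *: e x t + cos s *: nu x t.
Proof.
rewrite /e /nu cosD sinD.
move: (xi x) => z; apply/rowP => i; rewrite !mxE; ring.
Qed.

Lemma normal_point0 : e x 0 = x.
Proof. by rewrite /e cos0 sin0 scale1r scale0r addr0. Qed.

Lemma normal_vector0 : nu x 0 = xi x.
Proof. by rewrite /nu cos0 sin0 scale1r oppr0 scale0r add0r. Qed.

Lemma frame_inv_x t : x = cos t *: e x t - sin t *: nu x t.
Proof.
rewrite /e /nu; move: (xi x) => z; apply/rowP => i; rewrite !mxE.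
transitivity ((cos t ^+ 2 + sin t ^+ 2) * x 0 i); last by ring.
by rewrite cos2Dsin2 mul1r.
Qed.

Lemma frame_inv_xi t : xi x = sin t *: e x t + cos t *: nu x t.
Proof.
rewrite /e /nu; move: (xi x) => z; apply/rowP => i; rewrite !mxE.
transitivity ((cos t ^+ 2 + sin t ^+ 2) * z 0 i); last by ring.
by rewrite cos2Dsin2 mul1r.
Qed.

Lemma sphere_normal_point t : sphere R n.+2 (e x t).
Proof. by rewrite /sphere /= dot_point_point subrr cos0. Qed.

Lemma frame_expand t u : (forall v, T x v -> dot v u = 0) ->
  u = dot (e x t) u *: e x t + dot (nu x t) u *: nu x t.
Proof.
move=> hu.
have [E EE] : {E | E = e x t} by exists (e x t).
have [N NE] : {N | N = nu x t} by exists (nu x t).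
have E1 : dot E E = 1 by rewrite EE dot_point_point subrr cos0.
have N1 : dot N N = 1 by rewrite NE dot_vector_vector subrr cos0.
have EN : dot E N = 0 by rewrite EE NE dot_point_vector subrr sin0.
rewrite -EE -NE.
have [w wE] : {w | w = dot E u *: E + dot N u *: N} by exists (dot E u *: E + dot N u *: N).
have we : dot E (u - w) = 0 by rewrite wE dotBr dotDr !dotZr E1 EN; ring.
have wn : dot N (u - w) = 0 by rewrite wE dotBr dotDr !dotZr N1 (dotC N E) EN; ring.
have tw : T x (u - w).
  apply/(iso_tangentP iso _ Mx); split; rewrite dotC.
    by rewrite (frame_inv_x t) -EE -NE dotBl !dotZl we wn !mulr0 subrr.
  by rewrite (frame_inv_xi t) -EE -NE dotDl !dotZl we wn !mulr0 addr0.
have hE : dot (u - w) E = 0 by rewrite EE; exact: dot_tangent_point.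
have hN : dot (u - w) N = 0 by rewrite NE; exact: dot_tangent_vector.
apply/eqP; rewrite -wE -subr_eq0 -dot_eq0 dotBr hu // {2}wE dotDr !dotZr.
by rewrite hE hN !mulr0 addr0 subrr.
Qed.

Lemma is_derive_normal_point_curve v c t : curve_through M x v c ->
  is_derive (0 : R) (1 : R) (fun s => e (c s) t) (cos t *: v + sin t *: Dxi x v).
Proof.
move=> hc; have hd := iso_dxi_curve iso Mx hc; have [c0 cM dc] := hc.
have := is_derive_add (is_derive_scale (is_derive_const (cos t) (0 : R)) dc)
  (is_derive_scale (is_derive_const (sin t) (0 : R)) hd).
by rewrite !scale0r !add0r.
Qed.

Lemma is_derive_normal_vector_curve v c t : curve_through M x v c ->
  is_derive (0 : R) (1 : R) (fun s => nu (c s) t) (- sin t *: v + cos t *: Dxi x v).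
Proof.
move=> hc; have hd := iso_dxi_curve iso Mx hc; have [c0 cM dc] := hc.
have := is_derive_add (is_derive_scale (is_derive_const (- sin t) (0 : R)) dc)
  (is_derive_scale (is_derive_const (cos t) (0 : R)) hd).
by rewrite !scale0r !add0r.
Qed.

Lemma is_derive_normal_point a b t :
  is_derive t (1 : R) (fun s => e x (a + b * s)) (b *: nu x (a + b * t)).
Proof.
have := is_derive_add
  (is_derive_scale (is_derive_cosl a b t) (is_derive_const x t))
  (is_derive_scale (is_derive_sinl a b t) (is_derive_const (xi x) t)).
rewrite !scaler0 !addr0 /nu scalerDr !scalerA mulrN; exact.
Qed.

Lemma is_derive_normal_point1 t : is_derive t (1 : R) (fun s => e x s) (nu x t).
Proof.
have := is_derive_normal_point 0 1 t; rewrite add0r mul1r scale1r.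
by under eq_fun do rewrite add0r mul1r.
Qed.

Lemma tangent_normal v t : T x v -> T x (cos t *: v + sin t *: Dxi x v).
Proof.
move=> tv; have := iso_dxi_tangent iso Mx tv; move: tv.
move=> /(iso_tangentP iso _ Mx)[h1 h2] /(iso_tangentP iso _ Mx)[h3 h4].
by apply/(iso_tangentP iso _ Mx); rewrite !dot_bilinear h1 h2 h3 h4; split; ring.
Qed.

(* For [0 < t < theta 1] no principal curvature equals [cot t]. *)
Lemma tangent_normal_surj t u : 0 < t < theta 1 -> T x u ->
  exists2 v, T x v & cos t *: v + sin t *: Dxi x v = u.
Proof.
move=> /andP[t0 t1] tu; have [h hE] := iso_dxi_linear iso Mx.
pose L0 : 'M[R]_n.+2 := (cos t)%:M + sin t *: lin1_mx h.
pose L : {linear 'rV[R]_n.+2 -> 'rV[R]_n.+2} := mulmxr L0.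
have LE v : T x v -> L v = cos t *: v + sin t *: Dxi x v.
  move=> tv; rewrite /L /= /L0 mulmxDr mul_mx_scalar -scalemxAr mul_rV_lin1.
  by rewrite hE.
have g0 : (1 <= 1 <= g)%N by rewrite (leq_trans _ g2).
have /andP[th0 thpi] := iso_theta_range iso g0.
have st : 0 < sin t by apply: sin_gt0_pi; rewrite t0 (lt_trans t1).
have [v tv|v tv Lv|v tv Lv] := iso_tangent_surj (L := L) iso Mx _ _ tu; last first.
- by exists v => //; rewrite -LE.
- apply/eqP/negP => /negP v0; rewrite LE // in Lv.
  have [] := iso_all_curvatures iso (a := cot t) Mx _ v0.
    split=> //; rewrite /shape_operator /cot.
    move/eqP: Lv; rewrite addrC addr_eq0 => /eqP Lv.
    apply: (scalerI (lt0r_neq0 st)).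
    by rewrite scalerN Lv opprK scalerA mulrCA divff ?mulr1 // lt0r_neq0.
  move=> i hi; rewrite /cot.
  have /andP[i0 ipi] := iso_theta_range iso hi.
  have hti : t < theta i.
    apply: lt_le_trans t1 _; case/andP: hi => i1 ig.
    move: i1; rewrite leq_eqVlt => /orP[/eqP <- //|i1].
    by apply/ltW/(iso_theta_incr iso).
  have si : 0 < sin (theta i) by apply: sin_gt0_pi; rewrite i0.
  have sd : 0 < sin (theta i - t) by apply: sin_gt0_pi; lra.
  move=> /eqP; rewrite eqr_div ?lt0r_neq0 // => /eqP h2.
  by move: sd; rewrite sinB [sin (theta i) * _]mulrC h2 subrr ltxx.
- by rewrite LE //; exact: tangent_normal.
Qed.

End Frame.

Section Covered.
Variable M' : set 'rV[R]_n.+2.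
Hypothesis cov : covered M'.
Hypothesis hF : F \is mpoly.ishomog1 g (@mpoly.mdeg n.+2).

Definition focal_angle (t : R) := g%:R * theta 1 - g.-1%:R * t.
Local Notation t' := focal_angle.

Lemma focal_angleE t : t' t = t + g%:R * (theta 1 - t).
Proof.
rewrite /focal_angle.
have -> : g%:R = g.-1%:R + 1 :> R by rewrite natr1 prednK // (leq_trans _ g2).
ring.
Qed.

Lemma theta1_gt0 : 0 < theta 1.
Proof.
have g0 : (1 <= 1 <= g)%N by rewrite (leq_trans _ g2).
by have /andP[] := iso_theta_range iso g0.
Qed.

Lemma covered_curve x v c : M' x -> curve_through M x v c ->
  \forall s \near (0 : R), M' (c s).
Proof.
move=> Mx hc; have [_ cM _] := hc.
have := curve_near hc (covered_open cov Mx).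
by move=> h; near=> s; apply: (near h s) => //; near: s.
Unshelve. all: by end_near. Qed.

(** For [0 < t < theta 1] every tangent vector is the velocity of a curve [e (c s) t], along which
    [q] is constant. Continuation in [t] then reaches the focal parameters, where these velocities
    no longer span the tangent space. *)
Lemma tangent_grad_const (q : mpoly.mpoly n.+2 R) x v t :
  (forall x y s, M' x -> M' y -> peval q (e x s) = peval q (e y s)) ->
  M' x -> T x v -> dot v (grad q (e x t)) = 0.
Proof.
move=> hq M'x; have Mx := covered_sub cov M'x => tv.
have key u s : T x u -> dot (cos s *: u + sin s *: Dxi x u) (grad q (e x s)) = 0.
  move=> [c hc]; have [c0 cM dc] := hc.
  have := is_derive_peval q (is_derive_normal_point_curve Mx s hc); rewrite c0.
  move=> h; apply: is_derive_unique h _.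
  apply: near_eq_is_derive (is_derive_const (peval q (e x s)) (0 : R)).
  have := covered_curve M'x hc.
  by apply: filterS => r M'c; apply: hq.
have tp : trigpoly (fun t => dot v (grad q (e x t))).
  apply: (subalgebra_dot (trigpoly_subalgebra R)) => i.
    exact: (subalgebra_cst (trigpoly_subalgebra R)).
  apply: subalgebra_ext (trigpoly_peval_arc (mpoly.mderiv i q) x (xi x)) => s.
  by rewrite mxE.
apply: (trigpoly_eq0 tp theta1_gt0) => s hs.
by have [u tu <-] := tangent_normal_surj Mx hs tv; exact: key.
Qed.

Lemma tangent_grad x v t : M' x -> T x v -> dot v (grad F (e x t)) = 0.
Proof.
by apply: tangent_grad_const => y z s hy hz; rewrite !(covered_peval cov).
Qed.

(** The tangential part of the gradient vanishes, Euler's identity gives the radial part, and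
    differentiating [cos (g (theta 1 - t))] gives the part along [nu]; together they form a rotation
    by [g (theta 1 - t)]. *)
Lemma grad_normal_point x t : M' x -> grad F (e x t) = g%:R *: e x (t' t).
Proof.
move=> M'x; have Mx := covered_sub cov M'x.
rewrite (frame_expand Mx t (fun v => tangent_grad t M'x)).
rewrite (euler hF) (covered_peval cov) //.
have -> : dot (nu x t) (grad F (e x t)) = g%:R * sin (g%:R * (theta 1 - t)).
  have h := is_derive_peval F (is_derive_normal_point1 x t).
  apply: is_derive_unique h _.
  rewrite (_ : (fun s => _) = fun s => cos (g%:R * theta 1 + - g%:R * s)).
    apply: is_derive_eq (is_derive_cosl _ _ t) _.
    by rewrite mulNr opprK; congr (_ * sin _); ring.
  by apply/funext => s; rewrite (covered_peval cov) //; congr cos; ring.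
by rewrite -!scalerA -scalerDr -normal_pointD focal_angleE.
Qed.

Lemma normal_point_hess x t : M' x -> e x t *m hess F (e x t) = (g.-1%:R * g%:R) *: e x (t' t).
Proof. by move=> M'x; rewrite (euler_hess _ hF) grad_normal_point // scalerA. Qed.

Lemma normal_vector_hess x t : M' x ->
  nu x t *m hess F (e x t) = - (g.-1%:R * g%:R) *: nu x (t' t).
Proof.
move=> M'x; have h := is_derive_grad F (is_derive_normal_point1 x t).
apply: is_derive_unique h _.
rewrite (_ : (fun s => _) = fun s => g%:R *: e x (t' s)); last first.
  by apply/funext => s; rewrite grad_normal_point.
have := is_derive_scale (is_derive_const (g%:R : R) t)
  (is_derive_normal_point x (g%:R * theta 1) (- g.-1%:R) t).
rewrite scale0r add0r scalerA mulrN [g%:R * g.-1%:R]mulrC.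
rewrite /focal_angle mulNr.
by under eq_fun do rewrite mulNr.
Qed.

Lemma tangent_hess x v t : M' x -> T x v ->
  (cos t *: v + sin t *: Dxi x v) *m hess F (e x t) =
  g%:R *: (cos (t' t) *: v + sin (t' t) *: Dxi x v).
Proof.
move=> M'x [c hc]; have Mx := covered_sub cov M'x; have [c0 cM dc] := hc.
have := is_derive_grad F (is_derive_normal_point_curve Mx t hc); rewrite c0.
move=> h; apply: is_derive_unique h _.
have := is_derive_scale (is_derive_const (g%:R : R) (0 : R))
  (is_derive_normal_point_curve Mx (t' t) hc).
rewrite scale0r add0r; apply: near_eq_is_derive.
by have := covered_curve M'x hc; apply: filterS => r M'c; rewrite grad_normal_point.
Qed.

Lemma sin_theta_gt0 i : (1 <= i <= g)%N -> 0 < sin (theta i).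
Proof. by move=> hi; apply/sin_gt0_pi/(iso_theta_range iso). Qed.

Lemma eigen_normal x v i a b : (1 <= i <= g)%N -> Dxi x v = - cot (theta i) *: v ->
  sin (theta i) *: (a *: v + b *: Dxi x v) =
  (a * sin (theta i) - b * cos (theta i)) *: v.
Proof.
move=> hi ->; rewrite !scalerA -scalerDl scalerA; congr (_ *: _).
rewrite /cot; field; exact: lt0r_neq0 (sin_theta_gt0 hi).
Qed.

Lemma eigen_hess x v i t : M' x -> T x v -> (1 <= i <= g)%N ->
  Dxi x v = - cot (theta i) *: v ->
  sin (theta i - t) *: (v *m hess F (e x t)) =
  (g%:R * sin (theta i - t' t)) *: v.
Proof.
move=> M'x tv hi hv.
have := congr1 (fun w => sin (theta i) *: w) (tangent_hess t M'x tv).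
rewrite /= scalemxAl (eigen_normal _ _ hi hv) -scalemxAl.
rewrite (_ : sin (theta i) *: (g%:R *: _) = g%:R *: (sin (theta i) *:
  (cos (t' t) *: v + sin (t' t) *: Dxi x v))); last by rewrite !scalerA mulrC.
rewrite (eigen_normal _ _ hi hv) scalerA !sinB.
by rewrite ![cos (theta i) * _]mulrC ![sin (theta i) * _]mulrC.
Qed.

Lemma exists_eigen x i : M x -> (1 <= i <= g)%N ->
  exists v, [/\ v != 0, T x v & Dxi x v = - cot (theta i) *: v].
Proof.
move=> Mx hi; have [U UE dU] := iso_mult iso Mx hi.
have U0 : U != 0%VS by rewrite -dimv_eq0 dU -lt0n (iso_mult_gt0 iso).
have : principal_space M xi x (cot (theta i)) (vpick U) by rewrite UE /= memv_pick.
move=> [tv hv]; exists (vpick U); split=> //; first by rewrite vpick0.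
by rewrite scaleNr -hv /shape_operator opprK.
Qed.

Lemma sin_eq0_nat (y : R) : 0 <= y -> sin y = 0 -> exists k : nat, y = k%:R * pi.
Proof.
move=> y0 sy; pose k := Num.truncn (y / pi).
have /andP[h1 h2] := truncn_itv (divr_ge0 y0 (pi_ge0 R)).
have p0 := pi_gt0 R; exists k.
rewrite ler_pdivlMr // in h1; rewrite ltr_pdivrMr // in h2.
have [//|/eqP hne] := eqVneq y (k%:R * pi).
have : 0 < sin (y - pi *+ k).
  apply: sin_gt0_pi; rewrite -mulr_natl; move: h1 h2; rewrite -/k -natr1 => h1 h2.
  have : k%:R * pi != y by rewrite eq_sym; exact/eqP.
  move=> hne'; rewrite subr_gt0 lt_neqAle hne' h1 /=; lra.
suff -> : sin (y - pi *+ k) = 0 by rewrite ltxx.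
apply/eqP; rewrite -normr_eq0.
have e : y = (y - pi *+ k) + pi *+ k by rewrite subrK.
have := alternatingn (@sinDpi R) k (y - pi *+ k); rewrite -e sy => /esym/eqP.
by rewrite mulf_eq0 signr_eq0 /= => /eqP ->; rewrite normr0.
Qed.

(* At [t = theta i] the left-hand side of [eigen_hess] vanishes, hence
   [sin (g (theta i - theta 1)) = 0]; there are only [g] multiples of [pi / g]
   in an interval of length [< pi]. *)
Lemma theta_arithmetic i : (1 <= i <= g)%N -> theta i = theta 1 + i.-1%:R * pi / g%:R.
Proof.
have [x M'x] := covered_nonempty cov; have Mx := covered_sub cov M'x.
have g0 : 0 < g%:R :> R by rewrite ltr0n (leq_trans _ g2).
have p0 := pi_gt0 R.
have g11 : (1 <= 1 <= g)%N by rewrite (leq_trans _ g2).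
have le1 j : (1 <= j <= g)%N -> theta 1 <= theta j.
  move=> /andP[]; rewrite leq_eqVlt => /orP[/eqP <- //|j1] jg.
  by apply/ltW/(iso_theta_incr iso).
have hk j : (1 <= j <= g)%N -> exists k : nat, g%:R * (theta j - theta 1) = k%:R * pi.
  move=> hj; apply: sin_eq0_nat.
    by apply: mulr_ge0; [exact: ltW | rewrite subr_ge0 le1].
  have [v [v0 tv hv]] := exists_eigen Mx hj.
  have := eigen_hess (theta j) M'x tv hj hv.
  rewrite subrr sin0 scale0r => /esym/eqP; rewrite scaler_eq0 (negbTE v0) orbF.
  rewrite mulf_eq0 (gt_eqF g0) /= focal_angleE => /eqP h.
  by rewrite -[RHS]h; congr sin; ring.
(* The integers [g (theta j - theta 1) / pi] increase strictly with [j], are 0 at [j = 1] and less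
   than [g] at [j = g]; so they are [j - 1]. [lo] climbs from 1, [hi] descends from [g]. *)
have lo j : (1 <= j <= g)%N -> j.-1%:R * pi <= g%:R * (theta j - theta 1).
  elim: j => // -[_ _|j IHj]; first by rewrite mul0r subrr mulr0.
  move=> /andP[_ jg]; have hj : (1 <= j.+1 <= g)%N by rewrite /= ltnW.
  have hj2 : (1 <= j.+2 <= g)%N by [].
  have [k hk2] := hk _ hj2; have := IHj hj; rewrite /= hk2.
  have : g%:R * (theta j.+1 - theta 1) < k%:R * pi.
    rewrite -hk2 ltr_pM2l // ltrD2r; apply: (iso_theta_incr iso) => //.
    by rewrite ltnSn.
  move=> h1 h2; have := le_lt_trans h2 h1.
  by rewrite ltr_pM2r // ltr_nat ler_pM2r // ler_nat.
have hi d j : (1 <= j)%N -> (j + d = g)%N -> g%:R * (theta j - theta 1) <= j.-1%:R * pi.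
  elim: d j => [|d IHd] j j1 jd.
    have hj : (1 <= j <= g)%N by rewrite j1 -jd leq_addr.
    have [k hk2] := hk _ hj; rewrite hk2 ler_pM2r // ler_nat -ltnS prednK //.
    suff : k%:R * pi < g%:R * pi :> R by rewrite ltr_pM2r // ltr_nat -jd addn0.
    rewrite -hk2 ltr_pM2l //.
    by have /andP[_] := iso_theta_range iso hj; have := theta1_gt0; lra.
  have hj : (1 <= j <= g)%N by rewrite j1 -jd leq_addr.
  have hj2 : (1 <= j.+1 <= g)%N by rewrite /= -jd addnS ltnS leq_addr.
  have [k hk2] := hk _ hj; rewrite hk2 ler_pM2r // ler_nat -ltnS prednK //.
  have := IHd j.+1 isT; rewrite addSnnS => /(_ jd).
  have : g%:R * (theta j - theta 1) < g%:R * (theta j.+1 - theta 1).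
    rewrite ltr_pM2l // ltrD2r; apply: (iso_theta_incr iso); last by case/andP: hj2.
    by rewrite j1 ltnSn.
  rewrite hk2 => h1 h2; have := lt_le_trans h1 h2.
  by rewrite ltr_pM2r // ltr_nat.
move=> hi'; have /andP[i1 ig] := hi'.
have := lo _ hi'; have := hi (g - i)%N _ i1 (subnKC ig) => h1 h2.
have -> : i.-1%:R * pi = g%:R * (theta i - theta 1) by apply/le_anti; rewrite h1 h2.
by field; rewrite gt_eqF.
Qed.

Lemma g_theta1_lt_pi : g%:R * theta 1 < pi.
Proof.
have g0 : 0 < g%:R :> R by rewrite ltr0n (leq_trans _ g2).
have hg : (1 <= g <= g)%N by rewrite leqnn (leq_trans _ g2).
have /andP[_] := iso_theta_range iso hg; rewrite (theta_arithmetic hg).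
rewrite -(ltr_pM2l g0) mulrDr [g%:R * (_ / _)]mulrC divfK ?gt_eqF //.
have -> : g%:R = g.-1%:R + 1 :> R by rewrite natr1 prednK // (leq_trans _ g2).
by rewrite [(_ + 1) * pi]mulrDl mul1r; lra.
Qed.

End Covered.
End LocalStructure.

Lemma det_block11 (R : comPzRingType) (a b c d : 'M[R]_1) :
  \det (block_mx a b c d) = a 0 0 * d 0 0 - b 0 0 * c 0 0.
Proof.
set A := block_mx a b c d.
have -> : a 0 0 = A (lshift 1 0) (lshift 1 0) by rewrite block_mxEul.
have -> : b 0 0 = A (lshift 1 0) (rshift 1 0) by rewrite block_mxEur.
have -> : c 0 0 = A (rshift 1 0) (lshift 1 0) by rewrite block_mxEdl.
have -> : d 0 0 = A (rshift 1 0) (rshift 1 0) by rewrite block_mxEdr.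
clearbody A; rewrite (expand_det_row _ (lshift 1 0)) !big_ord_recl big_ord0.
rewrite /cofactor !det_mx11 !mxE /= addr0 expr0 expr1 mul1r mulN1r mulrN.
by congr (A _ _ * A _ _ - A _ _ * A _ _); apply: val_inj.
Qed.

Lemma sinDnpi (R : realType) (y : R) k : sin (y + k%:R * pi) = (-1) ^+ k * sin y.
Proof. by rewrite mulr_natl (alternatingn (@sinDpi R)). Qed.

Lemma cosDnpi (R : realType) (y : R) k : cos (y + k%:R * pi) = (-1) ^+ k * cos y.
Proof. by rewrite mulr_natl (alternatingn (@cosDpi R)). Qed.

(** * Orthonormal frames of principal vectors and the Hessian in such a frame *)

Section EigenFrame.
Variables (R : realType) (n g : nat).
Variables (M : set 'rV[R]_n.+2) (xi : 'rV[R]_n.+2 -> 'rV[R]_n.+2).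
Variables (theta : nat -> R) (m : nat -> nat) (F : mpoly.mpoly n.+2 R).
Hypothesis g2 : (2 <= g)%N.
Hypothesis iso : isoparametric g M xi theta m.
Variable M' : set 'rV[R]_n.+2.
Hypothesis cov : covered g M xi theta F M'.
Hypothesis hF : F \is mpoly.ishomog1 g (@mpoly.mdeg n.+2).
Implicit Types x v : 'rV[R]_n.+2.

Local Notation e := (normal_point xi).
Local Notation nu := (normal_vector xi).
Local Notation Dxi x v := (dmap M xi x v).
Local Notation T x v := (tangent M x v).
Local Notation t' := (focal_angle g theta).

Record eigenframe x (Q : 'M[R]_(n, n.+2)) (idx : 'I_n -> nat) : Prop := {
  eigenframe_orth : Q *m Q^T = 1%:M;
  eigenframe_tangent : forall k, T x (row k Q);
  eigenframe_idx : forall k, (1 <= idx k <= g)%N;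
  eigenframe_dxi : forall k, Dxi x (row k Q) = - cot (theta (idx k)) *: row k Q
}.

(** On [M'] the value of [F] is [cos (g theta 1)], so this says that [M'] is free of focal points.
    It lets the shape operator be recovered from the Hessian and makes the nonfocal points dense. *)
Lemma sin_g_theta1 : 0 < sin (g%:R * theta 1).
Proof.
apply: sin_gt0_pi; rewrite (g_theta1_lt_pi g2 iso cov hF) andbT.
by rewrite mulr_gt0 ?(theta1_gt0 g2 iso) // ltr0n (leq_trans _ g2).
Qed.

(** At [t = 0] the Hessian acts on tangent vectors as [g (cos w + sin w Dxi)] with [w = g theta 1].
    As [sin w] is nonzero, an orthonormal eigenbasis of the symmetric matrix [hess F x] on the
    complement of the invariant plane of [x] and [xi x] consists of principal vectors. *)
Lemma exists_eigenframe x : M' x -> exists Q idx, eigenframe x Q idx.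
Proof.
move=> M'x; have Mx := covered_sub cov M'x.
have eH := normal_point_hess g2 iso cov hF 0 M'x; have nH := normal_vector_hess g2 iso cov hF 0 M'x.
have tH v := tangent_hess (v := v) g2 iso cov hF 0 M'x.
have w0 : t' 0 = g%:R * theta 1 by rewrite /focal_angle mulr0 subr0.
rewrite w0 normal_point0 normal_vector0 in eH nH.
set w := g%:R * theta 1 in w0 eH nH; set K := g.-1%:R * g%:R in eH nH.
have sw : sin w != 0 by rewrite lt0r_neq0 // sin_g_theta1.
pose H := hess F x.
pose X : 'M[R]_(1 + 1, n.+2) := col_mx x (xi x).
pose C : 'M[R]_(1 + 1) := block_mx (K * cos w)%:M (K * sin w)%:M
  (K * sin w)%:M (- K * cos w)%:M.
have XH : X *m H = C *m X.
  rewrite /X mul_col_mx mul_block_col eH nH !mul_scalar_mx /e /nu.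
  by rewrite !scalerDr !scalerA mulrNN.
have [//|Q [d [QQ QX QH]]] := sym_eigenbasis (hess_sym F x) XH (j := n) _.
have tQ k : T x (row k Q).
  apply/(iso_tangentP iso _ Mx).
  have : row k Q *m X^T = 0 by rewrite -row_mul QX row0.
  rewrite /X tr_col_mx mul_mx_row -[0]row_mx0 => /eq_row_mx[h1 h2].
  by rewrite !dotE h1 h2 mxE.
have vH k : row k Q *m H = d 0 k *: row k Q.
  by rewrite -row_mul QH row_mul row_diag_mx -scalemxAl -rowE.
pose a k := (cos w - d 0 k / g%:R) / sin w.
have g0 : g%:R != 0 :> R by rewrite pnatr_eq0 -lt0n (leq_trans _ g2).
have hd k : Dxi x (row k Q) = - a k *: row k Q.
  have := tH _ (tQ k); rewrite normal_point0 cos0 sin0 scale0r addr0 scale1r.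
  rewrite vH w0 -/w.
  move=> h; apply: (scalerI g0); apply: (scalerI sw).
  move/eqP: h; rewrite scalerDr addrC -subr_eq => /eqP h.
  rewrite scalerA [sin w * _]mulrC -scalerA -h !scalerA -scalerBl.
  by congr (_ *: _); rewrite /a; field; rewrite sw g0.
have /choice[idx hidx] : forall k, exists i, (1 <= i <= g)%N /\ a k = cot (theta i).
  move=> k; have [||i hi ai] := iso_all_curvatures iso (a := a k) (v := row k Q) Mx.
  - split; first exact: tQ.
    by rewrite /shape_operator hd scaleNr opprK.
  - apply/eqP => h; have := congr1 (fun A : 'M[R]_n => A k k) QQ.
    rewrite !mxE eqxx big1 => [/esym/eqP|i _]; first by rewrite oner_eq0.
    have := congr1 (fun u : 'rV[R]_n.+2 => u 0 i) h.
    by rewrite !mxE => ->; rewrite mul0r.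
  - by exists i.
exists Q, idx; split=> // k; first by case: (hidx k).
by rewrite hd; case: (hidx k) => _ ->.
Qed.

Section Frame.
Variables (x : 'rV[R]_n.+2) (Q : 'M[R]_(n, n.+2)) (idx : 'I_n -> nat).
Hypothesis M'x : M' x.
Hypothesis fr : eigenframe x Q idx.

Let Mx : M x := covered_sub cov M'x.

Definition frame_mx t : 'M[R]_(1 + 1 + n) := col_mx (col_mx (e x t) (nu x t)) Q.

Let row_dot (u v : 'rV[R]_n.+2) : u *m v^T = (dot u v)%:M.
Proof. by apply/matrixP => i j; rewrite !ord1 -dotE mxE. Qed.

Lemma frame_Q_orth u : (forall v, T x v -> dot v u = 0) -> Q *m u^T = 0.
Proof.
move=> hu; apply/row_matrixP => k; rewrite row_mul row0 row_dot.
by rewrite hu ?raddf0 //; exact: (eigenframe_tangent fr k).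
Qed.

Lemma frame_mx_orth t : frame_mx t *m (frame_mx t)^T = 1%:M.
Proof.
have Qe : Q *m (e x t)^T = 0.
  by apply: frame_Q_orth => v tv; exact: (dot_tangent_point iso).
have Qn : Q *m (nu x t)^T = 0.
  by apply: frame_Q_orth => v tv; exact: (dot_tangent_vector iso).
have eQ : e x t *m Q^T = 0 by apply: trmx_inj; rewrite trmx_mul trmxK Qe trmx0.
have nQ : nu x t *m Q^T = 0 by apply: trmx_inj; rewrite trmx_mul trmxK Qn trmx0.
rewrite /frame_mx !tr_col_mx !mul_col_mx !mul_mx_row eQ nQ.
rewrite (eigenframe_orth fr) Qe Qn.
rewrite !row_dot (dot_point_point iso) // (dot_vector_vector iso) // (dot_vector_point iso) // (dot_point_vector iso) //.
rewrite !subrr cos0 sin0 raddf0 [RHS]scalar_mx_block /block_mx.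
rewrite [in RHS]scalar_mx_block /block_mx row_mx0; congr col_mx.
by rewrite -block_mxEv block_mxEh col_mx0.
Qed.

Lemma frame_expandQ v : T x v -> v = \sum_k dot v (row k Q) *: row k Q.
Proof.
move=> tv; have := mulmx1C (frame_mx_orth 0) => h.
rewrite -{1}(mulmx1 v) -h mulmxA /frame_mx !tr_col_mx !mul_mx_row.
rewrite !row_dot (dot_tangent_point iso) // (dot_tangent_vector iso) // raddf0.
rewrite row_mx0 mul_row_col mul0mx add0r mulmx_sum_row.
apply: eq_bigr => k _; congr (_ *: _).
by rewrite mxE; apply: eq_bigr => i _; rewrite !mxE.
Qed.

(** The rows of index [i] form a basis of the principal space. They span it because expanding a
    principal vector in the frame and applying [Dxi] kills every component whose curvature differs
    from [cot (theta i)], and [cot] is injective between 0 and [pi]. *)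
Lemma card_idx i : (1 <= i <= g)%N -> #|[pred k | idx k == i]| = m i.
Proof.
move=> hi; have [U UE dU] := iso_mult iso Mx hi; rewrite -dU.
have UP v : (v \in U) <-> T x v /\ Dxi x v = - cot (theta i) *: v.
  have -> : (v \in U) = [set` U] v :> Prop by [].
  rewrite -UE; split=> -[tv hv]; split=> //.
    by rewrite scaleNr -hv /shape_operator opprK.
  by rewrite /shape_operator hv scaleNr opprK.
pose A := [pred k | idx k == i].
pose b := [tuple row (enum_val k) Q | k < #|A|].
have QQ k l : dot (row k Q) (row l Q) = (k == l)%:R.
  have := congr1 (fun B : 'M[R]_n => B k l) (eigenframe_orth fr).
  rewrite !mxE => <-; apply: eq_bigr => j _; by rewrite !mxE.
have bE (k : 'I_#|A|) : b`_k = row (enum_val k) Q.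
  by rewrite -tnth_nth tnth_mktuple.
have fb : free b.
  apply/freeP => c hc k.
  have := congr1 (fun u => dot u (row (enum_val k) Q)) hc.
  rewrite dot0l /dot => h; rewrite -[RHS]h -/(dot _ _) dotE mulmx_suml summxE.
  rewrite (bigD1 k) //= big1 ?addr0 => [|l lk]; rewrite -dotE dotZl bE QQ.
    by rewrite eqxx mulr1.
  by rewrite (inj_eq enum_val_inj) (negbTE lk) mulr0.
have sb : <<b>>%VS = U.
  apply/eqP; rewrite eqEsubv; apply/andP; split.
    apply/span_subvP => _ /tnthP[k ->]; rewrite tnth_mktuple.
    apply/UP; split; first exact: (eigenframe_tangent fr).
    have := enum_valP k; rewrite inE => /eqP <-.
    exact: (eigenframe_dxi fr).
  apply/subvP => v /UP[tv hv].
  rewrite (frame_expandQ tv); apply: memv_suml => k _.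
  have [ki|ki] := boolP (k \in A).
    apply: memvZ; apply: memv_span; apply/tnthP.
    by exists (enum_rank_in ki k); rewrite tnth_mktuple enum_rankK_in.
  suff -> : dot v (row k Q) = 0 by rewrite scale0r mem0v.
  have [h hE] := iso_dxi_linear iso Mx.
  have : Dxi x v = \sum_k dot v (row k Q) *: (- cot (theta (idx k)) *: row k Q).
    rewrite hE // {1}(frame_expandQ tv) linear_sum; apply: eq_bigr => l _.
    rewrite linearZ -hE ?(eigenframe_dxi fr) //; exact: (eigenframe_tangent fr).
  rewrite hv {1}(frame_expandQ tv) => /(congr1 (fun u => dot u (row k Q))) /=.
  have ds (c : 'I_n -> R) : dot (\sum_l c l *: row l Q) (row k Q) = c k.
    rewrite dotE mulmx_suml summxE (bigD1 k) //= big1 ?addr0 => [|l lk];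
      rewrite -dotE dotZl QQ; first by rewrite eqxx mulr1.
    by rewrite (negbTE lk) mulr0.
  rewrite dotZl ds; under eq_bigr do rewrite scalerA.
  rewrite ds [RHS]mulrC => /eqP; rewrite -subr_eq0 -mulrBl mulf_eq0 => /orP[|/eqP //].
  rewrite opprK addrC subr_eq0 => /eqP hcot.
  have hk := eigenframe_idx fr k.
  have ti := iso_theta_range iso hi; have tk := iso_theta_range iso hk.
  have si := sin_theta_gt0 iso hi; have sk := sin_theta_gt0 iso hk.
  move/eqP: hcot; rewrite /cot eqr_div ?lt0r_neq0 // => /eqP hcot.
  have hs : sin (theta i - theta (idx k)) = 0.
    by rewrite sinB mulrC hcot mulrC subrr.
  have ne : idx k != i by move: ki; rewrite inE.
  have [lt|gt|eq] := ltngtP (idx k) i; last by rewrite eq eqxx in ne.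
    have h1 : theta (idx k) < theta i.
      by apply: (iso_theta_incr iso); [rewrite lt; case/andP: hk => ->|case/andP: hi].
    have : 0 < sin (theta i - theta (idx k)) by apply: sin_gt0_pi; lra.
    by rewrite hs ltxx.
  have h1 : theta i < theta (idx k).
    by apply: (iso_theta_incr iso); [rewrite gt; case/andP: hi => ->|case/andP: hk].
  have : 0 < sin (theta (idx k) - theta i) by apply: sin_gt0_pi; lra.
  by rewrite -opprB sinN hs oppr0 ltxx.
by rewrite -sb; move: fb; rewrite /free => /eqP ->; rewrite size_tuple.
Qed.

Lemma big_idx (V : Type) (z : V) (op : Monoid.com_law z) (f : nat -> V) :
  \big[op/z]_k f (idx k) =
  \big[op/z]_(1 <= i < g.+1) \big[op/z]_(k | idx k == i) f i.
Proof.
rewrite (eq_bigr (fun k => \big[op/z]_(1 <= i < g.+1 | idx k == i) f i)); last first.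
  move=> k _; rewrite -big_filter.
  have := eigenframe_idx fr k => /andP[h1 h2].
  rewrite (_ : seq.filter _ _ = [:: idx k]) ?big_seq1 //.
  rewrite (seq.eq_filter (a2 := pred1 (idx k))) => [|i]; last by rewrite /= eq_sym.
  by rewrite filter_pred1_uniq ?iota_uniq // mem_index_iota h1 ltnS.
by rewrite (exchange_big_dep xpredT).
Qed.

Lemma sum_idx (f : nat -> R) :
  \sum_k f (idx k) = \sum_(1 <= i < g.+1) (m i)%:R * f i.
Proof.
rewrite big_idx big_nat_cond [RHS]big_nat_cond.
apply: eq_bigr => i; rewrite andbT ltnS => hi.
by rewrite sumr_const card_idx // mulr_natl.
Qed.

Lemma prod_idx (f : nat -> R) :
  \prod_k f (idx k) = \prod_(1 <= i < g.+1) f i ^+ m i.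
Proof.
rewrite big_idx big_nat_cond [RHS]big_nat_cond.
apply: eq_bigr => i; rewrite andbT ltnS => hi.
by rewrite prodr_const card_idx.
Qed.

Lemma eigen_hess_frame k t :
  sin (theta (idx k) - t) *: (row k Q *m hess F (e x t)) =
  (g%:R * sin (theta (idx k) - t' t)) *: row k Q.
Proof.
apply: (eigen_hess g2 iso cov hF) => //.
- exact: (eigenframe_tangent fr k).
- exact: (eigenframe_idx fr k).
- exact: (eigenframe_dxi fr k).
Qed.

(** Where [sin (theta (idx k) - t)] is nonzero this is the eigenvalue of the Hessian on row [k]. In
    this form it is a trigonometric polynomial in [t], also defined at [t = theta (idx k)], where
    the quotient of sines becomes 0/0. *)
Definition frame_coef k t := dot (row k Q *m hess F (e x t)) (row k Q).

Lemma dot_row k : dot (row k Q) (row k Q) = 1.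
Proof.
have := congr1 (fun B : 'M[R]_n => B k k) (eigenframe_orth fr).
by rewrite !mxE eqxx mulr1n => <-; apply: eq_bigr => j _; rewrite !mxE.
Qed.

Lemma frame_coefE k t :
  sin (theta (idx k) - t) * frame_coef k t = g%:R * sin (theta (idx k) - t' t).
Proof.
have := congr1 (fun u => dot u (row k Q)) (eigen_hess_frame k t).
by rewrite /= !dotZl dot_row mulr1.
Qed.

Local Notation K := (g.-1%:R * g%:R : R).
Local Notation psi t := (g%:R * (theta 1 - t)).

(** The Hessian in the frame [e], [nu], [Q]. On the plane of the normal circle it is [K] times a
    reflection, hence contributes 0 to the trace and the factor [- K ^ 2] to the determinant. *)
Definition frame_block t (D : 'M[R]_n) : 'M[R]_(1 + 1 + n) :=
  block_mx (block_mx (K * cos (psi t))%:M (K * sin (psi t))%:M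
                     (K * sin (psi t))%:M (- K * cos (psi t))%:M) 0 0 D.

Lemma frame_mx_hess t (D : 'M[R]_n) : Q *m hess F (e x t) = D *m Q ->
  frame_mx t *m hess F (e x t) = frame_block t D *m frame_mx t.
Proof.
move=> QH; rewrite /frame_block /frame_mx [RHS]mul_block_col mul_block_col.
rewrite !mul_col_mx QH.
rewrite (normal_point_hess g2 iso cov hF) // (normal_vector_hess g2 iso cov hF) //.
rewrite (focal_angleE _ g2) normal_pointD normal_vectorD !mul_scalar_mx !mul0mx !addr0 add0r.
by rewrite !scalerDr !scalerA mulrNN.
Qed.

Lemma trace_hess t : \tr (hess F (e x t)) = \sum_k frame_coef k t.
Proof.
have h := mulmx1C (frame_mx_orth t).
rewrite -[hess _ _]mulmx1 -h mulmxA mxtrace_mulC mulmxA.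
rewrite /mxtrace (eq_bigr (fun i => dot (row i (frame_mx t) *m hess F (e x t))
    (row i (frame_mx t)))); last first.
  move=> i _; rewrite [LHS]mxE; apply: eq_bigr => j _; rewrite -row_mul.
  by rewrite [row i (_ *m _) 0 j]mxE [row i _ 0 j]mxE [_^T j i]mxE.
rewrite big_split_ord big_split_ord !big_ord1 /frame_mx /=.
rewrite !rowKu rowKd !row_id (normal_point_hess g2 iso cov hF) // (normal_vector_hess g2 iso cov hF) //.
rewrite !dotZl (dot_point_point iso) // (dot_vector_vector iso) // mulNr subrr add0r.
by apply: eq_bigr => k _; rewrite rowKd.
Qed.

Lemma det_hess t : (forall k, sin (theta (idx k) - t) != 0) ->
  \det (hess F (e x t)) = - (g.-1%:R * g%:R) ^+ 2 *
    \prod_k (g%:R * sin (theta (idx k) - t' t) / sin (theta (idx k) - t)).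
Proof.
move=> hs; pose d : 'rV[R]_n :=
  \row_k (g%:R * sin (theta (idx k) - t' t) / sin (theta (idx k) - t)).
have QH : Q *m hess F (e x t) = diag_mx d *m Q.
  apply/row_matrixP => k; rewrite !row_mul row_diag_mx -scalemxAl -rowE.
  apply: (scalerI (hs k)); rewrite eigen_hess_frame scalerA mxE; congr (_ *: _).
  by field.
have B0 : \det (frame_mx t) != 0.
  apply/eqP => h; have := congr1 (fun A => \det A) (frame_mx_orth t).
  by rewrite /= det_mulmx h mul0r det1 => /esym/eqP; rewrite oner_eq0.
have := congr1 (fun A => \det A) (frame_mx_hess QH).
rewrite /= !det_mulmx mulrC => /(mulIf B0) ->.
rewrite /frame_block det_ublock det_block11 det_diag !mxE !mulr1n.
congr (_ * _); last by apply: eq_bigr => k _; rewrite mxE.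
transitivity (- K ^+ 2 * (cos (psi t) ^+ 2 + sin (psi t) ^+ 2)); first by ring.
by rewrite cos2Dsin2 mulr1.
Qed.

End Frame.
End EigenFrame.

(** * Cartan's identity and the multiplicities *)

Section Cartan.
Variables (R : realType) (n g : nat).
Variables (M : set 'rV[R]_n.+2) (xi : 'rV[R]_n.+2 -> 'rV[R]_n.+2).
Variables (theta : nat -> R) (m : nat -> nat) (F : mpoly.mpoly n.+2 R).
Hypothesis g2 : (2 <= g)%N.
Hypothesis iso : isoparametric g M xi theta m.
Variable M' : set 'rV[R]_n.+2.
Hypothesis cov : covered g M xi theta F M'.
Hypothesis hF : F \is mpoly.ishomog1 g (@mpoly.mdeg n.+2).
Implicit Types x v : 'rV[R]_n.+2.

Local Notation e := (normal_point xi).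
Local Notation nu := (normal_vector xi).
Local Notation Dxi x v := (dmap M xi x v).
Local Notation T x v := (tangent M x v).
Local Notation t' := (focal_angle g theta).

Definition laplacian : mpoly.mpoly n.+2 R :=
  \sum_i mpoly.mderiv i (mpoly.mderiv i F).

Lemma peval_laplacian y : peval laplacian y = \tr (hess F y).
Proof.
by rewrite /peval /laplacian raddf_sum; apply: eq_bigr => i _; rewrite mxE.
Qed.

Lemma sin_theta_sub_gt0 i t : (1 <= i <= g)%N -> 0 < t < theta 1 ->
  0 < sin (theta i - t).
Proof.
move=> hi /andP[t0 t1]; apply: sin_gt0_pi.
have /andP[_ ipi] := iso_theta_range iso hi.
have : theta 1 <= theta i.
  case/andP: hi; rewrite leq_eqVlt => /orP[/eqP <- //|i1] ig.
  by apply/ltW/(iso_theta_incr iso).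
by move=> h; apply/andP; split; lra.
Qed.

Lemma frame_coef_small x Q idx k t : M' x -> eigenframe g M xi theta x Q idx ->
  0 < t < theta 1 -> frame_coef xi F x Q k t =
    g%:R * sin (theta (idx k) - t' t) / sin (theta (idx k) - t).
Proof.
move=> M'x fr ht; rewrite -(frame_coefE g2 iso cov hF M'x fr) mulrAC divff ?mul1r //.
by rewrite lt0r_neq0 // sin_theta_sub_gt0 // (eigenframe_idx fr).
Qed.

(** For [0 < s < theta 1] the trace is a sum over the curvatures, weighted by the multiplicities,
    and these do not depend on the point; the remaining [s] follow by continuation. *)
Lemma laplacian_const x y s : M' x -> M' y ->
  peval laplacian (e x s) = peval laplacian (e y s).
Proof.
move=> M'x M'y; have [Q [idx fr]] := exists_eigenframe g2 iso cov hF M'x.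
have [Q' [idx' fr']] := exists_eigenframe g2 iso cov hF M'y.
apply: (trigpoly_eq (f := fun s => peval laplacian (e x s))
  (g := fun s => peval laplacian (e y s)) _ _ (theta1_gt0 g2 iso)).
- exact: trigpoly_peval_arc.
- exact: trigpoly_peval_arc.
move=> t ht; rewrite !peval_laplacian.
rewrite (trace_hess g2 iso cov hF M'x fr) (trace_hess g2 iso cov hF M'y fr').
under eq_bigr do rewrite (frame_coef_small _ M'x fr ht).
under [RHS]eq_bigr do rewrite (frame_coef_small _ M'y fr' ht).
pose f i := g%:R * sin (theta i - t' t) / sin (theta i - t).
by rewrite (sum_idx iso cov M'x fr f) (sum_idx iso cov M'y fr' f).
Qed.

(* Along a principal direction [v] for [theta j] the focal point [e x (theta j)]
   is stationary whereas the normal [nu x (theta j)] is not; as the gradient of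
   the Laplacian at the focal point is a combination of both, its normal
   component vanishes. *)
Lemma laplacian_focal x j : M' x -> (1 <= j <= g)%N ->
  dot (nu x (theta j)) (grad laplacian (e x (theta j))) = 0.
Proof.
move=> M'x hj; have Mx := covered_sub cov M'x.
have [v [v0 [c hc] hv]] := exists_eigen iso Mx hj.
set t := theta j; have [c0 cM dc] := hc.
have sj := sin_theta_gt0 iso hj.
have de := is_derive_normal_point_curve iso Mx t hc.
have dn := is_derive_normal_vector_curve iso Mx t hc.
have de0 : cos t *: v + sin t *: Dxi x v = 0.
  rewrite hv scalerA -scalerDl (_ : _ + _ = 0) ?scale0r //.
  by rewrite /cot -/t; field; rewrite lt0r_neq0.
have dn0 : - sin t *: v + cos t *: Dxi x v = - (sin t)^-1 *: v.
  rewrite hv scalerA -scalerDl; congr (_ *: _).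
  have := cos2Dsin2 t; rewrite /cot -/t => h.
  transitivity (- (cos t ^+ 2 + sin t ^+ 2) / sin t); last by rewrite h mulN1r.
  by field; rewrite lt0r_neq0.
rewrite de0 in de; rewrite dn0 in dn.
have dg := is_derive_grad laplacian de; rewrite mul0mx in dg.
pose al s := dot (e (c s) t) (grad laplacian (e (c s) t)).
have dal : is_derive (0 : R) (1 : R) al 0.
  by have := is_derive_dot de dg; rewrite dot0l dot0r addr0.
(* [be] is the derivative of the Laplacian along the normal circle, so it is the same for all points
   of [M'] and can be treated as a constant along [c]. *)
pose be := dot (nu x t) (grad laplacian (e x t)).
have hgr y : M' y -> grad laplacian (e y t) =
    dot (e y t) (grad laplacian (e y t)) *: e y t + be *: nu y t.
  move=> M'y; have My := covered_sub cov M'y.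
  have hT v' : T y v' -> dot v' (grad laplacian (e y t)) = 0.
    by apply: (tangent_grad_const g2 iso cov) => // *; exact: laplacian_const.
  rewrite {1}(frame_expand iso My t hT).
  congr (_ + _ *: _); rewrite /be.
  have h1 := is_derive_peval laplacian (is_derive_normal_point1 xi x t).
  have h2 := is_derive_peval laplacian (is_derive_normal_point1 xi y t).
  apply: is_derive_unique h2 _; rewrite (_ : (fun s => _) = fun s => peval laplacian (e x s)) //.
  by apply/funext => s; exact: laplacian_const.
have dg' : is_derive (0 : R) (1 : R) (fun s => grad laplacian (e (c s) t))
    (be *: (- (sin t)^-1 *: v)).
  have h := is_derive_add (is_derive_scale dal de)
    (is_derive_scale (is_derive_const be (0 : R)) dn).
  rewrite !scale0r scaler0 !add0r in h.
  apply: near_eq_is_derive h.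
  by have := covered_curve cov M'x hc; apply: filterS => s M'c; rewrite hgr.
have /eqP := is_derive_unique dg dg'; rewrite eq_sym scalerA scaler_eq0 (negbTE v0) orbF.
by rewrite mulf_eq0 oppr_eq0 invr_eq0 (gt_eqF sj) orbF => /eqP.
Qed.

Lemma frame_coef_peval x (Q : 'M[R]_(n, n.+2)) k : exists q : mpoly.mpoly n.+2 R,
  forall t, frame_coef xi F x Q k t = peval q (e x t).
Proof.
set v := row k Q.
exists (\sum_j v 0 j *: \sum_i v 0 i *: mpoly.mderiv i (mpoly.mderiv j F)) => t.
rewrite /frame_coef -/v /dot /peval raddf_sum; apply: eq_bigr => j _.
rewrite /= mpoly.mevalZ raddf_sum [RHS]mulrC; congr (_ * _).
rewrite [LHS]mxE; apply: eq_bigr => i _.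
by rewrite /= mpoly.mevalZ [hess _ _ _ _]mxE.
Qed.

Lemma theta_focal i j : (1 <= j <= g)%N ->
  theta i - t' (theta j) = (theta i - theta j) + j.-1%:R * pi.
Proof.
move=> hj; rewrite (focal_angleE _ g2) {2}(theta_arithmetic g2 iso cov hF hj).
by field; rewrite pnatr_eq0 -lt0n (leq_trans _ g2).
Qed.

(* In a neighborhood of [theta j] the coefficient is
   [g sin (theta i - t') / sin (theta i - t)] if [idx k = i <> j]; if
   [idx k = j] it is an even function of [t - theta j], in accordance with the
   junk value [cot 0 = 0]. *)
Lemma is_derive_frame_coef x Q idx k j : M' x -> eigenframe g M xi theta x Q idx ->
  (1 <= j <= g)%N ->
  is_derive (theta j) (1 : R) (frame_coef xi F x Q k)
    (g%:R ^+ 2 * (-1) ^+ j.-1 * cot (theta (idx k) - theta j)).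
Proof.
move=> M'x fr hj; set i := idx k; set a := frame_coef _ _ _ _ _.
have hi : (1 <= i <= g)%N := eigenframe_idx fr k.
have g0 : g%:R != 0 :> R by rewrite pnatr_eq0 -lt0n (leq_trans _ g2).
have aE t : sin (theta i - t) * a t = g%:R * sin (theta i - t' t).
  exact: (frame_coefE g2 iso cov hF M'x fr).
have [q hq] := frame_coef_peval x Q k.
have [d da] : exists d, is_derive (theta j) (1 : R) a d.
  have := is_derive_peval q (is_derive_normal_point1 xi x (theta j)).
  rewrite (_ : (fun t => peval q _) = a); last by apply/funext => t; rewrite -hq.
  by exists (dot (nu x (theta j)) (grad q (e x (theta j)))).
suff <- : d = g%:R ^+ 2 * (-1) ^+ j.-1 * cot (theta i - theta j) by [].
have [ij|ij] := eqVneq i j.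
  rewrite ij subrr /cot sin0 invr0 !mulr0.
  have ev (s : R) : a (theta j + s) = a (theta j - s).
    have ta : trigpoly a.
      apply: subalgebra_ext (trigpoly_peval_arc q x (xi x)) => s'.
      by rewrite [RHS]hq.
    have t1 : trigpoly (fun s => a (theta j + s)).
      apply: subalgebra_ext (trigpoly_shift (theta j) ta) => s'.
      by rewrite addrC.
    have t2 : trigpoly (fun s => a (theta j - s)).
      have [A [B hAB]] := t1; exists A, (- B) => s'.
      by rewrite hAB cosN sinN hornerN; ring.
    apply: (trigpoly_eq t1 t2 (pi_gt0 R)) => s' hs'.
    have s0 : sin s' != 0 by rewrite lt0r_neq0 // sin_gt0_pi.
    apply: (mulfI s0).
    have h1 := aE (theta j + s'); have h2 := aE (theta j - s').
    have f1 : theta i - t' (theta j + s') = g.-1%:R * s' + j.-1%:R * pi.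
      have := theta_focal i hj; rewrite ij subrr add0r => <-.
      by rewrite /focal_angle; ring.
    have f2 : theta i - t' (theta j - s') = - (g.-1%:R * s') + j.-1%:R * pi.
      have := theta_focal i hj; rewrite ij subrr add0r => <-.
      by rewrite /focal_angle; ring.
    move: h1 h2; rewrite f1 f2 !sinDnpi sinN ij.
    rewrite (_ : theta j - (theta j + s') = - s'); last by ring.
    rewrite (_ : theta j - (theta j - s') = s'); last by ring.
    by rewrite sinN => h1 ->; rewrite -[LHS]opprK -mulNr h1; ring.
  have h1 : is_derive (0 : R) (1 : R) (fun s => a (theta j + 1 * s)) (1 * d).
    by apply: is_derive_comp1 (is_derive_lin _ _ _) _; rewrite mulr0 addr0.
  have h2 : is_derive (0 : R) (1 : R) (fun s => a (theta j + -1 * s)) (-1 * d).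
    by apply: is_derive_comp1 (is_derive_lin _ _ _) _; rewrite mulr0 addr0.
  have : 1 * d = -1 * d.
    apply: is_derive_unique h1 _.
    rewrite (_ : (fun s => _) = fun s => a (theta j + -1 * s)) //.
    by apply/funext => s; rewrite mul1r mulN1r ev.
  by rewrite mul1r mulN1r; lra.
have sij : sin (theta i - theta j) != 0.
  have [lt|gt|eq] := ltngtP i j; last by rewrite eq eqxx in ij.
    rewrite -opprB sinN oppr_eq0 lt0r_neq0 //; apply: sin_gt0_pi.
    have h1 : theta i < theta j.
      by apply: (iso_theta_incr iso); [rewrite lt; case/andP: hi => ->|case/andP: hj].
    have ti := iso_theta_range iso hi; have tj := iso_theta_range iso hj.
    lra.
  rewrite lt0r_neq0 //; apply: sin_gt0_pi.
  have h1 : theta j < theta i.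
    by apply: (iso_theta_incr iso); [rewrite gt; case/andP: hj => ->|case/andP: hi].
  have ti := iso_theta_range iso hi; have tj := iso_theta_range iso hj.
  lra.
have aj : a (theta j) = g%:R * (-1) ^+ j.-1.
  apply: (mulfI sij); rewrite aE theta_focal // sinDnpi; ring.
(* Differentiate both sides of [aE] at [theta j]. The term from the left, with
   [a (theta j) = g (-1)^(j-1)], and the factor [g (g - 1)] from the right add up to
   [g + g (g - 1) = g ^ 2]. *)
have L : is_derive (theta j) (1 : R) (fun t => sin (theta i + -1 * t) * a t)
    (-1 * cos (theta i + -1 * theta j) * a (theta j) +
     sin (theta i + -1 * theta j) * d).
  exact: is_derive_mul (is_derive_sinl _ _ _) da.
have L' : is_derive (theta j) (1 : R)
    (fun t => g%:R * sin ((theta i - g%:R * theta 1) + g.-1%:R * t))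
    (0 * sin ((theta i - g%:R * theta 1) + g.-1%:R * theta j) +
     g%:R * (g.-1%:R * cos ((theta i - g%:R * theta 1) + g.-1%:R * theta j))).
  exact: is_derive_mul (is_derive_const _ _) (is_derive_sinl _ _ _).
have fE t : theta i - g%:R * theta 1 + g.-1%:R * t = theta i - t' t.
  by rewrite /focal_angle; ring.
have : -1 * cos (theta i + -1 * theta j) * a (theta j) +
     sin (theta i + -1 * theta j) * d =
     0 * sin ((theta i - g%:R * theta 1) + g.-1%:R * theta j) +
     g%:R * (g.-1%:R * cos ((theta i - g%:R * theta 1) + g.-1%:R * theta j)).
  apply: is_derive_unique L _.
  rewrite (_ : (fun t => _ * _) =
    fun t => g%:R * sin ((theta i - g%:R * theta 1) + g.-1%:R * t)) //.
  by apply/funext => t; rewrite mulN1r aE fE.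
rewrite fE theta_focal // cosDnpi mulN1r aj mul0r add0r mulN1r.
have -> : g.-1%:R = g%:R - 1 :> R.
  by rewrite -[in RHS](prednK (leq_trans _ g2 : (0 < g)%N)) // -natr1 addrK.
move=> h; apply: (mulfI sij).
rewrite -(addKr (- cos (theta i - theta j) * (g%:R * (-1) ^+ j.-1)) (_ * d)) h.
by rewrite /cot; field; exact: sij.
Qed.

(* The term [i = j] vanishes, since [cot 0 = 0] with Rocq's division by 0. *)
Lemma cartan_identity j : (1 <= j <= g)%N ->
  \sum_(1 <= i < g.+1) (m i)%:R * cot (theta i - theta j) = 0.
Proof.
move=> hj; have [x M'x] := covered_nonempty cov.
have [Q [idx fr]] := exists_eigenframe g2 iso cov hF M'x.
have g0 : g%:R != 0 :> R by rewrite pnatr_eq0 -lt0n (leq_trans _ g2).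
have h1 := is_derive_peval laplacian (is_derive_normal_point1 xi x (theta j)).
rewrite laplacian_focal // in h1.
have h2 := is_derive_bigsum (index_enum 'I_n) xpredT
  (fun k => is_derive_frame_coef k M'x fr hj).
rewrite (_ : (fun t => peval _ _) = fun t => \sum_k frame_coef xi F x Q k t) in h1; last first.
  by apply/funext => t; rewrite peval_laplacian (trace_hess g2 iso cov hF M'x fr).
have /esym/eqP := is_derive_unique h1 h2; rewrite -mulr_sumr mulf_eq0 mulf_eq0 signr_eq0 orbF.
rewrite expf_eq0 /= (negbTE g0) /= => /eqP.
by rewrite (sum_idx iso cov M'x fr (fun i => cot (theta i - theta j))).
Qed.

End Cartan.

(** * Multiple angles and special values *)

Section Trigonometry.
Variable R : realType.
Implicit Types y : R.

Lemma cotN y : cot (- y) = - cot y.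
Proof. by rewrite /cot cosN sinN invrN mulrN. Qed.

Lemma cot_piB y : cot (pi - y) = - cot y.
Proof.
rewrite /cot cosB sinB cospi sinpi !mul0r addr0 sub0r !mulN1r opprK.
by rewrite mulNr.
Qed.

Lemma cot0 : cot 0 = 0 :> R.
Proof. by rewrite /cot sin0 invr0 mulr0. Qed.

Lemma cot_pihalf : cot (pi / 2) = 0 :> R.
Proof. by rewrite /cot cos_pihalf mul0r. Qed.

Lemma cot_gt0 y : 0 < y < pi / 2 -> 0 < cot y.
Proof.
move=> /andP[y0 y1]; rewrite divr_gt0 ?cos_gt0_pihalf ?sin_gt0_pihalf ?y0 //.
by rewrite y1 andbT (lt_trans _ y0) // oppr_lt0 divr_gt0 ?pi_gt0.
Qed.

Lemma sin_natS y k : sin (k.+2%:R * y) = 2 * cos y * sin (k.+1%:R * y) - sin (k%:R * y).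
Proof.
have e1 : k.+2%:R * y = k.+1%:R * y + y by rewrite -[k.+2%:R]natr1; ring.
have e2 : k%:R * y = k.+1%:R * y - y by rewrite -[k.+1%:R]natr1; ring.
by rewrite e1 e2 sinD sinB; ring.
Qed.

Lemma cos_natS y k : cos (k.+2%:R * y) = 2 * cos y * cos (k.+1%:R * y) - cos (k%:R * y).
Proof.
have e1 : k.+2%:R * y = k.+1%:R * y + y by rewrite -[k.+2%:R]natr1; ring.
have e2 : k%:R * y = k.+1%:R * y - y by rewrite -[k.+1%:R]natr1; ring.
by rewrite e1 e2 cosD cosB; ring.
Qed.

Lemma sin_double y : sin (2 * y) = sin y * (2 * cos y).
Proof. by rewrite sin_natS mul1r mul0r sin0; ring. Qed.

Lemma cos_double y : cos (2 * y) = 2 * cos y ^+ 2 - 1.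
Proof. by rewrite cos_natS mul1r mul0r cos0; ring. Qed.

Lemma sin_triple y : sin (3 * y) = sin y * (4 * cos y ^+ 2 - 1).
Proof. by rewrite sin_natS sin_double mul1r; ring. Qed.

Lemma cos_triple y : cos (3 * y) = cos y * (4 * cos y ^+ 2 - 3).
Proof. by rewrite cos_natS cos_double mul1r; ring. Qed.

Lemma sin_quintuple y : sin (5 * y) = sin y * (16 * cos y ^+ 4 - 12 * cos y ^+ 2 + 1).
Proof. by rewrite sin_natS sin_natS sin_triple sin_double; ring. Qed.

Lemma cos_quintuple y : cos (5 * y) = cos y * (16 * cos y ^+ 4 - 20 * cos y ^+ 2 + 5).
Proof. by rewrite cos_natS cos_natS cos_triple cos_double; ring. Qed.

Lemma cos_pi3 : cos (pi / 3) = 1 / 2 :> R.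
Proof.
have p0 := pi_gt0 R.
have c0 : 0 < cos (pi / 3 : R) by apply: cos_gt0_pihalf; lra.
have : cos (3 * (pi / 3)) = -1 :> R by rewrite mulrC divfK // cospi.
rewrite cos_triple; set c := cos _ in c0 *; move=> h.
(* This is the factorization of [4 c^3 - 3 c + 1], which vanishes because [cos pi = -1]; positivity
   of [c] selects the double root. *)
have /eqP : (c + 1) * (2 * c - 1) ^+ 2 = 0.
  by transitivity (c * (4 * c ^+ 2 - 3) + 1); [ring | rewrite h; ring].
rewrite mulf_eq0 sqrf_eq0 gt_eqF /=; last by lra.
by move=> /eqP; lra.
Qed.

Lemma sin_pi3_sqr : sin (pi / 3) ^+ 2 = 3 / 4 :> R.
Proof. by rewrite sin2cos2 cos_pi3; field. Qed.

Lemma sin_pi3_gt0 : 0 < sin (pi / 3) :> R.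
Proof. by have p0 := pi_gt0 R; apply: sin_gt0_pi; lra. Qed.

Lemma cot_pi6 : cot (pi / 6) = 3 * cot (pi / 3) :> R.
Proof.
have -> : pi / 6 = pi / 2 - pi / 3 :> R by field.
rewrite /cot cosB sinB cos_pihalf sin_pihalf !mul0r !mul1r subr0 add0r.
have s0 := sin_pi3_gt0; have s2 := sin_pi3_sqr.
apply: (mulIf (lt0r_neq0 s0)); rewrite cos_pi3.
rewrite mulrAC -expr2 s2; field; exact: lt0r_neq0.
Qed.

(** This and [sin_tri] are the cases [N = 2, 3] of the product of [N] sines at distance [pi / N].
    The curvatures of equal multiplicity come in such groups: two pairs for [g = 4], one triple for
    [g = 3], two triples for [g = 6]. *)
Lemma sin_duo y : sin y * sin (y + pi / 2) = sin (2 * y) / 2.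
Proof. by rewrite sinDpihalf sin_double; field. Qed.

Lemma sin_tri y : sin y * sin (y + pi / 3) * sin (y + 2 * (pi / 3)) = sin (3 * y) / 4.
Proof.
rewrite sin_triple sinD sinD sin_double cos_double cos_pi3.
have s2 := sin_pi3_sqr; set z := sin (pi / 3) in s2 *.
have y2 := sin2cos2 y.
transitivity (sin y * (z ^+ 2 * cos y ^+ 2 - sin y ^+ 2 / 4)); first by field.
by rewrite s2 y2; field.
Qed.

End Trigonometry.

(** * Periodicity of the multiplicities *)

Section Multiplicities.
Variables (R : realType) (n g : nat).
Variables (M : set 'rV[R]_n.+2) (xi : 'rV[R]_n.+2 -> 'rV[R]_n.+2).
Variables (theta : nat -> R) (m : nat -> nat) (F : mpoly.mpoly n.+2 R).
Hypothesis g2 : (2 <= g)%N.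
Hypothesis iso : isoparametric g M xi theta m.
Variable M' : set 'rV[R]_n.+2.
Hypothesis cov : covered g M xi theta F M'.
Hypothesis hF : F \is mpoly.ishomog1 g (@mpoly.mdeg n.+2).

Local Notation c k := (cot (k%:R * (pi / g%:R)) : R).

Lemma cot_theta i j : (1 <= j <= i)%N -> (i <= g)%N ->
  cot (theta i - theta j) = c (i - j)%N /\ cot (theta j - theta i) = - c (i - j)%N.
Proof.
move=> /andP[j1 ji] ig.
have hi : (1 <= i <= g)%N by rewrite (leq_trans j1).
have hj : (1 <= j <= g)%N by rewrite j1 (leq_trans ji).
have e : theta i - theta j = (i - j)%:R * (pi / g%:R).
  rewrite (theta_arithmetic g2 iso cov hF hi) (theta_arithmetic g2 iso cov hF hj).
  have -> : (i - j)%:R = i.-1%:R - j.-1%:R :> R.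
    by rewrite -[in LHS](prednK j1) -[in LHS](prednK (leq_trans j1 ji)) subSS natrB // -ltnS
      !prednK // (leq_trans j1).
  ring.
by rewrite e -opprB e cotN.
Qed.

Lemma cot_compl k : (k <= g)%N -> c (g - k)%N = - c k.
Proof.
move=> kg; rewrite -cot_piB natrB //; congr cot; field.
by rewrite pnatr_eq0 -lt0n (leq_trans _ g2).
Qed.

Lemma cot_cartan (a b : nat) (q : R) : q != 0 ->
  (a%:R - b%:R) * q = 0 -> a = b.
Proof.
move=> q0 /eqP; rewrite mulf_eq0 (negbTE q0) orbF subr_eq0 eqr_nat.
by move/eqP.
Qed.

Lemma cartan_sum j : (1 <= j <= g)%N ->
  \sum_(1 <= i < g.+1) (m i)%:R *
    (if (j <= i)%N then c (i - j)%N else - c (j - i)%N) = 0.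
Proof.
move=> /andP[j1 jg]; rewrite -[RHS](cartan_identity g2 iso cov hF (j := j)) ?j1 //.
apply: eq_big_nat => i /andP[i1 ig]; rewrite ltnS in ig; congr (_ * _).
case: leqP => ij; first by rewrite (cot_theta _ ig).1 // j1.
by rewrite (cot_theta _ jg).2 // i1 ltnW.
Qed.

(** All cotangents in Cartan's identities are integer multiples of one nonzero number [q], by
    [cot (pi - y) = - cot y], [cot (pi / 2) = 0] and, for [g = 6], [cot (pi / 6) = 3 cot (pi / 3)].
    This leaves linear equations for the multiplicities. *)
Lemma multiplicities :
  [/\ g = 3 -> m 2 = m 1 /\ m 3 = m 1,
      g = 4 -> m 3 = m 1 /\ m 4 = m 2 &
      g = 6 -> [/\ m 3 = m 1, m 5 = m 1, m 4 = m 2 & m 6 = m 2]]%N.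
Proof.
have cart := cartan_sum; have cc := cot_compl; have p0 := pi_gt0 R.
have c0 a : cot (0%:R * a) = 0 :> R by rewrite mul0r cot0.
split=> g_eq; rewrite g_eq in cart cc.
- have q0 : cot (1%:R * (pi / 3)) != 0 :> R.
    by rewrite mul1r lt0r_neq0 // cot_gt0 //; lra.
  have := cart 1%N isT; have := cart 2 isT.
  rewrite unlock /= !(cc 1%N) // !c0; set q := cot _ in q0 * => h2 h1.
  have e1 : m 2 = m 3 by apply: (cot_cartan q0); rewrite -[RHS]h1; ring.
  have e2 : m 3 = m 1 by apply: (cot_cartan q0); rewrite -[RHS]h2; ring.
  by rewrite e1 e2.
- have q0 : cot (1%:R * (pi / 4)) != 0 :> R.
    by rewrite mul1r lt0r_neq0 // cot_gt0 //; lra.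
  have c2 : cot (2 * (pi / 4)) = 0 :> R.
    by rewrite -[RHS](cot_pihalf R); congr cot; field.
  have := cart 1%N isT; have := cart 2 isT.
  rewrite unlock /= !(cc 1%N) // !c0 !c2; set q := cot _ in q0 * => h2 h1.
  split; apply: (cot_cartan q0); first by rewrite -[RHS]h2; ring.
  by rewrite -[RHS]oppr0 -h1; ring.
- have q0 : cot (pi / 3) != 0 :> R by rewrite lt0r_neq0 // cot_gt0 //; lra.
  have c1 : cot (1%:R * (pi / 6)) = 3 * cot (pi / 3) :> R by rewrite mul1r cot_pi6.
  have c2 : cot (2 * (pi / 6)) = cot (pi / 3) :> R by congr cot; field.
  have c3 : cot (3 * (pi / 6)) = 0 :> R.
    by rewrite -[RHS](cot_pihalf R); congr cot; field.
  have := cart 1%N isT; have := cart 2 isT; have := cart 3 isT.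
  have := cart 4 isT; have := cart 5 isT; have := cart 6 isT.
  rewrite unlock /= !(cc 1%N) // !(cc 2%N) // !c0 !c3 !c2 !c1.
  move: q0; set q := cot _ => q0 h6 h5 h4 h3 h2 h1.
  split; apply: (cot_cartan q0); lra.
Qed.

End Multiplicities.

(** * The determinant of the Hessian *)

Section DetFormula.
Variables (R : realType) (n g : nat).
Variables (M : set 'rV[R]_n.+2) (xi : 'rV[R]_n.+2 -> 'rV[R]_n.+2).
Variables (theta : nat -> R) (m : nat -> nat) (F : mpoly.mpoly n.+2 R).
Hypothesis hg : g \in [:: 2; 3; 4; 6]%N.
Hypothesis iso : isoparametric g M xi theta m.
Variable M' : set 'rV[R]_n.+2.
Hypothesis cov : covered g M xi theta F M'.
Hypothesis hF : F \is mpoly.ishomog1 g (@mpoly.mdeg n.+2).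

Local Notation e := (normal_point xi).

Let g2 : (2 <= g)%N.
Proof. by move: hg; rewrite !inE => /or4P[] /eqP ->. Qed.

(* Up to a negative constant this is [det (hess F)] at a point of the sphere
   where [F = cos z]: the factors come from the principal curvatures of odd and
   of even index, respectively. *)
Definition hess_sign_fun (k m1 m2 : nat) (z : R) : R :=
  (- (sin (k%:R * (z / 2)) / sin (z / 2))) ^+ m1 *
  (cos (k%:R * (z / 2)) / cos (z / 2)) ^+ m2.

Lemma prod_curvatures (s : R) : 0 < g%:R * s < pi ->
  \prod_(1 <= i < g.+1) (sin (i.-1%:R * (pi / g%:R) + s - g%:R * s) /
                         sin (i.-1%:R * (pi / g%:R) + s)) ^+ m i =
  hess_sign_fun g.-1 (m 1) (m 2) (g%:R * s).
Proof.
have p0 := pi_gt0 R; have [m3 m4 m6] := multiplicities g2 iso cov hF.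
move: hg; rewrite !inE => /or4P[] /eqP g_eq; rewrite g_eq /= => hs;
  rewrite unlock /= ?mul0r ?add0r ?mul1r /hess_sign_fun.
- have s0 : 0 < sin s by apply: sin_gt0_pi; lra.
  have c0 : 0 < cos s by apply: cos_gt0_pihalf; lra.
  rewrite mulr1 !mul1r.
  rewrite (_ : s - 2 * s = - s); last by ring.
  rewrite (_ : pi / 2 + s - 2 * s = - s + pi / 2); last by ring.
  rewrite (_ : 2 * s / 2 = s); last by field.
  rewrite [pi / 2 + s]addrC !sinDpihalf cosN sinN mulNr !divff ?lt0r_neq0 //.
(* For [g = 3] all three factors merge into one quotient [- sin (6 s) / sin (3 s)]; the double-angle
   formula splits it again into the sine and the cosine quotient. *)
- have [e2 e3] := m3 g_eq.
  have s1 : 0 < sin s by apply: sin_gt0_pi; lra.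
  have s2 : 0 < sin (s + pi / 3) by apply: sin_gt0_pi; lra.
  have s3 : 0 < sin (s + 2 * (pi / 3)) by apply: sin_gt0_pi; lra.
  have s4 : 0 < sin (3 * s / 2) by apply: sin_gt0_pi; lra.
  have c4 : 0 < cos (3 * s / 2) by apply: cos_gt0_pihalf; lra.
  rewrite mulr1 e2 e3 -!exprMn; congr (_ ^+ _).
  set y := s - 3 * s.
  have -> : pi / 3 + s - 3 * s = y + pi / 3 by rewrite /y; ring.
  have -> : 2 * (pi / 3) + s - 3 * s = y + 2 * (pi / 3) by rewrite /y; ring.
  rewrite [pi / 3 + s]addrC [2 * (pi / 3) + s]addrC.
  have t1 := sin_tri y; have t2 := sin_tri s.
  transitivity ((sin y * sin (y + pi / 3) * sin (y + 2 * (pi / 3))) /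
     (sin s * sin (s + pi / 3) * sin (s + 2 * (pi / 3)))).
    by field; rewrite !lt0r_neq0.
  rewrite t1 t2.
  have -> : 3 * y = - (2 * (3 * s)) by rewrite /y; ring.
  have [h hE] : {h | h = 3 * s / 2} by exists (3 * s / 2).
  rewrite -hE in s4 c4 *.
  have -> : 3 * s = 2 * h by rewrite hE; field.
  rewrite sinN [sin (2 * (2 * h))]sin_double [sin (2 * h)]sin_double.
  by field; rewrite !lt0r_neq0.
- have [e3 e4] := m4 g_eq.
  have s1 : 0 < sin s by apply: sin_gt0_pi; lra.
  have s2 : 0 < sin (s + pi / 2) by apply: sin_gt0_pi; lra.
  have s3 : 0 < sin (s + pi / 4) by apply: sin_gt0_pi; lra.
  have s4 : 0 < sin (s + pi / 4 + pi / 2) by apply: sin_gt0_pi; lra.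
  have s5 : 0 < sin (2 * s) by apply: sin_gt0_pi; lra.
  have c5 : 0 < cos (2 * s) by apply: cos_gt0_pihalf; lra.
  rewrite mulr1 e3 e4; set y := s - 4 * s.
  have -> : pi / 4 + s - 4 * s = y + pi / 4 by rewrite /y; ring.
  have -> : 2 * (pi / 4) + s - 4 * s = y + pi / 2 by rewrite /y; field.
  have -> : 3 * (pi / 4) + s - 4 * s = y + pi / 4 + pi / 2 by rewrite /y; field.
  have -> : pi / 4 + s = s + pi / 4 by ring.
  have -> : 2 * (pi / 4) + s = s + pi / 2 by field.
  have -> : 3 * (pi / 4) + s = s + pi / 4 + pi / 2 by field.
  have t1 := sin_duo y; have t2 := sin_duo s.
  have t3 := sin_duo (y + pi / 4); have t4 := sin_duo (s + pi / 4).
  transitivity ((sin y * sin (y + pi / 2) / (sin s * sin (s + pi / 2))) ^+ m 1 *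
    (sin (y + pi / 4) * sin (y + pi / 4 + pi / 2) /
       (sin (s + pi / 4) * sin (s + pi / 4 + pi / 2))) ^+ m 2).
    rewrite [RHS]mulrC mulrCA mulrA [RHS]mulrC.
    by rewrite !invfM !exprMn; ring.
  rewrite t1 t2 t3 t4.
  have -> : 2 * (y + pi / 4) = 2 * y + pi / 2 by field.
  have -> : 2 * (s + pi / 4) = 2 * s + pi / 2 by field.
  rewrite !sinDpihalf.
  have -> : 2 * y = - (3 * (4 * s / 2)) by rewrite /y; field.
  rewrite sinN cosN; have -> : 4 * s / 2 = 2 * s by field.
  by congr (_ ^+ _ * _ ^+ _); field; rewrite lt0r_neq0.
- have [e3 e5 e4 e6] := m6 g_eq.
  have h0 : 0 < s by lra.
  have s1 : 0 < sin s by apply: sin_gt0_pi; lra.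
  have s2 : 0 < sin (s + pi / 3) by apply: sin_gt0_pi; lra.
  have s3 : 0 < sin (s + 2 * (pi / 3)) by apply: sin_gt0_pi; lra.
  pose r := s + pi / 6; have rE : r = s + pi / 6 by [].
  have r1 : 0 < sin r by apply: sin_gt0_pi; lra.
  have r2 : 0 < sin (r + pi / 3) by apply: sin_gt0_pi; lra.
  have r3 : 0 < sin (r + 2 * (pi / 3)) by apply: sin_gt0_pi; lra.
  have s5 : 0 < sin (3 * s) by apply: sin_gt0_pi; lra.
  have c5 : 0 < cos (3 * s) by apply: cos_gt0_pihalf; lra.
  rewrite mulr1 e3 e4 e5 e6; pose y := s - 6 * s; pose z := y + pi / 6.
  have -> : s - 6 * s = y by [].
  have -> : pi / 6 + s - 6 * s = z by rewrite /z /y; ring.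
  have -> : 2 * (pi / 6) + s - 6 * s = y + pi / 3 by rewrite /y; field.
  have -> : 3 * (pi / 6) + s - 6 * s = z + pi / 3 by rewrite /z /y; field.
  have -> : 4 * (pi / 6) + s - 6 * s = y + 2 * (pi / 3) by rewrite /y; field.
  have -> : 5 * (pi / 6) + s - 6 * s = z + 2 * (pi / 3) by rewrite /z /y; field.
  have -> : pi / 6 + s = r by rewrite rE; ring.
  have -> : 2 * (pi / 6) + s = s + pi / 3 by field.
  have -> : 3 * (pi / 6) + s = r + pi / 3 by rewrite rE; field.
  have -> : 4 * (pi / 6) + s = s + 2 * (pi / 3) by field.
  have -> : 5 * (pi / 6) + s = r + 2 * (pi / 3) by rewrite rE; field.
  have t1 := sin_tri y; have t2 := sin_tri s.
  have t3 := sin_tri z; have t4 := sin_tri r.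
  transitivity ((sin y * sin (y + pi / 3) * sin (y + 2 * (pi / 3)) /
       (sin s * sin (s + pi / 3) * sin (s + 2 * (pi / 3)))) ^+ m 1 *
     (sin z * sin (z + pi / 3) * sin (z + 2 * (pi / 3)) /
       (sin r * sin (r + pi / 3) * sin (r + 2 * (pi / 3)))) ^+ m 2).
    by rewrite !invfM !exprMn; ring.
  rewrite t1 t2 t3 t4.
  have -> : 3 * z = 3 * y + pi / 2 by rewrite /z; field.
  have -> : 3 * r = 3 * s + pi / 2 by rewrite rE; field.
  rewrite !sinDpihalf.
  have -> : 3 * y = - (5 * (6 * s / 2)) by rewrite /y; field.
  rewrite sinN cosN; have -> : 6 * s / 2 = 3 * s by field.
  by congr (_ ^+ _ * _ ^+ _); field; rewrite lt0r_neq0.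
Qed.

(** A polynomial in [F] is what can be continued over the sphere. For odd [g - 1] each of the two
    quotients is a polynomial in [cos (z / 2) ^ 2], hence in [cos z]; for [g = 3] only their product
    is, which requires [m 2 = m 1]. The explicit values for [g = 2, 3] serve the regular focal
    values. *)
Lemma hess_sign_poly : exists P : {poly R},
  [/\ forall z, 0 < z < pi -> P.[cos z] = hess_sign_fun g.-1 (m 1) (m 2) z,
      g = 2%N -> forall c, P.[c] = (-1) ^+ m 1 &
      g = 3%N -> forall c, P.[c] = (- (2 * c)) ^+ m 1].
Proof.
have [m3 _ _] := multiplicities g2 iso cov hF.
have hz z : 0 < z < pi -> [/\ 0 < sin (z / 2), 0 < cos (z / 2) &
    cos z = 2 * cos (z / 2) ^+ 2 - 1].
  have p0 := pi_gt0 R; move=> h; split.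
  - by apply: sin_gt0_pi; lra.
  - by apply: cos_gt0_pihalf; lra.
  - by rewrite -cos_double; congr cos; field.
rewrite /hess_sign_fun.
move: hg; rewrite !inE => /or4P[] /eqP g_eq; rewrite g_eq /=.
- exists ((-1) ^+ m 1)%:P; split=> [z /hz[s0 c0 _]|_ c|//]; last exact: hornerC.
  by rewrite hornerC mul1r !divff ?lt0r_neq0 // expr1n mulr1.
- exists ((- (2 *: 'X)) ^+ m 1); split=> [z /hz[s0 c0 cz]|//|_ c]; last first.
    by rewrite horner_exp hornerN hornerZ hornerX.
  have [-> _] := m3 g_eq.
  rewrite horner_exp hornerN hornerZ hornerX -exprMn; congr (_ ^+ _).
  by rewrite sin_double cos_double cz; field; rewrite !lt0r_neq0.
- exists ((- (2 *: 'X + 1%:P)) ^+ m 1 * (2 *: 'X - 1%:P) ^+ m 2).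
  split=> // z /hz[s0 c0 cz].
  rewrite hornerM !horner_exp !(hornerN, hornerD, hornerZ, hornerX, hornerC).
  by congr (_ ^+ _ * _ ^+ _); rewrite ?sin_triple ?cos_triple cz; field; rewrite lt0r_neq0.
- exists ((- (4 *: ('X * 'X) + 2 *: 'X - 1%:P)) ^+ m 1 *
          (4 *: ('X * 'X) - 2 *: 'X - 1%:P) ^+ m 2).
  split=> // z /hz[s0 c0 cz].
  rewrite hornerM !horner_exp !(hornerN, hornerD, hornerZ, hornerM, hornerX, hornerC).
  by congr (_ ^+ _ * _ ^+ _); rewrite ?sin_quintuple ?cos_quintuple cz; field; rewrite lt0r_neq0.
Qed.

Lemma det_hess_covered (P : {poly R}) :
  (forall z, 0 < z < pi -> P.[cos z] = hess_sign_fun g.-1 (m 1) (m 2) z) ->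
  exists2 C : R, 0 < C & forall x t, M' x ->
    \det (hess F (e x t)) = - C * P.[peval F (e x t)].
Proof.
move=> hP; have g0 : 0 < g%:R :> R by rewrite ltr0n (leq_trans _ g2).
have g1 : 0 < g.-1%:R :> R by rewrite ltr0n; case: g g2 => [|[]].
(* The square comes from the reflection in the plane of the normal circle, and each of the [n]
   principal directions contributes a factor [g]. *)
exists ((g.-1%:R * g%:R) ^+ 2 * g%:R ^+ n) => [|x t M'x].
  by rewrite mulr_gt0 ?exprn_gt0 ?mulr_gt0.
have [Q [idx fr]] := exists_eigenframe g2 iso cov hF M'x.
have S := trigpoly_subalgebra R.
have tp1 : trigpoly (fun t => \det (hess F (e x t))).
  apply: (subalgebra_det S) => i j.
  apply: subalgebra_ext (trigpoly_peval_arc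
    (mpoly.mderiv i (mpoly.mderiv j F)) x (xi x)) => s.
  by rewrite mxE.
have tp2 : trigpoly (fun t =>
    - ((g.-1%:R * g%:R) ^+ 2 * g%:R ^+ n) * P.[peval F (e x t)]).
  apply: (subalgebraM S); first exact: (subalgebra_cst S).
  by apply: (subalgebra_horner S); exact: trigpoly_peval_arc.
apply: (trigpoly_eq tp1 tp2 (theta1_gt0 g2 iso)) => {}t ht.
have hs i : (1 <= i <= g)%N -> 0 < sin (theta i - t).
  by move=> hi; exact: (sin_theta_sub_gt0 iso hi ht).
rewrite (det_hess g2 iso cov hF M'x fr) => [|k]; last first.
  by rewrite lt0r_neq0 // hs // (eigenframe_idx fr).
pose f i := sin (theta i - focal_angle g theta t) / sin (theta i - t).
rewrite (eq_bigr (fun k => g%:R * f (idx k))) => [|k _]; last by rewrite /f mulrA.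
rewrite big_split /= prodr_const card_ord (prod_idx iso cov M'x fr f).
rewrite (covered_peval cov) // hP; last first.
  have /andP[h1 h2] := ht; have h3 := g_theta1_lt_pi g2 iso cov hF.
  by rewrite mulr_gt0 ?subr_gt0 //= (lt_trans _ h3) // ltr_pM2l //; lra.
rewrite -prod_curvatures; last first.
  have /andP[h1 h2] := ht; have h3 := g_theta1_lt_pi g2 iso cov hF.
  by rewrite mulr_gt0 ?subr_gt0 //= (lt_trans _ h3) // ltr_pM2l //; lra.
rewrite (_ : \prod_(1 <= i < g.+1) f i ^+ m i = \prod_(1 <= i < g.+1)
    (sin (i.-1%:R * (pi / g%:R) + (theta 1 - t) - g%:R * (theta 1 - t)) /
     sin (i.-1%:R * (pi / g%:R) + (theta 1 - t))) ^+ m i); first by ring.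
apply: eq_big_nat => i hi; rewrite /f; congr ((_ / _) ^+ _); congr sin.
  rewrite (focal_angleE _ g2) (theta_arithmetic g2 iso cov hF hi); ring.
by rewrite (theta_arithmetic g2 iso cov hF hi); ring.
Qed.

End DetFormula.

(** * Combinations of two points of a great circle *)

Section Chords.
Variable R : realType.
Implicit Types a b c : R.

(* If [u] is a unit complex number with real part [c], the pair [(p, q)]
   satisfies [p + q u = u (a + b u^-1)^k]. *)
Fixpoint chord_coef (k : nat) a b c : R * R :=
  if k is k'.+1 then
    let pq := chord_coef k' a b c in
    (a * pq.1 + b * pq.2 + 2 * c * b * pq.1, a * pq.2 - b * pq.1)
  else (0, 1).

(** With [u = exp (i psi)] and [a + b u = r exp (i sigma)], these are the real and imaginary parts
    of [p + q u = r^k exp (i (psi - k sigma))]. The recursion multiplies by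
    [a + b u^-1 = r exp (- i sigma)], using [u^-1 = 2 c - u]. *)
Lemma chord_coef_polar k a b psi r sigma :
  a + b * cos psi = r * cos sigma -> b * sin psi = r * sin sigma ->
  let pq := chord_coef k a b (cos psi) in
  pq.1 + pq.2 * cos psi = r ^+ k * cos (psi - k%:R * sigma) /\
  pq.2 * sin psi = r ^+ k * sin (psi - k%:R * sigma).
Proof.
move=> ha hb; elim: k => [|k [IH1 IH2]] /=.
  by rewrite expr0 mul0r subr0 !mul1r add0r.
move: IH1 IH2; set p := (chord_coef k a b _).1; set q := (chord_coef k a b _).2.
have -> : psi - k.+1%:R * sigma = psi - k%:R * sigma - sigma by rewrite -natr1; ring.
move: (psi - k%:R * sigma) => s IH1 IH2.
rewrite cosB sinB exprS.
have s2 := sin2cos2 psi; split.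
  transitivity ((r ^+ k * cos s) * (r * cos sigma) + (r ^+ k * sin s) * (r * sin sigma)).
    rewrite -IH1 -IH2 -ha -hb.
    transitivity (a * (p + q * cos psi) +
      b * (cos psi * p + cos psi ^+ 2 * q + q * (1 - cos psi ^+ 2))).
      by ring.
    by rewrite -s2; ring.
  by ring.
transitivity ((r ^+ k * sin s) * (r * cos sigma) - (r ^+ k * cos s) * (r * sin sigma)).
  by rewrite -IH1 -IH2 -ha -hb; ring.
by ring.
Qed.

Lemma polar a b : exists r sigma : R, a = r * cos sigma /\ b = r * sin sigma.
Proof.
pose r := Num.sqrt (a ^+ 2 + b ^+ 2).
have h : 0 <= a ^+ 2 + b ^+ 2 by rewrite addr_ge0 ?sqr_ge0.
have r2 : r ^+ 2 = a ^+ 2 + b ^+ 2 by rewrite sqr_sqrtr.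
have [r0|r0] := eqVneq r 0.
  exists 0, 0; rewrite !mul0r; move: r2; rewrite r0 expr0n /= => /esym/eqP.
  by rewrite paddr_eq0 ?sqr_ge0 // !sqrf_eq0 => /andP[/eqP -> /eqP ->].
have r_gt0 : 0 < r by rewrite lt_neqAle eq_sym r0 sqrtr_ge0.
have ar : -1 <= a / r <= 1.
  by rewrite ler_pdivlMr // ler_pdivrMr // mulN1r mul1r; apply/andP; split; nra.
have ca : cos (acos (a / r)) = a / r by rewrite acosK // in_itv.
set S := sin (acos (a / r)).
have S0 : 0 <= r * S.
  apply: mulr_ge0; first exact: ltW.
  by apply: sin_ge0_pi; rewrite acos_ge0 // acos_lepi.
have S2 : (r * S) ^+ 2 = b ^+ 2.
  rewrite exprMn /S sin2cos2 ca mulrBr mulr1 -exprMn mulrC divfK //.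
  by rewrite r2 addrC addKr.
have [b0|b0] := leP 0 b.
  exists r, (acos (a / r)); rewrite ca mulrC divfK //; split=> //.
  by apply/eqP; rewrite -(@eqrXn2 _ 2) // S2.
exists r, (- acos (a / r)); rewrite cosN sinN ca mulrC divfK //; split=> //.
rewrite mulrN -/S; apply/eqP; rewrite -(inj_eq oppr_inj) opprK.
by rewrite -(@eqrXn2 _ 2) ?oppr_ge0 ?(ltW b0) // sqrrN S2.
Qed.

Lemma polyfun_chord_coef n k a b (f : 'rV[R]_n -> R) : polyfun f ->
  polyfun (fun x => (chord_coef k a b (f x)).1) /\
  polyfun (fun x => (chord_coef k a b (f x)).2).
Proof.
move=> hf; have S := polyfun_subalgebra R n.
have hc (q : R) : polyfun (fun _ : 'rV[R]_n => q) := subalgebra_cst S q.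
elim: k => [|k [IH1 IH2]] /=; first by split; exact: hc.
split.
  apply: (subalgebraD S); first apply: (subalgebraD S); apply: (subalgebraM S) => //;
    by apply: (subalgebraM S) => //; apply: (subalgebraM S).
by apply: (subalgebraB S); apply: (subalgebraM S).
Qed.

End Chords.

(** * Continuation of the identities to the whole sphere *)

Section Globalization.
Variables (R : realType) (n g : nat).
Variables (M : set 'rV[R]_n.+2) (xi : 'rV[R]_n.+2 -> 'rV[R]_n.+2).
Variables (theta : nat -> R) (m : nat -> nat) (F : mpoly.mpoly n.+2 R).
Hypothesis g2 : (2 <= g)%N.
Hypothesis iso : isoparametric g M xi theta m.
Variable M' : set 'rV[R]_n.+2.
Hypothesis cov : covered g M xi theta F M'.
Hypothesis hF : F \is mpoly.ishomog1 g (@mpoly.mdeg n.+2).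

Local Notation e := (normal_point xi).
Local Notation Phi := (gradient_map g F).

Lemma sphere_ext (f h : 'rV[R]_n.+2 -> R) : polyfun f -> polyfun h ->
  (forall x t, M' x -> f (e x t) = h (e x t)) ->
  forall y, sphere R n.+2 y -> f y = h y.
Proof.
move=> pf ph hfh; have [Om [p [oO Op Sp hO]]] := covered_image cov.
apply: (polyfun_sphere_eq pf ph oO Op Sp) => y Sy Oy.
by have [x [t [M'x ->]]] := hO y Sy Oy; exact: hfh.
Qed.

Lemma gradient_map_normal_point x t : M' x -> Phi (e x t) = e x (focal_angle g theta t).
Proof.
move=> M'x; rewrite gradient_mapE (grad_normal_point g2 iso cov hF) // scalerA mulVf ?scale1r //.
by rewrite pnatr_eq0 -lt0n (leq_trans _ g2).
Qed.

Lemma gradient_map_sphere y : sphere R n.+2 y -> sphere R n.+2 (Phi y).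
Proof.
have S := polyfun_subalgebra R n.+2; have hP := gradient_map_polymap g F.
apply: (sphere_ext (f := fun y => dot (Phi y) (Phi y)) (h := fun=> 1)).
- exact: (subalgebra_dot S).
- exact: (subalgebra_cst S).
- move=> x t M'x; rewrite gradient_map_normal_point //.
  by rewrite (dot_point_point iso) ?subrr ?cos0 //; exact: (covered_sub cov).
Qed.

(** For [y = e x t] the argument is [r e x (t + sigma)]. By homogeneity its image is
    [r^(g-1) e x (t + psi - (g - 1) sigma)], which [chord_coef_polar] expresses through [e x t] and
    [e x (t + psi) = Phi y]. The coefficients depend polynomially on [cos psi = F y], so the
    identity continues. *)
Lemma gradient_map_chord a b y : sphere R n.+2 y ->
  Phi (a *: y + b *: Phi y) = (chord_coef g.-1 a b (peval F y)).1 *: y +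
    (chord_coef g.-1 a b (peval F y)).2 *: Phi y.
Proof.
have S := polyfun_subalgebra R n.+2; have hP := gradient_map_polymap g F.
have hc (q : R) : polyfun (fun _ : 'rV[R]_n.+2 => q) := subalgebra_cst S q.
have [p1 p2] := polyfun_chord_coef g.-1 a b (polyfun_peval F).
move=> Sy; apply/rowP => j.
pose f y := Phi (a *: y + b *: Phi y) 0 j.
pose h y := ((chord_coef g.-1 a b (peval F y)).1 *: y +
    (chord_coef g.-1 a b (peval F y)).2 *: Phi y) 0 j.
apply: (sphere_ext (f := f) (h := h)) Sy.
- have [q hq] := hP j; apply: (@subalgebra_ext _ _ _ (fun y => peval q (a *: y + b *: Phi y))).
    by move=> z; rewrite /f hq.
  apply: (subalgebra_peval S) => i.
  rewrite (_ : (fun s => _) = fun y : 'rV[R]_n.+2 => a * y 0 i + b * Phi y 0 i); last first.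
    by apply/funext => z; rewrite mxE [X in X + _]mxE [X in _ + X]mxE.
  apply: (subalgebraD S); apply: (subalgebraM S); [exact: hc| |exact: hc|exact: hP].
  exact: polyfun_coord.
- apply: (@subalgebra_ext _ _ _ (fun y => (chord_coef g.-1 a b (peval F y)).1 * y 0 j +
    (chord_coef g.-1 a b (peval F y)).2 * Phi y 0 j)).
    by move=> z; rewrite /h [RHS]mxE [X in _ = X + _]mxE [X in _ = _ + X]mxE.
  apply: (subalgebraD S); apply: (subalgebraM S) => //; exact: polyfun_coord.
- move=> x t M'x; rewrite /f /h gradient_map_normal_point // (covered_peval cov) //.
  rewrite (focal_angleE _ g2); set psi := g%:R * (theta 1 - t).
  have [r [sigma [ha hb]]] := polar (a + b * cos psi) (b * sin psi).
  have [h1 h2] := chord_coef_polar g.-1 ha hb.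
  have key p q : p *: e x t + q *: e x (t + psi) =
      (p + q * cos psi) *: e x t + (q * sin psi) *: normal_vector xi x t.
    rewrite normal_pointD; move: (e x t) (normal_vector xi x t) => E N.
    by rewrite scalerDr !scalerA addrA -scalerDl.
  have key2 q s : (q * cos s) *: e x t + (q * sin s) *: normal_vector xi x t =
      q *: e x (t + s).
    rewrite normal_pointD; move: (e x t) (normal_vector xi x t) => E N.
    by rewrite scalerDr !scalerA.
  rewrite !key ha hb h1 h2 !key2.
  rewrite (gradient_map_homog hF) gradient_map_normal_point //.
  congr ((_ *: e x _) 0 j); have := focal_angleE theta g2 t; rewrite -/psi => h3.
  by rewrite addrA -h3 /focal_angle; ring.
Qed.

(** Otherwise [F ^ 2 = 1] on an open piece of the sphere, hence on all of it, although
    [F = cos (g theta 1)] on [M']. *)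
Lemma nonfocal_dense (O : set 'rV[R]_n.+2) y : open O -> O y -> sphere R n.+2 y ->
  exists z, [/\ O z, sphere R n.+2 z & peval F z ^+ 2 != 1].
Proof.
move=> oO Oy Sy; apply: contrapT => hn.
have S := polyfun_subalgebra R n.+2.
have hO z : sphere R n.+2 z -> O z -> peval F z ^+ 2 = 1.
  by move=> Sz Oz; apply/eqP; apply: contrapT => /negP h; apply: hn; exists z.
have [x M'x] := covered_nonempty cov; have Mx := covered_sub cov M'x.
have := @polyfun_sphere_eq _ _ (fun z => peval F z ^+ 2) (fun=> 1) _ _
  (subalgebraX S 2 (polyfun_peval F)) (subalgebra_cst S 1) oO Oy Sy hO _
  (sphere_normal_point iso Mx 0).
rewrite (covered_peval cov) // subr0 cos2sin2 => /eqP.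
rewrite -subr_eq0 addrAC subrr add0r oppr_eq0 sqrf_eq0.
by rewrite (gt_eqF (sin_g_theta1 g2 iso cov hF)).
Qed.

Lemma det_hess_sphere (C : R) (P : {poly R}) :
  (forall x t, M' x -> \det (hess F (e x t)) = - C * P.[peval F (e x t)]) ->
  forall y, sphere R n.+2 y -> \det (hess F y) = - C * P.[peval F y].
Proof.
have S := polyfun_subalgebra R n.+2; move=> h.
apply: (sphere_ext (f := fun y => \det (hess F y)) (h := fun y => - C * P.[peval F y])) => //.
- apply: (subalgebra_det S) => i j.
  by exists (mpoly.mderiv i (mpoly.mderiv j F)) => y; rewrite mxE.
- apply: (subalgebraM S); first exact: (subalgebra_cst S).
  by apply: (subalgebra_horner S); exact: polyfun_peval.
Qed.

End Globalization.

(** * The fibers of the gradient map *)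

Section Degree.
Variables (R : realType) (n g m1 m2 : nat) (F : mpoly.mpoly n.+2 R).
Variables (C : R) (P : {poly R}).
Local Notation S := (sphere R n.+2).
Local Notation Phi := (gradient_map g F).
Local Notation k := (g.-1).
Hypothesis hg : g \in [:: 2; 3; 4; 6]%N.
Hypothesis hF : F \is mpoly.ishomog1 g (@mpoly.mdeg n.+2).
Hypothesis Phi_sphere : forall y, S y -> S (Phi y).
Hypothesis Phi_chord : forall a b y, S y ->
  Phi (a *: y + b *: Phi y) = (chord_coef k a b (peval F y)).1 *: y +
    (chord_coef k a b (peval F y)).2 *: Phi y.
Hypothesis nonfocal_approx : forall (O : set 'rV[R]_n.+2) y, open O -> O y -> S y ->
  exists z, [/\ O z, S z & peval F z ^+ 2 != 1].
Hypothesis C_gt0 : 0 < C.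
Hypothesis det_hessE : forall y, S y -> \det (hess F y) = - C * P.[peval F y].
Hypothesis P_cos : forall z : R, 0 < z < pi -> P.[cos z] = hess_sign_fun k m1 m2 z.
Hypothesis P_2 : g = 2%N -> forall c, P.[c] = (-1) ^+ m1.
Hypothesis P_3 : g = 3%N -> forall c, P.[c] = (- (2 * c)) ^+ m1.
Hypothesis P_3_multiplicity : g = 3%N -> m2 = m1.
Hypothesis m1_gt0 : (0 < m1)%N.
Hypothesis m2_gt0 : (0 < m2)%N.
Implicit Types x y : 'rV[R]_n.+2.

Let g2 : (2 <= g)%N.
Proof. by move: hg; rewrite !inE => /or4P[] /eqP ->. Qed.

Let k_gt0 : 0 < k%:R :> R.
Proof. by rewrite ltr0n; case: g g2 => [|[]]. Qed.

Let k_le5 : (k <= 5)%N.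
Proof. by move: hg; rewrite !inE => /or4P[] /eqP ->. Qed.

(* The local degree at a preimage [x] of a nonfocal point with [F x = cos z],
   [j pi < (g - 1) z < (j + 1) pi]. *)
Definition degree_term (j : nat) : int :=
  match j with
  | 1%N => - ((-1) ^+ m1 * (-1) ^+ m2)
  | 2%N => - (-1) ^+ m2
  | 3%N => - 1
  | _ => - (-1) ^+ m1
  end.

(** The denominators are positive, and [w = (g - 1) z / 2] lies in the open quadrant number [j],
    counted from 0; the signs of [sin w] and [cos w] are read off, and [j = 4] repeats [j = 0]. *)
Lemma sgz_hess_sign j (z : R) : (j < 5)%N -> 0 < z < pi ->
  j%:R * pi < k%:R * z < j.+1%:R * pi ->
  - sgz (hess_sign_fun k m1 m2 z) = degree_term j.
Proof.
move=> j5 hz hw; have p0 := pi_gt0 R.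
have s0 : 0 < sin (z / 2) by apply: sin_gt0_pi; lra.
have c0 : 0 < cos (z / 2) by apply: cos_gt0_pihalf; lra.
rewrite /hess_sign_fun; set w := k%:R * (z / 2).
have w2 : k%:R * z = w + w by rewrite /w; field.
have sg1 (e : R) : sgz ((- (e / sin (z / 2))) ^+ m1) = (- sgz e) ^+ m1.
  by rewrite sgzX sgzN sgzM [sgz _^-1]gtr0_sgz ?invr_gt0 // mulr1.
have sg2 (e : R) : sgz ((e / cos (z / 2)) ^+ m2) = (sgz e) ^+ m2.
  by rewrite sgzX sgzM [sgz _^-1]gtr0_sgz ?invr_gt0 // mulr1.
rewrite sgzM sg1 sg2; rewrite w2 in hw.
clearbody w; case: j j5 hw => [|[|[|[|[|//]]]]] _ hw; rewrite /degree_term /=.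
- rewrite (gtr0_sgz (sin_gt0_pi _)); last by lra.
  by rewrite (gtr0_sgz (cos_gt0_pihalf _)) ?expr1n ?mulr1 //; lra.
- rewrite (gtr0_sgz (sin_gt0_pi _)); last by lra.
  rewrite (ltr0_sgz (_ : cos w < 0)) //.
  rewrite (_ : w = w - pi / 2 + pi / 2) ?cosDpihalf; last by rewrite subrK.
  by rewrite oppr_lt0; apply: sin_gt0_pi; lra.
- have e1 : w = (w - pi) + pi by rewrite subrK.
  have sw : 0 < sin (w - pi) by apply: sin_gt0_pi; lra.
  have cw : 0 < cos (w - pi) by apply: cos_gt0_pihalf; lra.
  rewrite e1 sinDpi cosDpi !ltr0_sgz ?oppr_lt0 // opprK expr1n mul1r //.
- have e1 : w = (w - pi) + pi by rewrite subrK.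
  have sw : 0 < sin (w - pi) by apply: sin_gt0_pi; lra.
  have cw : 0 < sin (w - pi - pi / 2) by apply: sin_gt0_pi; lra.
  rewrite e1 sinDpi cosDpi (ltr0_sgz (_ : - sin (w - pi) < 0)) ?oppr_lt0 //.
  rewrite (_ : w - pi = w - pi - pi / 2 + pi / 2); last by rewrite subrK.
  by rewrite cosDpihalf !opprK gtr0_sgz // !expr1n mulr1.
- have p2 : pi *+ 2 = pi + pi :> R by rewrite mulr2n.
  have e1 : w = (w - pi *+ 2) + pi *+ 2 by rewrite subrK.
  have sw : 0 < sin (w - pi *+ 2) by apply: sin_gt0_pi; rewrite p2; lra.
  have cw : 0 < cos (w - pi *+ 2) by apply: cos_gt0_pihalf; rewrite p2; lra.
  by rewrite e1 sinD2pi cosD2pi !gtr0_sgz // expr1n mulr1.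
Qed.

Lemma degree_term_neq0 j : (j < 5)%N -> degree_term j != 0.
Proof.
have h (p : nat) : (-1) ^+ p != 0 :> int by rewrite signr_eq0.
by case: j => [|[|[|[|[|//]]]]] _ //=; rewrite oppr_eq0 ?mulf_neq0.
Qed.

Lemma dot_Phi x : S x -> dot (Phi x) (Phi x) = 1.
Proof. exact: Phi_sphere. Qed.

Lemma dot_x_Phi x : dot x (Phi x) = peval F x.
Proof. exact: dot_gradient_map. Qed.

Lemma peval_sphere_itv x : S x -> -1 <= peval F x <= 1.
Proof.
move=> Sx; have h1 := dot_ge0 (x - Phi x); have h2 := dot_ge0 (x + Phi x).
have e1 : dot (x - Phi x) (x - Phi x) = 2 - 2 * peval F x.
  rewrite -dot_x_Phi; have := dot_Phi Sx; move: (Phi x) => z hz.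
  by rewrite !dot_bilinear hz Sx (dotC z); ring.
have e2 : dot (x + Phi x) (x + Phi x) = 2 + 2 * peval F x.
  rewrite -dot_x_Phi; have := dot_Phi Sx; move: (Phi x) => z hz.
  by rewrite !dot_bilinear hz Sx (dotC z); ring.
by rewrite e1 in h1; rewrite e2 in h2; apply/andP; split; lra.
Qed.

(** The equality case of the Cauchy-Schwarz inequality for the unit vectors [x] and [Phi x], whose
    product is [F x]. *)
Lemma Phi_focal x : S x -> peval F x ^+ 2 = 1 -> Phi x = peval F x *: x.
Proof.
move=> Sx h; apply/eqP; rewrite -subr_eq0 -dot_eq0.
have := dot_Phi Sx; have := dot_x_Phi x; move: (Phi x) => z hz zz.
rewrite !dot_bilinear zz Sx (dotC z) hz; apply/eqP.
transitivity (1 - peval F x ^+ 2); first by ring.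
by rewrite h subrr.
Qed.

Lemma chord_coef01 c (z : R) : c = cos z ->
  let pq := chord_coef k 0 1 c in
  pq.1 + pq.2 * c = cos (z - k%:R * z) /\ pq.2 * sin z = sin (z - k%:R * z).
Proof.
move=> ->; have := @chord_coef_polar R k 0 1 z 1 z.
by rewrite !mul1r add0r expr1n !mul1r; apply.
Qed.

Lemma Phi_Phi x : S x -> Phi (Phi x) = (chord_coef k 0 1 (peval F x)).1 *: x +
    (chord_coef k 0 1 (peval F x)).2 *: Phi x.
Proof. by move=> Sx; rewrite -Phi_chord // scale0r add0r scale1r. Qed.

(** [F (Phi x)] is the product of [Phi x] and [Phi (Phi x)], and the latter is the chord with
    [a = 0], [b = 1]. *)
Lemma peval_Phi x (z : R) : S x -> peval F x = cos z -> peval F (Phi x) = cos (k%:R * z).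
Proof.
move=> Sx hz; rewrite -dot_x_Phi Phi_Phi //.
have [h1 h2] := chord_coef01 hz; move: h1 h2.
set p := (chord_coef _ _ _ _).1; set q := (chord_coef _ _ _ _).2 => h1 h2.
have := dot_Phi Sx; have := dot_x_Phi x; move: (Phi x) => w hw ww.
rewrite dotDr !dotZr ww mulr1 (dotC w) hw hz.
rewrite hz in h1.
have -> : k%:R * z = z - (z - k%:R * z) by ring.
rewrite cosB -h1 -h2; have s2 := sin2cos2 z.
transitivity (cos z * (p + q * cos z) + q * (1 - cos z ^+ 2)); first by ring.
by rewrite -s2; ring.
Qed.

(* Put [z = g tau(x)].  In the complex coordinate of the normal great circle
   through [x] in which [x] is [1], the points [y = Phi x] and [Phi y] are
   [exp (- i z)] and [exp (i (g - 2) z)]; this solves [x = a y + b Phi y]. *)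
Definition preimage_point y (z : R) : 'rV[R]_n.+2 :=
  (cos z - sin z / sin (k%:R * z) * cos (k%:R * z)) *: y +
  (sin z / sin (k%:R * z)) *: Phi y.

Lemma preimage_pointP y (z : R) : S y -> peval F y = cos (k%:R * z) ->
  sin (k%:R * z) != 0 ->
  [/\ S (preimage_point y z), Phi (preimage_point y z) = y &
      peval F (preimage_point y z) = cos z].
Proof.
move=> Sy hy s0; set b := sin z / sin (k%:R * z).
set a := cos z - b * cos (k%:R * z).
have ha : a + b * cos (k%:R * z) = cos z by rewrite subrK.
have hb : b * sin (k%:R * z) = sin z by rewrite divfK.
have hPhi : Phi (preimage_point y z) = y.
  rewrite /preimage_point -/b -/a Phi_chord // hy.
  (* [a] and [b] are chosen so that [a + b u = exp (i z)] for [u = exp (i k z)]. Then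
     [p + q u = exp (i (k z - k z)) = 1], whence [p = 1] and [q = 0]. *)
  have [||h1 h2] := @chord_coef_polar R k a b (k%:R * z) 1 z; rewrite ?mul1r //.
  move: h1 h2; rewrite expr1n !mul1r subrr cos0 sin0.
  set p := (chord_coef _ _ _ _).1; set q := (chord_coef _ _ _ _).2 => h1 h2.
  have q0 : q = 0 by apply/eqP; move/eqP: h2; rewrite mulf_eq0 (negbTE s0) orbF.
  by move: h1; rewrite q0 mul0r addr0 => ->; rewrite scale1r scale0r addr0.
split=> //.
  rewrite /sphere /= /preimage_point -/b -/a.
  have := dot_Phi Sy; have := dot_x_Phi y; move: (Phi y) => w h1 h2.
  rewrite !dot_bilinear h2 Sy (dotC w) h1 hy.
  transitivity ((a + b * cos (k%:R * z)) ^+ 2 + b ^+ 2 * (1 - cos (k%:R * z) ^+ 2)).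
    by ring.
  by rewrite ha -sin2cos2 -exprMn hb cos2Dsin2.
rewrite -dot_x_Phi hPhi /preimage_point -/b -/a.
have := dot_x_Phi y; move: (Phi y) => w h; rewrite dotDl !dotZl Sy.
by rewrite (dotC w) h hy mulr1 ha.
Qed.

Lemma preimage_point_unique x y (z : R) : S x -> Phi x = y -> peval F x = cos z ->
  sin (k%:R * z) != 0 -> x = preimage_point y z.
Proof.
move=> Sx <- hz s0; rewrite /preimage_point Phi_Phi // hz.
have [h1 h2] := chord_coef01 (erefl (cos z)); move: h1 h2.
set p := (chord_coef _ _ _ _).1; set q := (chord_coef _ _ _ _).2 => h1 h2.
set b := sin z / sin (k%:R * z); set a := cos z - b * cos (k%:R * z).
have hp : p = cos (z - k%:R * z) - q * cos z by rewrite -h1 addrK.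
have e : k%:R * z = z - (z - k%:R * z) by ring.
(* As [Phi y = p x + q y], the preimage point is [b p x + (a + b q) y]; it remains to evaluate the
   two coefficients. *)
have bp : b * p = 1.
  rewrite /b mulrAC (_ : sin z * p = sin (k%:R * z)) ?divff // hp.
  transitivity (sin z * cos (z - k%:R * z) - cos z * (q * sin z)); first by ring.
  by rewrite h2 [in RHS]e [RHS]sinB; ring.
have aq : a + b * q = 0.
  apply: (mulfI s0); rewrite mulr0 /a /b.
  transitivity (sin (k%:R * z) * cos z - cos (k%:R * z) * sin z + q * sin z).
    by field.
  by rewrite -sinB h2 -{1}opprB sinN addNr.
move: (Phi x) => w; rewrite scalerDr !scalerA addrCA -scalerDl aq scale0r addr0 bp scale1r //.
Qed.

Section Nonfocal.
Variable y : 'rV[R]_n.+2.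
Hypothesis Sy : S y.
Hypothesis nf : peval F y ^+ 2 != 1.
Local Notation b := (peval F y).

Let b_itv : -1 < b < 1.
Proof.
have /andP[h1 h2] := peval_sphere_itv Sy.
rewrite !lt_neqAle h1 h2 !andbT; apply/andP; split.
  by apply: contra nf => /eqP <-; rewrite sqrrN expr1n.
by apply: contra nf => /eqP ->; rewrite expr1n.
Qed.

Let sb_itv (j : nat) : -1 < (-1) ^+ j * b < 1.
Proof.
rewrite -signr_odd; case: (odd j); rewrite ?mul1r // mulN1r.
by have := b_itv; move=> /andP[h1 h2]; apply/andP; split; lra.
Qed.

(** The solution [z] of [cos (k z) = F y] with [k z] between [j pi] and [(j + 1) pi]; the sign in
    [acos] compensates the shift of the cosine by [j pi]. *)
Definition fiber_angle (j : nat) : R := (j%:R * pi + acos ((-1) ^+ j * b)) / k%:R.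

Lemma fiber_angleE j : k%:R * fiber_angle j = j%:R * pi + acos ((-1) ^+ j * b).
Proof. by rewrite /fiber_angle [LHS]mulrC divfK ?gt_eqF. Qed.

Lemma fiber_angle_itv j : j%:R * pi < k%:R * fiber_angle j < j.+1%:R * pi.
Proof.
have /andP[h1 h2] := sb_itv j.
rewrite fiber_angleE -natr1 mulrDl mul1r ltrDl ltrD2l.
by rewrite acos_gt0 ?acos_ltpi ?h1 ?h2 ?(ltW h1) ?(ltW h2).
Qed.

Lemma fiber_angle_pi j : (j < k)%N -> 0 < fiber_angle j < pi.
Proof.
move=> jk; have /andP[h1 h2] := fiber_angle_itv j; have p0 := pi_gt0 R.
have h0 : 0 <= j%:R * pi :> R by rewrite mulr_ge0 // ltW.
have h3 : j.+1%:R * pi <= k%:R * pi :> R by rewrite ler_pM2r // ler_nat.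
apply/andP; split; first by rewrite -(pmulr_rgt0 _ k_gt0) (le_lt_trans h0).
by rewrite -(ltr_pM2l k_gt0) (lt_le_trans h2).
Qed.

Lemma cos_fiber_angle j : cos (k%:R * fiber_angle j) = b.
Proof.
have /andP[h1 h2] := sb_itv j.
rewrite fiber_angleE addrC cosDnpi acosK.
  by rewrite mulrA -exprMn mulrNN mulr1 expr1n mul1r.
by rewrite in_itv /= (ltW h1) (ltW h2).
Qed.

Lemma sin_neq0_nonfocal (z : R) : cos (k%:R * z) = b -> sin (k%:R * z) != 0.
Proof.
move=> h; rewrite -sqrf_eq0 sin2cos2 h subr_eq0 eq_sym.
exact: nf.
Qed.

Definition fiber_point (j : nat) := preimage_point y (fiber_angle j).

Lemma fiber_pointP j :
  [/\ S (fiber_point j), Phi (fiber_point j) = y &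
      peval F (fiber_point j) = cos (fiber_angle j)].
Proof.
have h := cos_fiber_angle j.
by apply: preimage_pointP => //; exact: sin_neq0_nonfocal.
Qed.

Lemma fiber_nonfocal :
  sphere_fiber Phi y = [set` [seq fiber_point j | j <- iota 0 k]].
Proof.
apply/seteqP; split=> [x [Sx xy]|x /= /mapP[j _ ->]]; last first.
  by have [] := fiber_pointP j.
have hx := peval_sphere_itv Sx; have p0 := pi_gt0 R.
set z := acos (peval F x).
have hz : peval F x = cos z by rewrite acosK // in_itv.
have z0 : 0 <= z by rewrite acos_ge0.
have zpi : z <= pi by rewrite acos_lepi.
have hk := peval_Phi Sx hz; rewrite xy in hk.
have s0 := sin_neq0_nonfocal (esym hk).
pose j := Num.truncn (k%:R * z / pi).
have kz0 : 0 <= k%:R * z by rewrite mulr_ge0 // ltW.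
have /andP[] := truncn_itv (divr_ge0 kz0 (ltW p0)).
rewrite -/j ler_pdivlMr // ltr_pdivrMr // => j1 j2.
have hj : acos ((-1) ^+ j * b) = k%:R * z - j%:R * pi.
  rewrite -(@cosK R (k%:R * z - j%:R * pi)); last first.
    by rewrite in_itv /= subr_ge0 j1 /=; move: j2; rewrite -natr1; lra.
  congr acos; rewrite hk -{1}(subrK (j%:R * pi) (k%:R * z)) cosDnpi.
  by rewrite mulrA -exprMn mulrNN mulr1 expr1n mul1r.
have zj : z = fiber_angle j.
  by rewrite /fiber_angle hj addrC subrK mulrC mulKf // gt_eqF.
(* Only [z = pi] would give [j = k], and it is excluded by [sin (k z) != 0]. *)
have jk : (j < k)%N.
  rewrite -(ltr_nat R) -(ltr_pM2r p0); apply: (le_lt_trans j1).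
  rewrite lt_neqAle ler_pM2l // zpi andbT.
  by apply: contraNneq s0 => ->; rewrite -[_ * pi]add0r sinDnpi sin0 mulr0.
apply/mapP; exists j; first by rewrite mem_iota.
by apply: preimage_point_unique => //; rewrite -zj.
Qed.

Lemma fiber_point_uniq : uniq [seq fiber_point j | j <- iota 0 k].
Proof.
rewrite map_inj_in_uniq ?iota_uniq // => i j; rewrite !mem_iota !add0n => ik jk hij.
have [_ _ hi] := fiber_pointP i; have [_ _ hj] := fiber_pointP j.
have /andP[i0 i1] := fiber_angle_pi ik; have /andP[j0 j1] := fiber_angle_pi jk.
have aij : fiber_angle i = fiber_angle j.
  by apply: cos_inj; rewrite ?in_itv /= ?ltW // -hi -hj hij.
have p0 := pi_gt0 R.
have /andP[hi1 hi2] := fiber_angle_itv i; have /andP[hj1 hj2] := fiber_angle_itv j.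
rewrite aij in hi1 hi2; apply/eqP; rewrite eqn_leq -ltnS -[(j <= i)%N]ltnS.
have := lt_trans hi1 hj2; rewrite ltr_pM2r // ltr_nat => ->.
by have := lt_trans hj1 hi2; rewrite ltr_pM2r // ltr_nat.
Qed.

Lemma local_degree_fiber_point j : (j < k)%N ->
  local_degree Phi (fiber_point j) = degree_term j.
Proof.
move=> jk; have [Sx _ hx] := fiber_pointP j.
rewrite (local_degree_hess g2 hF Sx) det_hessE // hx P_cos ?fiber_angle_pi //.
rewrite mulNr sgzN sgzM (gtr0_sgz C_gt0) mul1r.
apply: sgz_hess_sign; [exact: leq_trans jk k_le5|exact: fiber_angle_pi|].
exact: fiber_angle_itv.
Qed.

Lemma regular_nonfocal : sphere_regular_value Phi y.
Proof.
split=> // x; rewrite fiber_nonfocal /= => /mapP[j]; rewrite mem_iota add0n => jk ->.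
have := local_degree_fiber_point jk; rewrite /local_degree => h.
by rewrite -sgz_eq0 h degree_term_neq0 // (leq_trans jk).
Qed.

Lemma degree_nonfocal : finite_set (sphere_fiber Phi y) /\
  \sum_(x \in sphere_fiber Phi y) local_degree Phi x =
  \sum_(j <- iota 0 k) degree_term j.
Proof.
rewrite fiber_nonfocal; split; first exact: finite_seq.
rewrite -fsbig_seq ?fiber_point_uniq // big_map big_seq [RHS]big_seq.
by apply: eq_bigr => j; rewrite mem_iota add0n => /local_degree_fiber_point.
Qed.

End Nonfocal.

Lemma continuous_Phi : continuous Phi.
Proof.
by move=> x; exact/differentiable_continuous/polymap_differentiable/gradient_map_polymap.
Qed.

(* The image of the compact set [c1 <= F <= c2] is closed, and nonfocal points
   are dense. *)
Lemma preimage_closure (c1 c2 : R) (O : set 'rV[R]_n.+2) y : open O -> O y -> S y ->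
  (forall y', S y' -> O y' -> peval F y' ^+ 2 != 1 ->
     exists x, [/\ S x, Phi x = y' & c1 <= peval F x <= c2]) ->
  exists x, [/\ S x, Phi x = y & c1 <= peval F x <= c2].
Proof.
move=> oO Oy Sy hO.
pose K := S `&` ([set x | peval F x <= c2] `&` [set x | - peval F x <= - c1]).
have cF : continuous (peval F) by exact: continuous_peval.
have cNF : continuous (fun x => - peval F x).
  exact: (subalgebraN (continuous_subalgebra R _)).
have cK : compact K.
  apply: subsphere_compact => [x []//|].
  apply: closedI; first exact: sphere_closed.
  by apply: closedI; exact: closed_preimage_le.
have cA : closed (Phi @` K).
  apply: compact_closed; first exact: norm_hausdorff.
  by apply: continuous_compact => //; apply: continuous_subspaceT; exact: continuous_Phi.
have [x [Sx [x2 x1]] xy] : (Phi @` K) y.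
  apply: cA => B; rewrite nbhsE => -[B' [oB' B'y] B'B].
  have [z [[Oz B'z] Sz nz]] := nonfocal_approx (openI oO oB') (conj Oy B'y) Sy.
  have [x [Sx xz /andP[hx1 hx2]]] := hO z Sz Oz nz.
  exists z; split; last exact: B'B.
  by exists x => //; split=> //; split=> //=; rewrite lerN2.
by exists x; split=> //; rewrite x2 andbT -lerN2.
Qed.

(** With [F x = cos z] and [w = k z / 2], the hypothesis on [Phi x] gives
    [2 sin w cos w = sin (k z) = 0]. So one of the two numerators in [hess_sign_fun] vanishes, and
    both exponents are positive. *)
Lemma degenerate x : S x -> peval F x ^+ 2 != 1 -> peval F (Phi x) ^+ 2 = 1 ->
  \det (sphere_diff_mx Phi x) = 0.
Proof.
move=> Sx nx hx; apply/eqP; rewrite -sgz_eq0 -[sgz _]/(local_degree Phi x).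
rewrite (local_degree_hess g2 hF Sx) sgz_eq0 det_hessE // mulf_eq0; apply/orP; right.
have /andP[h1 h2] := peval_sphere_itv Sx.
set z := acos (peval F x).
have hz : peval F x = cos z by rewrite acosK // in_itv /= h1.
have z0 : 0 < z.
  apply: acos_gt0; rewrite h1 lt_neqAle h2 andbT.
  by apply: contra nx => /eqP ->; rewrite expr1n.
have zpi : z < pi.
  apply: acos_ltpi; rewrite h2 andbT lt_neqAle h1 andbT eq_sym.
  by apply: contra nx => /eqP ->; rewrite sqrrN expr1n.
rewrite hz P_cos ?z0 //; have := peval_Phi Sx hz => hk.
have : sin (k%:R * z) ^+ 2 = 0 by rewrite sin2cos2 -hk hx subrr.
have -> : k%:R * z = 2 * (k%:R * (z / 2)) by field.
rewrite /hess_sign_fun sin_double; move: (k%:R * (z / 2)) => w /eqP.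
rewrite sqrf_eq0 mulf_eq0 mulf_eq0 pnatr_eq0 /= mulf_eq0 !expf_eq0 m1_gt0 m2_gt0 /=.
by rewrite oppr_eq0 !mulf_eq0 => /orP[->|->]; rewrite ?orbT.
Qed.

Lemma focal_regular y : S y -> peval F y ^+ 2 = 1 -> sphere_regular_value Phi y ->
  g = 2%N \/ (g = 3%N /\ peval F y = 1).
Proof.
move=> Sy fy [_ ry]; have p0 := pi_gt0 R.
(* The limit of such preimages is a nonfocal preimage of the focal point [y], at which the
   differential degenerates, against regularity of [y]. *)
have key (c1 c2 : R) (O : set 'rV[R]_n.+2) : -1 < c1 -> c2 < 1 -> open O -> O y ->
    (forall y', S y' -> O y' -> peval F y' ^+ 2 != 1 ->
       exists x, [/\ S x, Phi x = y' & c1 <= peval F x <= c2]) -> False.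
  move=> hc1 hc2 oO Oy hO; have [x [Sx xy /andP[x1 x2]]] := preimage_closure oO Oy Sy hO.
  have /negP := ry x (conj Sx xy); apply; apply/eqP; apply: degenerate => //.
    have x3 : -1 < peval F x by exact: lt_le_trans x1.
    have x4 : peval F x < 1 by exact: le_lt_trans hc2.
    by rewrite -subr_eq0 subr_sqr_1 mulf_neq0 // ?subr_eq0 ?(lt_eqF x4) //
      lt0r_neq0 //; lra.
  by rewrite xy.
have cle (a b' : R) : 0 <= a -> a <= b' -> b' <= pi -> cos b' <= cos a.
  move=> h1 h2 h3; rewrite leNgt; apply/negP => h4.
  have : b' < a by rewrite -(@ltr_cos R) // in_itv /=; apply/andP; split; lra.
  by rewrite ltNge h2.
(* For [k >= 3] there is a middle interval: the fiber point of index 1 has its angle between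
   [w = pi / k] and [2 w < pi], wherever [y'] is. *)
have big3 : (3 <= k)%N -> False.
  move=> k3; have k3' : 3 <= k%:R :> R by rewrite (ler_nat _ 3).
  have w : 0 < pi / k%:R :> R /\ 3 * (pi / k%:R) <= pi :> R.
    split; first by rewrite divr_gt0.
    by rewrite mulrCA -[leRHS]mulr1 ler_pM2l // ler_pdivrMr // mul1r.
  have wk : k%:R * (pi / k%:R) = pi :> R by rewrite mulrC divfK // gt_eqF.
  move: w wk; move: (pi / k%:R) => w [w0 w1] wk.
  apply: (key (cos (2 * w)) (cos w) setT) => //.
  - by rewrite -cospi ltr_cos // ?in_itv /=; try (apply/andP; split); lra.
  - by rewrite -cos0 ltr_cos // ?in_itv /=; try (apply/andP; split); lra.
  - exact: openT.
  move=> y' Sy' _ ny'; exists (fiber_point y' 1); have [h1 h2 h3] := fiber_pointP Sy' ny' 1.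
  split=> //; rewrite h3.
  have /andP[a1 a2] := fiber_angle_itv Sy' ny' 1.
  have a3 : w < fiber_angle y' 1.
    by rewrite -(ltr_pM2l k_gt0) wk (le_lt_trans _ a1) // mul1r.
  have a4 : fiber_angle y' 1 < 2 * w.
    by rewrite -(ltr_pM2l k_gt0) [ltRHS]mulrCA wk.
  by rewrite !cle //; lra.
move: hg big3; rewrite !inE => /or4P[] /eqP g_eq; rewrite g_eq /= => big3;
  [by left| |by case: (big3 isT)|by case: (big3 isT)].
right; split=> //.
move/eqP: fy; rewrite sqrf_eq1 => /orP[/eqP //|/eqP fy].
have c4 : cos (pi / 4) < cos 0 :> R.
  by rewrite ltr_cos // ?in_itv /=; try (apply/andP; split); lra.
(* For [g = 3] and [F y = -1], nearby points have [F y' < 0], so the angle [acos (F y') / 2] of the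
   fiber point of index 0 lies between [pi / 4] and [pi / 2]. *)
exfalso; apply: (key 0 (cos (pi / 4)) [set z | peval F z < 0]).
- by [].
- by rewrite -[ltRHS](cos0 R).
- apply: (@open_comp _ _ (peval F) [set x : R | x < 0]); last exact: open_lt.
  by move=> x _; exact: continuous_peval.
- by rewrite /= fy oppr_lt0.
move=> y' Sy' /= Oy' ny'; exists (fiber_point y' 0); have [h1 h2 h3] := fiber_pointP Sy' ny' 0.
split=> //; rewrite h3.
have b1 : -1 <= peval F y' <= 1 := peval_sphere_itv Sy'.
have ha : pi / 2 < acos (peval F y').
  have hin : acos (peval F y') \in `[0, pi] by rewrite in_itv /= acos_ge0 // acos_lepi.
  rewrite -(@ltr_cos R) ?acosK ?in_itv // ?cos_pihalf //=; try (apply/andP; split); try lra.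
have hb : acos (peval F y') <= pi by exact: acos_lepi.
have a0 : fiber_angle y' 0 = acos (peval F y') / 2.
  by rewrite /fiber_angle g_eq /= mul0r add0r expr0 mul1r.
rewrite a0 cos_ge0_pihalf ?cle //; try (apply/andP; split); lra.
Qed.

Lemma degree_focal y : S y -> peval F y ^+ 2 = 1 -> sphere_regular_value Phi y ->
  finite_set (sphere_fiber Phi y) /\
  \sum_(x \in sphere_fiber Phi y) local_degree Phi x =
  \sum_(j <- iota 0 k) degree_term j.
Proof.
move=> Sy fy ry; have hd x : S x -> local_degree Phi x = - sgz P.[peval F x].
  move=> Sx; rewrite (local_degree_hess g2 hF Sx) det_hessE //.
  by rewrite mulNr sgzN sgzM (gtr0_sgz C_gt0) mul1r.
have Py := Phi_focal Sy fy.
have [g_eq|[g_eq fy1]] := focal_regular Sy fy ry.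
  (* For [g = 2] the map is homogeneous of degree 1 and preserves [F], so every preimage [x] of [y]
     is focal with [y = F(y) x]. *)
  have Phi_hom (r : R) x : Phi (r *: x) = r *: Phi x.
    by rewrite (gradient_map_homog hF) g_eq expr1.
  have hfib : sphere_fiber Phi y = [set` [:: peval F y *: y]].
    apply/seteqP; split=> [x [Sx xy]|x /=]; rewrite ?inE.
      have hx := peval_sphere_itv Sx.
      have hz : peval F x = cos (acos (peval F x)) by rewrite acosK // in_itv.
      have := peval_Phi Sx hz; rewrite xy g_eq /= mul1r -hz => yx.
      rewrite yx -xy Phi_focal ?scalerA -?expr2 -?yx ?fy ?scale1r //.
      by rewrite inE.
    move=> /eqP ->; split.
      by rewrite /sphere /= !dot_bilinear Sy mulr1 -expr2 fy.
    by rewrite Phi_hom Py scalerA -expr2 fy scale1r.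
  rewrite hfib; split; first exact: finite_seq.
  rewrite -fsbig_seq // big_seq1 hd; last first.
    by rewrite /sphere /= !dot_bilinear Sy mulr1 -expr2 fy.
  by rewrite g_eq big_seq1 P_2 // sgzX sgzN1 /degree_term.
rewrite fy1 scale1r in Py.
have hNy : Phi (- y) = y.
  by rewrite -scaleN1r (gradient_map_homog hF) Py g_eq sqrrN expr1n scale1r.
have SNy : S (- y) by rewrite /sphere /= dotNl dotNr opprK.
have FNy : peval F (- y) = - 1 by rewrite -dot_x_Phi hNy dotNl Sy.
have hfib : sphere_fiber Phi y = [set` [:: y; - y]].
  apply/seteqP; split=> [x [Sx xy]|x /=]; last first.
    by rewrite !inE => /orP[] /eqP ->; split.
  have hx := peval_sphere_itv Sx.
  have hz : peval F x = cos (acos (peval F x)) by rewrite acosK // in_itv.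
  (* For [g = 3] this reads [1 = 2 (F x)^2 - 1], so every preimage is focal. *)
  have := peval_Phi Sx hz; rewrite xy g_eq /= cos_double -hz fy1 => yx.
  have fx : peval F x ^+ 2 = 1 by lra.
  have := Phi_focal Sx fx; rewrite xy => ->; rewrite !inE.
  move/eqP: fx; rewrite sqrf_eq1 => /orP[] /eqP ->; first by rewrite scale1r eqxx.
  by rewrite scaleN1r opprK eqxx orbT.
have yNy : y != - y.
  apply/eqP => h; have := FNy; rewrite -h fy1 => /eqP.
  by rewrite -subr_eq0 opprK -[1 + 1]/(2%:R) pnatr_eq0.
rewrite hfib; split; first exact: finite_seq.
rewrite -fsbig_seq /= ?inE ?andbT // !big_cons !big_nil !hd // fy1 FNy g_eq /=.
rewrite !big_cons !big_nil.
(* The local degrees at [y] and [- y] are [- (-1)^m1] and [-1]; the latter is [degree_term 1]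
   because [m1 = m2]. *)
rewrite !P_3 // mulrN1 opprK mulr1 !sgzX sgzN.
by rewrite (gtr0_sgz (_ : 0 < 2)) // expr1n /degree_term P_3_multiplicity // -expr2 sqrr_sign.
Qed.

Theorem brouwer_degree_gradient_map :
  brouwer_degree Phi (\sum_(j <- iota 0 k) degree_term j).
Proof.
split.
- exact/polymap_smooth/gradient_map_polymap.
- by move=> x; exact: Phi_sphere.
- have S1 : S (delta_mx 0 0).
    rewrite /sphere /= /dot (bigD1 0) //= big1 => [|i i0].
      by rewrite mxE !eqxx mulr1 addr0.
    by rewrite mxE (negbTE i0) andbF mul0r.
  have [z [_ Sz nz]] := nonfocal_approx openT I S1.
  by exists z; exact: regular_nonfocal.
- move=> y ry; have [Sy _] := ry.
  have [fy|fy] := eqVneq (peval F y ^+ 2) 1; first exact: degree_focal.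
  exact: degree_nonfocal.
Qed.

End Degree.

Lemma isoparametric_degree (R : realType) (n g m1 m2 : nat)
    (F : mpoly.mpoly n.+2 R) :
  g \in [:: 2; 3; 4; 6]%N -> isoparametric_polynomial g m1 m2 F ->
  brouwer_degree (gradient_map g F)
    (\sum_(j <- iota 0 g.-1) degree_term m1 m2 j).
Proof.
move=> hg [M [xi [theta [m [iso hFM -> ->]]]]].
have g2 : (2 <= g)%N by move: hg; rewrite !inE => /or4P[] /eqP ->.
have -> : minn 2 g = 2%N by apply/minn_idPl.
have [hF _] := hFM; have [M' cov] := exists_covered iso hFM.
have [P [P_cos P_2 P_3]] := hess_sign_poly hg iso cov hF.
have [C C_gt0 hC] := det_hess_covered hg iso cov hF P_cos.
have [m3 _ _] := multiplicities g2 iso cov hF.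
apply: (brouwer_degree_gradient_map hg hF _ _ _ C_gt0 _ P_cos P_2 P_3).
- exact: (gradient_map_sphere g2 iso cov hF).
- exact: (gradient_map_chord g2 iso cov hF).
- exact: (nonfocal_dense g2 iso cov hF).
- exact: (det_hess_sphere cov hC).
- by move=> /m3[].
- by apply: (iso_mult_gt0 iso); rewrite (leq_trans _ g2).
- by apply: (iso_mult_gt0 iso).
Qed.

Theorem corollary2p1 (R : realType) (n g m1 m2 : nat)
    (F : mpoly.mpoly n.+2 R)
    (hF : isoparametric_polynomial g m1 m2 F) :
  [/\ g = 2%N -> brouwer_degree (gradient_map g F) ((-1) ^+ (m1 + 1)),
      g = 3%N -> brouwer_degree (gradient_map g F)
        ((-1) ^+ (m1 + 1) + (-1) ^+ (m1 + m2 + 1)),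
      g = 4%N -> brouwer_degree (gradient_map g F)
        ((-1) ^+ (m1 + 1) + (-1) ^+ (m1 + m2 + 1) + (-1) ^+ (m2 + 1)) &
      g = 6%N -> brouwer_degree (gradient_map g F)
        (2 * (-1) ^+ (m1 + 1) + (-1) ^+ (m1 + m2 + 1)
         + (-1) ^+ (m2 + 1) - 1)].
Proof.
have e : g \in [:: 2; 3; 4; 6]%N -> forall d,
    \sum_(j <- iota 0 g.-1) degree_term m1 m2 j = d ->
    brouwer_degree (gradient_map g F) d.
  by move=> hg d <-; exact: isoparametric_degree.
(* For [g = 6] the intervals [j = 0] and [j = 4] contribute the same sign, whence the coefficient 2,
   and [j = 3] gives the final [- 1]. *)
split=> g_eq; apply: e; rewrite g_eq //= !big_cons big_nil /degree_term !exprD expr1;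
  ring.
Qed.
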